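(* Let $n\geq 4$ and $\ell\geq 1$ be integers. There exists a Riemannian product $M^{n+\ell}=N^n\times\mathbb{R}^\ell$, where $\mathbb{R}^\ell$ carries the flat Euclidean metric and $(N^n,g_N)$ is an Einstein warped product (of the form described in the context) satisfying $\mathrm{Ric}^N=\rho\,g_N$ for some real constant $\rho\neq 0$, with the following properties: (i) $M^{n+\ell}$ has exactly two distinct constant Ricci eigenvalues, namely $0$ and $\rho$, with multiplicities $\ell$ and $n$ respectively; (ii) $M^{n+\ell}$ is curvature inhomogeneous; (iii) $M^{n+\ell}$ admits a local isometric immersion into $\mathbb{R}^{n+\ell+2}$ with flat normal bundle, and the codimension two is the smallest possible, i.e. for $q\in\{0,1\}$ no nonempty open subset of $M^{n+\ell}$ admits an isometric immersion into $\mathbb{R}^{n+\ell+q}$.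
   Context: A Riemannian manifold $(M,g)$ is curvature homogeneous if for any two points $p,q\in M$ there is a linear isometry $J\colon T_pM\to T_qM$ with $J^*R_q=R_p$, where $R$ is the Riemann curvature tensor; it is curvature inhomogeneous if it is not curvature homogeneous. $(M,g)$ has constant Ricci eigenvalues if the eigenvalues of the Ricci endomorphism $\widehat{\mathrm{Ric}}$ (the Ricci tensor viewed as a self-adjoint endomorphism of $TM$ via $g$) are constant functions on $M$. A local isometric immersion of $M$ is an isometric immersion defined on a (sufficiently small) nonempty open subset around a point of $M$. Einstein warped products: fix $n\ge 4$ and $\rho\in\mathbb{R}$. Let $c\neq 0$ be a real constant and $\varphi\colon I\to(0,\infty)$ a nonconstant smooth function on an open interval $I$ containing $0$ such that $$\varphi'(t)^2=1-\frac{\rho}{n-1}\varphi(t)^2+\frac{c}{\varphi(t)^{n-3}},\qquad 0<\varphi'(t)^2<1,\qquad t\in I.$$ Let $L^2$ be a coordinate domain (nonempty connected open set) with coordinates $(t,u)$, $t\in I$, with the metric $g_L=dt^2+\varphi'(t)^2\,du^2$. The Einstein warped product is $$N^n=L^2\times_\varphi\mathbb{S}^{n-2},\qquad g_N=dt^2+\varphi'(t)^2\,du^2+\varphi(t)^2 g_{\mathbb{S}^{n-2}},$$ where $g_{\mathbb{S}^{n-2}}$ is the unit round metric. *)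

(* Defs.v *)
From HB Require Import structures.
From mathcomp Require Import all_boot all_order all_algebra.
From mathcomp Require Import all_classical all_reals all_analysis.
Import Order.TTheory GRing.Theory Num.Theory.
Import numFieldNormedType.Exports.

Set Implicit Arguments.
Unset Strict Implicit.
Unset Printing Implicit Defensive.

Local Open Scope classical_set_scope.
Local Open Scope ring_scope.

(* C^oo on an open set U: every iterated directional derivative of f is
   Frechet differentiable at every point of U. *)
Definition smooth_on (R : realType) (V W : normedModType R)
    (U : set V) (f : V -> W) : Prop :=
  forall s : seq V, forall x, U x ->
    differentiable (foldr (fun v h => 'D_v h) f s) x.

(* The Euclidean inner product; the library norm on row vectors is the sup
   norm. *)
Definition dot (R : realType) (N : nat) (u v : 'rV[R]_N) : R :=
  (u *m v^T) 0 0.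

Definition inner (R : realType) (m : nat) (G : 'M[R]_m) (u v : 'rV[R]_m) : R :=
  (u *m G *m v^T) 0 0.

Section LocalGeometry.
Variables (R : realType) (m : nat).
Implicit Types (g : 'rV[R]_m -> 'M[R]_m) (x u v w z : 'rV[R]_m).

(* Gram matrix of the partial derivatives of F: row i of 'J F x is the
   i-th partial derivative of F. *)
Definition induced_metric N (F : 'rV[R]_m -> 'rV[R]_N) x : 'M[R]_m :=
  'J F x *m ('J F x)^T.

Definition partial (i : 'I_m) (f : 'rV[R]_m -> R) : 'rV[R]_m -> R :=
  'D_(delta_mx 0 i) f.

(* Gamma^k_{ij} *)
Definition christoffel g (k i j : 'I_m) x : R :=
  2^-1 * \sum_l invmx (g x) k l *
    (partial i (fun y => g y j l) x + partial j (fun y => g y i l) x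
     - partial l (fun y => g y i j) x).

(* R(d_i, d_j) d_k = \sum_l (riemann_coef g l i j k) d_l, with the convention
   R(X, Y) Z = D_X D_Y Z - D_Y D_X Z - D_[X, Y] Z. *)
Definition riemann_coef g (l i j k : 'I_m) x : R :=
  partial i (christoffel g l j k) x - partial j (christoffel g l i k) x
  + \sum_s (christoffel g l i s x * christoffel g s j k x
            - christoffel g l j s x * christoffel g s i k x).

(* R(u, v) w *)
Definition riemann_op g x u v w : 'rV[R]_m :=
  \row_l \sum_i \sum_j \sum_k
    u 0 i * v 0 j * w 0 k * riemann_coef g l i j k x.

(* g(R(u, v) w, z) *)
Definition riemann g x u v w z : R :=
  inner (g x) (riemann_op g x u v w) z.

(* Ric(Y, Z) = trace of X |-> R(X, Y) Z *)
Definition ricci g x : 'M[R]_m :=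
  \matrix_(j, k) \sum_i riemann_coef g i i j k x.

(* The endomorphism v |-> v *m ricci_endo g x satisfies
   g(v *m ricci_endo g x, w) = Ric(v, w). *)
Definition ricci_endo g x : 'M[R]_m := ricci g x *m invmx (g x).

(* The orthogonal projection onto the normal space of an immersion F, acting
   on row vectors from the right. *)
Definition normal_proj N (F : 'rV[R]_m -> 'rV[R]_N) x : 'M[R]_N :=
  1%:M - ('J F x)^T *m invmx (induced_metric F x) *m 'J F x.

Definition normal_field N (F : 'rV[R]_m -> 'rV[R]_N) (W : set 'rV[R]_m)
    (xi : 'rV[R]_m -> 'rV[R]_N) : Prop :=
  smooth_on W xi /\ forall x, W x -> forall v, dot (v *m 'J F x) (xi x) = 0.

Definition normal_connection N (F : 'rV[R]_m -> 'rV[R]_N) v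
    (xi : 'rV[R]_m -> 'rV[R]_N) : 'rV[R]_m -> 'rV[R]_N :=
  fun x => 'D_v xi x *m normal_proj F x.

(* R^perp(v, w) xi, for constant (hence commuting) vector fields v and w. *)
Definition normal_curvature N (F : 'rV[R]_m -> 'rV[R]_N) v w
    (xi : 'rV[R]_m -> 'rV[R]_N) : 'rV[R]_m -> 'rV[R]_N :=
  fun x => normal_connection F v (normal_connection F w xi) x
           - normal_connection F w (normal_connection F v xi) x.

Definition flat_normal_on N (F : 'rV[R]_m -> 'rV[R]_N) (D : set 'rV[R]_m)
  : Prop :=
  forall (W : set 'rV[R]_m) (xi : 'rV[R]_m -> 'rV[R]_N),
    open W -> W `<=` D -> normal_field F W xi ->
    forall v w x, W x -> normal_curvature F v w xi x = 0.

End LocalGeometry.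

(* The set [points] with parametrizations [chart_param a] from coordinate
   domains of R^m, which also induce its topology [open_in], and the Gram
   matrices of a metric in these coordinates. The axioms making it a smooth
   Riemannian manifold are in [riemannian_manifold]. Only the values of
   [chart_param a] and [chart_metric a] on [chart_dom a] matter. *)
Record riem_atlas (R : realType) (m : nat) := RiemAtlas {
  carrier : Type;
  points : set carrier;
  chart : Type;
  chart_dom : chart -> set 'rV[R]_m;
  chart_param : chart -> 'rV[R]_m -> carrier;
  chart_metric : chart -> 'rV[R]_m -> 'M[R]_m }.

Arguments points {R m} r.
Arguments chart_dom {R m r} _.
Arguments chart_param {R m r} _ _.
Arguments chart_metric {R m r} _ _.

Section Manifold.
Variables (R : realType) (m : nat) (M : riem_atlas R m).

Definition coord_preim (a : chart M) (U : set (carrier M)) : set 'rV[R]_m :=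
  chart_dom a `&` chart_param a @^-1` U.

Definition open_in (U : set (carrier M)) : Prop :=
  U `<=` points M /\ forall a : chart M, open (coord_preim a U).

Definition overlap (a b : chart M) : set 'rV[R]_m :=
  coord_preim a (chart_param b @` chart_dom b).

Definition smooth_manifold : Prop :=
  [/\ forall a : chart M, open (chart_dom a),
      forall a : chart M, {in chart_dom a &, injective (chart_param a)},
      \bigcup_(a : chart M) (chart_param a @` chart_dom a) = points M &
      forall a b : chart M, open (overlap a b) /\
        exists2 tau : 'rV[R]_m -> 'rV[R]_m, smooth_on (overlap a b) tau &
          forall x, overlap a b x -> chart_dom b (tau x) /\
            chart_param b (tau x) = chart_param a x].

Definition hausdorff_manifold : Prop :=
  forall p q, points M p -> points M q -> p <> q ->
    exists U V, [/\ open_in U, open_in V, U p, V q & U `&` V = set0].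

Definition second_countable_manifold : Prop :=
  exists B : nat -> set (carrier M), (forall k, open_in (B k)) /\
    forall U p, open_in U -> U p -> exists k, B k p /\ B k `<=` U.

Definition riemannian_metric : Prop :=
  forall a : chart M,
  [/\ smooth_on (chart_dom a) (chart_metric a),
      forall x, chart_dom a x -> (chart_metric a x)^T = chart_metric a x,
      forall x (v : 'rV[R]_m), chart_dom a x -> v != 0 ->
        0 < inner (chart_metric a x) v v &
      forall (b : chart M) (tau : 'rV[R]_m -> 'rV[R]_m),
        smooth_on (overlap a b) tau ->
        (forall x, overlap a b x -> chart_dom b (tau x) /\
            chart_param b (tau x) = chart_param a x) ->
        forall x, overlap a b x ->
          chart_metric a x
          = 'J tau x *m chart_metric b (tau x) *m ('J tau x)^T].

Definition riemannian_manifold : Prop :=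
  [/\ smooth_manifold, hausdorff_manifold, second_countable_manifold
    & riemannian_metric].

Definition einstein (rho : R) : Prop :=
  forall (a : chart M) x, chart_dom a x ->
    ricci (chart_metric a) x = rho *: chart_metric a x.

(* Tangent spaces are identified with 'rV_m through the charts: x in the chart
   a represents p, y in the chart b represents q, and J acts on the right. *)
Definition curvature_homogeneous : Prop :=
  forall (a b : chart M) x y, chart_dom a x -> chart_dom b y ->
  exists J : 'M[R]_m,
    (forall u v, inner (chart_metric b y) (u *m J) (v *m J)
                 = inner (chart_metric a x) u v) /\
    forall u v w z,
      riemann (chart_metric b) y (u *m J) (v *m J) (w *m J) (z *m J)
      = riemann (chart_metric a) x u v w z.

Definition isometric_immersion N (U : set (carrier M))
    (f : carrier M -> 'rV[R]_N) : Prop :=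
  forall a : chart M,
    smooth_on (coord_preim a U) (f \o chart_param a) /\
    forall x, coord_preim a U x ->
      induced_metric (f \o chart_param a) x = chart_metric a x.

Definition flat_normal_bundle N (U : set (carrier M))
    (f : carrier M -> 'rV[R]_N) : Prop :=
  forall a : chart M, flat_normal_on (f \o chart_param a) (coord_preim a U).

End Manifold.

Section Constructions.
Variable R : realType.

Definition coordinate_domain m (D : set 'rV[R]_m)
    (g : 'rV[R]_m -> 'M[R]_m) : riem_atlas R m :=
  @RiemAtlas R m 'rV[R]_m D unit (fun=> D) (fun=> id) (fun=> g).

Definition euclidean m : riem_atlas R m :=
  coordinate_domain setT (fun=> 1%:M).

(* Inverse stereographic projection from the pole (0, ..., 0, (-1) ^+ s). *)
Definition inv_stereo k (s : bool) (y : 'rV[R]_k) : 'rV[R]_(k + 1) :=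
  row_mx ((2 / (dot y y + 1)) *: y)
         (((-1) ^+ s * ((dot y y - 1) / (dot y y + 1)))%:M).

Definition round_sphere k : riem_atlas R k :=
  @RiemAtlas R k 'rV[R]_(k + 1) [set p | dot p p = 1] bool
    (fun=> setT) (@inv_stereo k) (fun s => induced_metric (@inv_stereo k s)).

(* The metric g_A + (phi \o pr_A)^2 g_B on A x B. *)
Definition warped_product m1 m2 (A : riem_atlas R m1) (phi : carrier A -> R)
    (B : riem_atlas R m2) : riem_atlas R (m1 + m2) :=
  @RiemAtlas R (m1 + m2) (carrier A * carrier B)%type (points A `*` points B)
    (chart A * chart B)%type
    (fun ab => [set x | chart_dom ab.1 (lsubmx x) /\ chart_dom ab.2 (rsubmx x)])
    (fun ab x => (chart_param ab.1 (lsubmx x), chart_param ab.2 (rsubmx x)))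
    (fun ab x => block_mx (chart_metric ab.1 (lsubmx x)) 0
                   0 (phi (chart_param ab.1 (lsubmx x)) ^+ 2
                      *: chart_metric ab.2 (rsubmx x))).

Definition riem_product m1 m2 (A : riem_atlas R m1) (B : riem_atlas R m2) :
    riem_atlas R (m1 + m2) :=
  @RiemAtlas R (m1 + m2) (carrier A * carrier B)%type (points A `*` points B)
    (chart A * chart B)%type
    (fun ab => [set x | chart_dom ab.1 (lsubmx x) /\ chart_dom ab.2 (rsubmx x)])
    (fun ab x => (chart_param ab.1 (lsubmx x), chart_param ab.2 (rsubmx x)))
    (fun ab x => block_mx (chart_metric ab.1 (lsubmx x)) 0
                   0 (chart_metric ab.2 (rsubmx x))).

(* The coordinates (t, u) on L are (p 0 0, p 0 1); this is
   dt^2 + phi'(t)^2 du^2. *)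
Definition base_metric (phi : R -> R) (p : 'rV[R]_2) : 'M[R]_2 :=
  diag_mx (\row_(j < 2) if j == 0 then 1 else (phi^`())%classic (p 0 0) ^+ 2).

Definition warping_function (n : nat) (rho c : R) (I : set R)
    (phi : R -> R) : Prop :=
  [/\ smooth_on I phi,
      forall t, I t -> 0 < phi t,
      ~ (exists k, forall t, I t -> phi t = k),
      forall t, I t -> (phi^`())%classic t ^+ 2 =
        1 - rho / (n - 1)%:R * phi t ^+ 2 + c / phi t ^+ (n - 3) &
      forall t, I t -> 0 < (phi^`())%classic t ^+ 2 < 1].

Definition einstein_warped_product (n : nat) (phi : R -> R)
    (L : set 'rV[R]_2) : riem_atlas R (2 + (n - 2)) :=
  @warped_product 2 (n - 2) (coordinate_domain L (base_metric phi))
    (fun p : 'rV[R]_2 => phi (p 0 0)) (round_sphere (n - 2)).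

End Constructions.

(* Main.v *)
(* Take c = 1/4, rho = (n - 1) / 2 and phi a solution of
   phi' = sqrt (1 - phi^2 / 2 + phi^(3 - n) / 4) near phi = 1. For k = 1 / (n - 2)
   and eta' = sqrt (1 - phi'^2 - k^2 phi''^2), the map
     (t, u, w) |-> (k phi' cos (u / k), k phi' sin (u / k), phi w, eta),
   with w on the unit sphere, is an isometric immersion of N in R^(n + 2) whose
   coordinate directions are principal for every normal vector; times the
   identity of R^l it is the required immersion, and Ricci's equation makes its
   normal bundle flat. By the Gauss equation the curvature tensor is diagonal,
   and with X = c / phi^(n - 1), p = n - 3 its sectional curvatures are
     K(t, u) = 1/2 - p (p + 1) X / 2,    K(t, y) = K(u, y) = 1/2 + p X / 2,
     K(y, y') = 1/2 - X,
   and 0 along R^l. Summing them gives Ric^N = rho g_N and the Ricci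
   eigenvalues. The largest one, K(t, y), is an isometry invariant of the
   curvature tensor that depends on t, so M is curvature inhomogeneous. In
   codimension at most one the second fundamental form takes values in a line, and
   the Gauss equation forces K(t, u) K(y, y') = K(t, y) K(u, y), which fails
   because X < 1/2. *)

Require Import Defs.
From HB Require Import structures.
From mathcomp Require Import all_boot all_order all_algebra.
From mathcomp Require Import all_classical all_reals all_analysis.
From mathcomp Require Import ring lra zify.
Import Order.TTheory GRing.Theory Num.Theory.
Import numFieldNormedType.Exports.

Set Implicit Arguments.
Unset Strict Implicit.
Unset Printing Implicit Defensive.

Local Open Scope classical_set_scope.
Local Open Scope ring_scope.

(** The Christoffel symbols of the metrics are never evaluated. The Gauss equation expresses the
    curvature coefficients through any immersion inducing the metric: the explicit immersion yields
    the curvature of M, a hypothetical one of lower codimension yields the contradiction. For the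
    former it is enough that the second derivatives of the immersion are diagonal in the coordinates
    up to tangent vectors, and the same fact gives the flat normal bundle.

    The parameter k makes room for eta. Radius k phi' and angle u / k give speed phi' in the
    direction u for every k, whereas eta exists only where phi'^2 + k^2 phi''^2 < 1; so k only has
    to be small. At phi = 1 one has phi'^2 = 3/4, the required strict inequalities hold there for k
    = 1 / (n - 2), and they persist nearby.

    K(t, y) is compared between points through a bound: the sectional curvature of any plane is a
    weighted mean of those of the coordinate planes, so the largest coordinate value is the largest
    value over all planes.

    The equation for phi is autonomous. It is solved by separation of variables, eta is a function
    of phi, and both are smooth by bootstrapping. *)

(** * Iterated directional derivatives *)

(* The index counts derivatives that are differentiable: [Ck 0] is
   differentiability, not continuity. *)
Definition Ck (R : realType) (V W : normedModType R) (k : nat) (U : set V)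
    (f : V -> W) : Prop :=
  forall s : seq V, (size s <= k)%N -> forall x, U x ->
    differentiable (foldr (fun v h => 'D_v h) f s) x.

Arguments Ck : simpl never.

Section CkTheory.
Context {R : realType} {V : normedModType R}.
Implicit Types (W : normedModType R) (U : set V).

Lemma smooth_onE W U (f : V -> W) : smooth_on U f <-> forall k, Ck k U f.
Proof. by split=> [sf k s _ x /sf //|kf s x Ux]; exact: (kf (size s)). Qed.

(** [foldr] applies the last direction of the list first, so peeling off the innermost derivative
    means splitting the list with [rcons]. This recursion replaces lists by induction on [k] in the
    closure lemmas below. *)
Lemma CkP W U k (f : V -> W) : Ck k U f <->
  (forall x, U x -> differentiable f x) /\
  if k is k'.+1 then forall v, Ck k' U ('D_v f) else True.
Proof.
split=> [kf|[df Df] s].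
  split; first by move=> x Ux; exact: (kf [::]).
  by case: k kf => // k kf v s ks x Ux; rewrite -foldr_rcons; apply: kf; rewrite ?size_rcons.
elim/last_ind: s => [|s v _]; first by move=> _ x Ux; exact: df.
by rewrite size_rcons foldr_rcons; case: k Df => // k Df ks; exact: Df.
Qed.

Lemma Ck_derive W U k (f : V -> W) v : Ck k.+1 U f -> Ck k U ('D_v f).
Proof. by move=> /CkP[_]; exact. Qed.

Lemma CkW W U k (f : V -> W) : Ck k.+1 U f -> Ck k U f.
Proof. by move=> kf s ks; apply: kf; exact: leqW. Qed.

Lemma Ck_differentiable W U k (f : V -> W) x : Ck k U f -> U x ->
  differentiable f x.
Proof. by move=> /CkP[+ _]; exact. Qed.

Lemma near_open U (P : V -> Prop) x : open U -> U x -> (forall y, U y -> P y) ->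
  \forall y \near x, P y.
Proof. by move=> oU Ux UP; near=> y; apply: UP; near: y; exact: open_nbhs_nbhs.
Unshelve. all: by end_near. Qed.

(** The difference [g - f] vanishes near x, hence is little-o there and has zero differential; g is
    f plus this difference. *)
Lemma near_eq_differentiable W (f g : V -> W) x :
  {near x, f =1 g} -> differentiable f x -> differentiable g x.
Proof.
move=> fg df; pose e y := g y - f y.
have ex : e x = 0 by rewrite /e (nbhs_singleton fg) subrr.
have de : continuous (0 : V -> W) /\ e \o shift x = cst (e x) + 0 +o_ 0 id.
  split; first exact: cst_continuous.
  apply/eqaddoP => _/posnumP[eps]; rewrite ex.
  have : \forall y \near x, e y = 0.
    by near do rewrite /e; near=> y; rewrite (near fg y) // subrr.
  rewrite (near_shift 0) subr0 => H; near=> h.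
  have -> : (e \o shift x - (cst 0 + 0)) h = e (h + x).
    by rewrite -[LHS]/(e (h + x) - (0 + 0)) addr0 subr0.
  by have /= -> := near H h; rewrite ?normr0 ?mulr_ge0.
have dde : differentiable e x.
  apply/diff_locallyP; have -> : 'd e x = 0 :> (V -> W).
    by apply/diff_unique; case: de.
  exact: de.
have -> : g = f + e by apply/funext => y; rewrite /e -[RHS]/(f y + (g y - f y)) addrC subrK.
exact: differentiableD.
Unshelve. all: by end_near. Qed.

Lemma eq_Ck W U k (f g : V -> W) : open U -> (forall x, U x -> f x = g x) ->
  Ck k U f -> Ck k U g.
Proof.
move=> oU; elim: k f g => [|k IH] f g fg /CkP[df Df]; apply/CkP; split=> //.
- by move=> x Ux; apply: near_eq_differentiable (df x Ux); exact: near_open Ux _.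
- by move=> x Ux; apply: near_eq_differentiable (df x Ux); exact: near_open Ux _.
move=> v; apply: (IH _ _ _ (Df v)) => x Ux.
by apply: near_eq_derive; exact: near_open Ux _.
Qed.

Lemma Ck_subset W U U' k (f : V -> W) : U' `<=` U -> Ck k U f -> Ck k U' f.
Proof.
by move=> UU; elim: k f => [|k IH] f /CkP[df Df]; apply/CkP; split=> // *; auto.
Qed.

Lemma Ck_cst W U k (a : W) : Ck k U (cst a : V -> W).
Proof.
elim: k a => [|k IH] a; apply/CkP; split=> // v.
rewrite (_ : 'D_v _ = cst 0) //; apply/funext => x; exact: derive_cst.
Qed.

Lemma CkD W U k (f g : V -> W) : open U -> Ck k U f -> Ck k U g ->
  Ck k U (fun x => f x + g x).
Proof.
move=> oU; elim: k f g => [|k IH] f g /CkP[df Df] /CkP[dg Dg]; apply/CkP; split=> //.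
- by move=> x Ux; apply: differentiableD; auto.
- by move=> x Ux; apply: differentiableD; auto.
move=> v; apply: (eq_Ck oU _ (IH _ _ (Df v) (Dg v))) => x Ux.
by rewrite deriveD //; apply: diff_derivable; auto.
Qed.

Lemma CkN W U k (f : V -> W) : open U -> Ck k U f -> Ck k U (fun x => - f x).
Proof.
move=> oU; elim: k f => [|k IH] f /CkP[df Df]; apply/CkP; split=> //.
- by move=> x Ux; apply: differentiableN; auto.
- by move=> x Ux; apply: differentiableN; auto.
move=> v; apply: (eq_Ck oU _ (IH _ (Df v))) => x Ux.
by rewrite deriveN //; apply: diff_derivable; auto.
Qed.

Lemma CkM U k (f g : V -> R) : open U -> Ck k U f -> Ck k U g ->
  Ck k U (fun x => f x * g x).
Proof.
move=> oU; elim: k f g => [|k IH] f g kf kg; apply/CkP; split=> //.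
- by move=> x Ux; apply: differentiableM; apply: Ck_differentiable Ux; eassumption.
- by move=> x Ux; apply: differentiableM; apply: Ck_differentiable Ux; eassumption.
move=> v; apply: (eq_Ck oU _ (CkD oU (IH _ _ (CkW kf) (Ck_derive v kg)) (IH _ _ (CkW kg) (Ck_derive v kf)))) => x Ux.
by rewrite deriveM //; apply: diff_derivable; apply: Ck_differentiable Ux; eassumption.
Qed.

Lemma CkB W U k (f g : V -> W) : open U -> Ck k U f -> Ck k U g ->
  Ck k U (fun x => f x - g x).
Proof. by move=> oU kf kg; apply: CkD => //; exact: CkN. Qed.

Lemma Ck_sum W U k (I : Type) (r : seq I) (f : I -> V -> W) : open U ->
  (forall i, Ck k U (f i)) -> Ck k U (fun x => \sum_(i <- r) f i x).
Proof.
move=> oU kf; elim: r => [|i r IH].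
  by under eq_fun do rewrite big_nil; exact: Ck_cst.
by under eq_fun do rewrite big_cons; exact: CkD.
Qed.

Lemma CkX U k (f : V -> R) n : open U -> Ck k U f -> Ck k U (fun x => f x ^+ n).
Proof.
move=> oU kf; elim: n => [|n IH].
  by under eq_fun do rewrite expr0; exact: Ck_cst.
by under eq_fun do rewrite exprS; exact: CkM.
Qed.

Lemma CkV U k (f : V -> R) : open U -> (forall x, U x -> f x != 0) ->
  Ck k U f -> Ck k U (fun x => (f x)^-1).
Proof.
move=> oU f0; elim: k => [|k IH] kf.
  apply/CkP; split=> // x Ux; apply: differentiableV; last exact: f0.
  apply: Ck_differentiable Ux; eassumption.
apply/CkP; split=> [x Ux|v].
  apply: differentiableV; last exact: f0.
  apply: Ck_differentiable Ux; eassumption.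
have kV := IH (CkW kf).
apply: (eq_Ck oU _ (CkN oU (CkM oU (CkM oU kV kV) (Ck_derive v kf)))) => x Ux /=.
rewrite deriveV ?f0 //; last by apply: diff_derivable; apply: Ck_differentiable Ux; eassumption.
by rewrite -mulNr /GRing.scale /= expr2 invfM.
Qed.

Lemma linear_Ck W U k (f : {linear V -> W}) : continuous f -> Ck k U f.
Proof.
move=> cf; case: k => [|k]; apply/CkP; split=> //; try by move=> *; exact: linear_differentiable.
move=> v.
rewrite (_ : 'D_v _ = cst (f v)); first exact: Ck_cst.
apply/funext => x; rewrite deriveE ?diff_lin //; exact: linear_differentiable.
Qed.

Lemma differentiable_mxP m n (M : V -> 'M[R]_(m, n)) x :
  differentiable M x <-> forall i j, differentiable (fun y => M y i j) x.
Proof.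
split=> [dM i j|dM].
  exact: (differentiable_comp dM (differentiable_coord (M x) i j)).
have -> : M = \sum_(i < m) \sum_(j < n) (fun y => M y i j *: delta_mx i j).
  apply/funext => y; rewrite [LHS]matrix_sum_delta fct_sumE.
  by apply: eq_bigr => i _; rewrite fct_sumE.
by do 2!apply: differentiable_sum => ?; exact: differentiableZl.
Qed.

Lemma derive_mxE m n (M : V -> 'M[R]_(m, n)) x v i j : differentiable M x ->
  ('D_v M x) i j = 'D_v (fun y => M y i j) x.
Proof. by move=> dM; rewrite derive_mx ?mxE //; exact: diff_derivable. Qed.

Lemma Ck_mxP m n k U (M : V -> 'M[R]_(m, n)) : open U ->
  Ck k U M <-> forall i j, Ck k U (fun y => M y i j).
Proof.
move=> oU; elim: k M => [|k IH] M; split=> [/CkP[dM DM]|kM].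
- by move=> i j; apply/CkP; split=> // x Ux; move: (dM x Ux) => /differentiable_mxP.
- by apply/CkP; split=> // x Ux; apply/differentiable_mxP => i j; exact: Ck_differentiable (kM i j) _.
- move=> i j; apply/CkP; split=> [x Ux|v]; first by move: (dM x Ux) => /differentiable_mxP.
  move: (DM v) => /IH /(_ i j); apply: (eq_Ck oU) => x Ux.
  by rewrite derive_mxE //; exact: dM.
have dM x : U x -> differentiable M x.
  by move=> Ux; apply/differentiable_mxP => i j; exact: Ck_differentiable (kM i j) _.
apply/CkP; split=> // v; apply/IH => i j; apply: (eq_Ck oU _ (Ck_derive v (kM i j))) => x Ux.
by rewrite derive_mxE //; exact: dM.
Qed.

Lemma Ck_mulmx m n p k U (M : V -> 'M[R]_(m, n)) (N : V -> 'M[R]_(n, p)) :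
  open U -> Ck k U M -> Ck k U N -> Ck k U (fun x => M x *m N x).
Proof.
move=> oU /(Ck_mxP _ _ oU) kM /(Ck_mxP _ _ oU) kN; apply/(Ck_mxP _ _ oU) => i j.
by under eq_fun do rewrite mxE; apply: Ck_sum => // ?; exact: CkM.
Qed.

Lemma derive_comp W W' (f : V -> W) (g : W -> W') x v :
  differentiable f x -> differentiable g (f x) ->
  'D_v (g \o f) x = 'D_('D_v f x) g (f x).
Proof.
move=> df dg; rewrite !deriveE //; last exact: differentiable_comp.
by rewrite diff_comp.
Qed.

End CkTheory.

Section CkComp.
Context {R : realType} {V : normedModType R}.

Lemma Ck_comp1 k (U : set V) (A : set R) (f : V -> R) (g : R -> R) : open U ->
  (forall x, U x -> A (f x)) -> Ck k A g -> Ck k U f -> Ck k U (g \o f).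
Proof.
move=> oU UA; elim: k g => [|k IH] g kg kf.
  apply/CkP; split=> // x Ux; apply: differentiable_comp.
    exact: Ck_differentiable kf Ux.
  exact/(Ck_differentiable kg)/UA.
have df x : U x -> differentiable f x by move/(Ck_differentiable kf).
have dg x : U x -> differentiable g (f x) by move/UA/(Ck_differentiable kg).
apply/CkP; split=> [x Ux|v]; first by apply: differentiable_comp; auto.
have := CkM oU (Ck_derive v kf) (IH _ (Ck_derive (1 : R) kg) (CkW kf)).
apply: (eq_Ck oU) => x Ux.
rewrite (derive_comp _ (df _ Ux) (dg _ Ux)).
rewrite [LHS]/= [in LHS](deriveE _ (dg _ Ux)) [in RHS](deriveE _ (dg _ Ux)).
by rewrite -[X in _ = 'd _ _ X]mulr1 [RHS]linearZ.
Qed.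

(** The chain rule differentiates g in the direction ['D_v f x], which varies with x, while [Ck]
    speaks of fixed directions. Expanding this direction in the standard basis leaves the fixed
    directions [delta_mx 0 i], to which the induction hypothesis applies. *)
Lemma Ck_comp_real m k (U : set V) (A : set 'rV[R]_m) (f : V -> 'rV[R]_m)
    (g : 'rV[R]_m -> R) : open U ->
  (forall x, U x -> A (f x)) -> Ck k A g -> Ck k U f -> Ck k U (g \o f).
Proof.
move=> oU UA; elim: k g => [|k IH] g kg kf.
  apply/CkP; split=> // x Ux; apply: differentiable_comp.
    exact: Ck_differentiable kf Ux.
  exact/(Ck_differentiable kg)/UA.
have df x : U x -> differentiable f x by move/(Ck_differentiable kf).
have dg x : U x -> differentiable g (f x) by move/UA/(Ck_differentiable kg).
apply/CkP; split=> [x Ux|v]; first by apply: differentiable_comp; auto.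
have : Ck k U (fun x => \sum_(i < m) ('D_v f x) 0 i * ('D_(delta_mx 0 i) g \o f) x).
  apply: Ck_sum => // i; apply: CkM => //; last exact: IH (Ck_derive _ kg) (CkW kf).
  by have /(Ck_mxP _ _ oU) := Ck_derive v kf; exact.
apply: (eq_Ck oU) => x Ux; have dgx := dg x Ux.
rewrite (derive_comp _ (df _ Ux) dgx).
rewrite (deriveE _ dgx) [X in _ = 'd _ _ X]row_sum_delta linear_sum.
by apply: eq_bigr => i _; rewrite linearZ /= -(deriveE _ dgx).
Qed.

Lemma Ck_comp m n p k (U : set V) (A : set 'rV[R]_m) (f : V -> 'rV[R]_m)
    (g : 'rV[R]_m -> 'M[R]_(n, p)) : open U -> open A ->
  (forall x, U x -> A (f x)) -> Ck k A g -> Ck k U f -> Ck k U (g \o f).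
Proof.
move=> oU oA UA /(Ck_mxP _ _ oA) kg kf; apply/(Ck_mxP _ _ oU) => i j.
exact: Ck_comp_real UA (kg i j) kf.
Qed.

End CkComp.

(** * Symmetry of second derivatives *)

Section Schwarz.
Context {R : realType} {V : normedModType R}.
Implicit Types (f : V -> R) (x v w : V).

Lemma is_derive_line (W : normedModType R) (f : V -> W) x v (s : R) :
  differentiable f (s *: v + x) ->
  is_derive s 1 (fun s : R => f (s *: v + x)) ('D_v f (s *: v + x)).
Proof.
move=> df; pose l : R -> V := fun s => s *: v + x.
have dZ : is_diff s ( *:%R ^~ v) ( *:%R ^~ v) := is_diff_scalel s v.
have lE : l = ( *:%R ^~ v) + cst x by [].
have dls : differentiable l s by rewrite lE; apply: differentiableD.
have dl : 'D_(1 : R) l s = v.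
  rewrite deriveE // lE diffD // diff_cst (diff_val (is_diff_def := dZ)).
  by rewrite -[LHS]/(1 *: v + 0) scale1r addr0.
apply: DeriveDef.
  by apply: diff_derivable; exact: (differentiable_comp dls).
by have := @derive_comp R R V _ l f s 1 dls df; rewrite dl.
Qed.

(* The mean value theorem in the direction [v], applied to
   [s |-> f (x + s v + h w) - f (x + s v)]. *)
Lemma second_difference (U : set V) f x v w (e : R) : open U -> U x ->
  (forall y, U y -> differentiable f y) -> differentiable ('D_v f) x -> 0 < e ->
  \forall h \near 0^'+,
    `|f (h *: v + h *: w + x) - f (h *: v + x) - f (h *: w + x) + f x
      - h ^+ 2 * 'D_w ('D_v f) x| <= e * h ^+ 2.
Proof.
move=> oU Ux df dDf e0.
pose N := `|v| + `|w| + 1.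
have N0 : 0 < N by rewrite ltr_wpDl // addr_ge0.
have /nbhs_ballP[d1 /= d10 Hd1] : nbhs x U by exact: open_nbhs_nbhs.
(* All displacements have norm at most [h * N], so each of the two linearization errors of ['D_v f]
   is at most [e / 2 * h]; the mean value theorem contributes the remaining factor h. *)
have e'0 : 0 < e / (2 * N) by rewrite divr_gt0 // mulr_gt0.
have /diff_locally/eqaddoP/(_ _ e'0)/nbhs_ballP[d2 /= d20 Hd2] := dDf.
have small (a b h : R) : 0 <= a <= h -> 0 <= b <= h ->
    `|a *: v + b *: w| <= h * N.
  move=> /andP[a0 ah] /andP[b0 bh]; apply: le_trans (ler_normD _ _) _.
  rewrite !normrZ !ger0_norm // /N mulrDr mulr1 -[leLHS]addr0 mulrDr.
  rewrite lerD //; last exact: le_trans ah.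
  by rewrite lerD // ler_wpM2r.
near=> h.
have h0 : 0 < h by [].
have hN1 : h * N < d1.
  by rewrite -ltr_pdivlMr //; near: h; apply: nbhs_right_lt; rewrite divr_gt0.
have hN2 : h * N < d2.
  by rewrite -ltr_pdivlMr //; near: h; apply: nbhs_right_lt; rewrite divr_gt0.
have inU (a b : R) : 0 <= a <= h -> 0 <= b <= h -> U (a *: v + (b *: w + x)).
  move=> ha hb; apply: Hd1; rewrite -ball_normE /= addrA opprD addrCA subrr addr0.
  by rewrite normrN; apply: le_lt_trans hN1; exact: small.
have near_Df (a b : R) : 0 <= a <= h -> 0 <= b <= h ->
   `|'D_v f (a *: v + (b *: w + x)) - ('D_v f x + 'd ('D_v f) x (a *: v + b *: w))|
     <= e / 2 * h.
  move=> ha hb; have le := small _ _ _ ha hb.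
  have := Hd2 (a *: v + b *: w).
  rewrite -ball_normE /= sub0r normrN => /(_ (le_lt_trans le hN2)).
  rewrite [a *: v + (_ + x)]addrA => H; apply: le_trans H _.
  apply: le_trans (ler_wpM2l (ltW e'0) le) _.
  by have -> : e / (2 * N) * (h * N) = e / 2 * h by field; rewrite lt0r_neq0.
have hh : 0 <= h <= h by rewrite ltW //=.
have h00 : 0 <= (0 : R) <= h by rewrite lexx ltW.
pose G s := f (s *: v + (h *: w + x)) - f (s *: v + x).
have dG s : 0 <= s <= h -> is_derive s 1 G
    ('D_v f (s *: v + (h *: w + x)) - 'D_v f (s *: v + x)).
  move=> hs; apply: is_deriveB; apply: is_derive_line; apply: df; first exact: inU.
  by have := inU s 0 hs h00; rewrite scale0r add0r.
have [|||c /itvP ch] := @MVT R G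
   (fun s => 'D_v f (s *: v + (h *: w + x)) - 'D_v f (s *: v + x)) 0 h.
- by [].
- by move=> s /itvP sh; apply: dG; rewrite !sh.
- apply: derivable_within_continuous => s /itvP sh.
  by have [] := dG s ltac:(by rewrite !sh).
rewrite /G subr0 !scale0r !add0r.
have hc : 0 <= c <= h by rewrite !ch.
have H2 := near_Df c h hc hh; have H1 := near_Df c 0 hc h00.
rewrite scale0r add0r addr0 in H1.
have EL : 'd ('D_v f) x (c *: v + h *: w) =
    'd ('D_v f) x (c *: v) + h * 'D_w ('D_v f) x.
  by rewrite linearD (deriveE w dDf); congr (_ + _); rewrite linearZ.
rewrite EL in H2.
rewrite -[h *: v + h *: w + x]addrA; move: H1 H2.
set A := 'D_v f (_ + (_ + _)); set B := 'D_v f (_ + _); set C := 'd _ _ _.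
set L := 'D_w _ _ => H1 H2.
move=> E.
have -> : f (h *: v + (h *: w + x)) - f (h *: v + x) - f (h *: w + x) + f x
   - h ^+ 2 * L = h * ((A - ('D_v f x + (C + h * L))) - (B - ('D_v f x + C))).
  transitivity ((A - B) * h - h ^+ 2 * L); last by ring.
  by rewrite -E; ring.
rewrite normrM gtr0_norm // [e * _]mulrC expr2 -mulrA ler_pM2l // mulrC.
apply: le_trans (ler_normB _ _) _.
by apply: le_trans (lerD H2 H1) _; rewrite -mulrDl -splitr.
Unshelve. all: by end_near. Qed.

(** The second difference is symmetric in v and w, and divided by h^2 it approximates both mixed
    derivatives. If these differed by d > 0, tolerance d / 4 for each would give d <= d / 2. *)
Lemma Schwarz (U : set V) f x v w : open U -> U x -> Ck 1 U f ->
  'D_w ('D_v f) x = 'D_v ('D_w f) x.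
Proof.
move=> oU Ux kf; have df y := @Ck_differentiable R V _ U 1 f y kf.
have dD z : differentiable ('D_z f) x := Ck_differentiable (Ck_derive z kf) Ux.
set p := LHS; set q := RHS.
apply/eqP; rewrite -subr_eq0 -normr_eq0; apply/negPn/negP => ne0.
set d := `|_| in ne0; have d0 : 0 < d / 4 by rewrite divr_gt0 // lt_def ne0 /d normr_ge0.
have Hv := second_difference w oU Ux df (dD v) d0.
have Hw := second_difference v oU Ux df (dD w) d0.
have [h [[H1 H2] h0]] := filter_ex (filterI (filterI Hv Hw) (nbhs_right_gt 0)).
have h2 : 0 < h ^+ 2 by rewrite exprn_gt0.
have E : f (h *: w + h *: v + x) - f (h *: w + x) - f (h *: v + x) =
    f (h *: v + h *: w + x) - f (h *: v + x) - f (h *: w + x).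
  by rewrite [h *: w + h *: v]addrC addrAC.
rewrite -/p in H1; rewrite -/q E in H2; clear Hv Hw E dD.
move: H1 H2; move: (_ - _ - _ + _) => X H1 H2; clearbody p q.
have : `|h ^+ 2 * (p - q)| <= d / 4 * h ^+ 2 + d / 4 * h ^+ 2.
  have -> : h ^+ 2 * (p - q) = (X - h ^+ 2 * q) - (X - h ^+ 2 * p) by ring.
  exact: le_trans (ler_normB _ _) (lerD H2 H1).
rewrite normrM gtr0_norm // -mulrDl mulrC ler_pM2r // -/d.
by move: d0; lra.
Qed.
End Schwarz.

#[local] Opaque derive derivable diff.

(** * The Euclidean inner product and its derivatives *)

Section Dot.
Context {R : realType} {N : nat}.
Implicit Types u v w : 'rV[R]_N.

Lemma dotE u v : dot u v = \sum_k u 0 k * v 0 k.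
Proof. by rewrite /dot mxE; apply: eq_bigr => k _; rewrite mxE. Qed.

Lemma dotC u v : dot u v = dot v u.
Proof. by rewrite !dotE; apply: eq_bigr => k _; rewrite mulrC. Qed.

Lemma dotDl u v w : dot (u + v) w = dot u w + dot v w.
Proof. by rewrite /dot mulmxDl mxE. Qed.

Lemma dotDr u v w : dot w (u + v) = dot w u + dot w v.
Proof. by rewrite dotC dotDl !(dotC w). Qed.

Lemma dotZl a u v : dot (a *: u) v = a * dot u v.
Proof. by rewrite /dot -scalemxAl mxE. Qed.

Lemma dotZr a u v : dot u (a *: v) = a * dot u v.
Proof. by rewrite dotC dotZl dotC. Qed.

Lemma dotNl u v : dot (- u) v = - dot u v.
Proof. by rewrite -scaleN1r dotZl mulN1r. Qed.

Lemma dotNr u v : dot u (- v) = - dot u v.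
Proof. by rewrite dotC dotNl dotC. Qed.

Lemma dotBl u v w : dot (u - v) w = dot u w - dot v w.
Proof. by rewrite dotDl dotNl. Qed.

Lemma dotBr u v w : dot w (u - v) = dot w u - dot w v.
Proof. by rewrite dotDr dotNr. Qed.

Lemma dot0l u : dot 0 u = 0.
Proof. by rewrite /dot mul0mx mxE. Qed.

Lemma dot0r u : dot u 0 = 0.
Proof. by rewrite dotC dot0l. Qed.

Lemma dot_suml (I : finType) (f : I -> 'rV[R]_N) v :
  dot (\sum_i f i) v = \sum_i dot (f i) v.
Proof. by rewrite /dot mulmx_suml summxE. Qed.

Lemma dot_eq0 u : dot u u = 0 -> u = 0.
Proof.
rewrite dotE => /eqP; rewrite psumr_eq0 => [/allP u0|k _]; last by rewrite -expr2 sqr_ge0.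
apply/rowP => k; rewrite mxE; have := u0 k (mem_index_enum _).
by rewrite /= -expr2 sqrf_eq0 => /eqP.
Qed.

Lemma dot_ge0 u : 0 <= dot u u.
Proof. by rewrite dotE sumr_ge0 // => k _; rewrite -expr2 sqr_ge0. Qed.

End Dot.

Section DerivativeLemmas.
Context {R : realType} {V : normedModType R}.

Lemma Ck_dot N k (U : set V) (f g : V -> 'rV[R]_N) : open U ->
  Ck k U f -> Ck k U g -> Ck k U (fun x => dot (f x) (g x)).
Proof.
move=> oU /(Ck_mxP _ _ oU) kf /(Ck_mxP _ _ oU) kg.
by under eq_fun do rewrite dotE; apply: Ck_sum => // i; exact: CkM.
Qed.

Lemma derive_bigsum (I : finType) (W : normedModType R) (f : I -> V -> W) x v :
  (forall i, derivable (f i) x v) ->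
  'D_v (fun y => \sum_i f i y) x = \sum_i 'D_v (f i) x.
Proof.
move=> df.
suff [] : derivable (fun y => \sum_i f i y) x v /\
  'D_v (fun y => \sum_i f i y) x = \sum_i 'D_v (f i) x by [].
elim: (index_enum I) => [|i r [IH1 IH2]].
  under eq_fun do rewrite big_nil; rewrite big_nil; split; last exact: derive_cst.
  exact: derivable_cst.
under eq_fun do rewrite big_cons; rewrite big_cons -IH2; split; first exact: derivableD.
exact: deriveD.
Qed.

Lemma derive_dot N (f g : V -> 'rV[R]_N) x v :
  differentiable f x -> differentiable g x ->
  'D_v (fun y => dot (f y) (g y)) x = dot ('D_v f x) (g x) + dot (f x) ('D_v g x).
Proof.
move=> df dg; under eq_fun do rewrite dotE.
have dfi i : derivable (fun y => f y 0 i) x v.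
  by apply: diff_derivable; move/differentiable_mxP : df; exact.
have dgi i : derivable (fun y => g y 0 i) x v.
  by apply: diff_derivable; move/differentiable_mxP : dg; exact.
rewrite derive_bigsum; last by move=> i; exact: derivableM.
rewrite !dotE -big_split; apply: eq_bigr => i _ /=.
rewrite deriveM // (derive_mxE _ _ _ df) (derive_mxE _ _ _ dg).
by rewrite addrC /GRing.scale /= [_ * g x 0 i]mulrC.
Qed.

Lemma Schwarz_mx m n (U : set V) (F : V -> 'M[R]_(m, n)) x v w :
  open U -> U x -> Ck 1 U F -> 'D_w ('D_v F) x = 'D_v ('D_w F) x.
Proof.
move=> oU Ux kF; apply/matrixP => i j.
have dF z : differentiable ('D_z F) x := Ck_differentiable (Ck_derive z kF) Ux.
have near_coord z : \forall y \near x, ('D_z F y) i j = 'D_z (fun t => F t i j) y.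
  by apply: (near_open oU Ux) => y Uy; exact/derive_mxE/(Ck_differentiable kF).
rewrite [LHS](derive_mxE w i j (dF v)) [RHS](derive_mxE v i j (dF w)).
rewrite [LHS](near_eq_derive w (near_coord v)) [RHS](near_eq_derive v (near_coord w)).
apply: (@Schwarz R V U (fun t => F t i j) x v w oU Ux).
by have /(Ck_mxP _ _ oU) := kF; exact.
Qed.

End DerivativeLemmas.

Lemma induced_metricE (R : realType) m N (F : 'rV[R]_m -> 'rV[R]_N) x i j :
  differentiable F x -> induced_metric F x i j =
    dot ('D_(delta_mx 0 i) F x) ('D_(delta_mx 0 j) F x).
Proof.
move=> dF; rewrite !deriveEjacobian // -!rowE /induced_metric dotE mxE.
by apply: eq_bigr => k _; rewrite !mxE.
Qed.

(** * The Gauss equation *)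

#[local] Opaque dot delta_mx.

Section Gauss.
Context {R : realType} {m N : nat}.
Variables (g : 'rV[R]_m -> 'M[R]_m) (F : 'rV[R]_m -> 'rV[R]_N).
Variable D : set 'rV[R]_m.
Hypotheses (oD : open D) (kF : Ck 2 D F).
Hypothesis gE : forall y, D y -> induced_metric F y = g y.
Hypothesis gU : forall y, D y -> g y \in unitmx.

Variables (F1 : 'I_m -> 'rV[R]_m -> 'rV[R]_N) (F2 : 'I_m -> 'I_m -> 'rV[R]_m -> 'rV[R]_N).
Hypothesis F1E : forall i, F1 i = 'D_(delta_mx 0 i) F.
Hypothesis F2E : forall i j, F2 i j = 'D_(delta_mx 0 i) (F1 j).

Let F2x i j y : 'D_(delta_mx 0 i) (F1 j) y = F2 i j y. Proof. by rewrite F2E. Qed.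

Let kF1 i : Ck 1 D (F1 i). Proof. by rewrite F1E; exact: Ck_derive. Qed.
Let kF2 i j : Ck 0 D (F2 i j). Proof. by rewrite F2E; exact: Ck_derive. Qed.

Let F2C i j y : D y -> F2 i j y = F2 j i y.
Proof. by move=> Dy; rewrite !F2E !F1E; apply: (Schwarz_mx _ _ oD Dy); exact: CkW. Qed.

Let gdot i j y : D y -> g y i j = dot (F1 i y) (F1 j y).
Proof. by move=> Dy; rewrite !F1E -gE // induced_metricE //; exact: Ck_differentiable kF _. Qed.

Let partial_metric k i j y : D y -> partial k (fun z => g z i j) y =
  dot (F2 k i y) (F1 j y) + dot (F1 i y) (F2 k j y).
Proof.
move=> Dy; have dF1 l : differentiable (F1 l) y := Ck_differentiable (kF1 l) Dy.
rewrite !F2E -(derive_dot _ (dF1 i) (dF1 j)).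
apply: near_eq_derive; apply: (near_open oD Dy) => z Dz; exact: gdot.
Qed.

(** The three metric derivatives in the Christoffel symbol are six products of second with first
    derivatives of F. By symmetry of [F2] four of them cancel and the other two agree, so the symbol
    with lowered index is [dot (F2 i j y) (F1 k y)]. *)
Let christoffel_dot i j k y : D y ->
  \sum_l christoffel g l i j y * g y l k = dot (F2 i j y) (F1 k y).
Proof.
move=> Dy; pose X l := dot (F2 i j y) (F1 l y).
have chE l : christoffel g l i j y = \sum_r invmx (g y) l r * X r.
  rewrite /christoffel mulr_sumr; apply: eq_bigr => r _; rewrite mulrCA; congr (_ * _).
  rewrite !partial_metric // (F2C j i) // (F2C r i) // (F2C r j) //.
  rewrite [dot (F1 j y) _]dotC /X.
  move: (dot _ _) (dot _ _) (dot _ _) => a b c; lra.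
have gT : (g y)^T = g y by rewrite -gE // /induced_metric trmx_mul trmxK.
have gC a b : g y a b = g y b a by move/matrixP: gT => /(_ b a); rewrite mxE.
have gG r : \sum_l invmx (g y) l r * g y l k = (k == r)%:R.
  have /matrixP/(_ k r) := mulmxV (gU Dy); rewrite mxE [RHS]mxE => <-.
  by apply: eq_bigr => l _; rewrite mulrC gC.
under eq_bigr do rewrite chE mulr_suml.
rewrite exchange_big /= -/(X k).
under eq_bigr => r _ do under eq_bigr do rewrite mulrAC.
under eq_bigr do rewrite -mulr_suml gG.
rewrite (bigD1 k) //= eqxx mul1r big1 ?addr0 // => r rk.
by rewrite eq_sym (negPf rk) mul0r.
Qed.

Variable II : 'I_m -> 'I_m -> 'rV[R]_m -> 'rV[R]_N.
Hypothesis IIE : forall i j x,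
  II i j x = F2 i j x - \sum_l christoffel g l i j x *: F1 l x.

(** By [christoffel_dot] the Christoffel symbols are the tangential coefficients of [F2 i j], so
    [II] is its normal part, the second fundamental form. *)
Lemma dot_second_fundamental_form i j k x : D x ->
  dot (II i j x) (F1 k x) = 0.
Proof.
move=> Dx; rewrite IIE dotBl dot_suml -christoffel_dot //.
apply/eqP; rewrite subr_eq0; apply/eqP.
by apply: eq_bigr => l _; rewrite dotZl -gdot.
Qed.

(** Differentiate [christoffel_dot] along the i-th coordinate and antisymmetrize in i and j. The
    third derivatives of F cancel, the quadratic Christoffel terms cancel against those from the
    product rule, and the normal parts remain. *)
Lemma Gauss_equation i j k r x : D x ->
  (forall l a b, derivable (christoffel g l a b) x (delta_mx 0 i)
     /\ derivable (christoffel g l a b) x (delta_mx 0 j)) ->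
  \sum_l riemann_coef g l i j k x * g x l r =
    dot (II j k x) (II i r x) - dot (II i k x) (II j r x).
Proof.
move=> Dx dc.
have dF1 l : differentiable (F1 l) x := Ck_differentiable (kF1 l) Dx.
have dF2 a b : differentiable (F2 a b) x := Ck_differentiable (kF2 a b) Dx.
have dg a b v : derivable (fun z => g z a b) x v.
  apply: (near_eq_derivable (f := fun z => dot (F1 a z) (F1 b z))).
    by apply: (near_open oD Dx) => z Dz; rewrite gdot.
  by apply: diff_derivable; apply: Ck_differentiable (Ck_dot oD (kF1 a) (kF1 b)) Dx.
(* The product rule on both sides of [christoffel_dot]. The tangential part of [F2 b k] is absorbed
   by the Christoffel sum, which turns a product of second derivatives into one of second
   fundamental forms. *)
have main a b : (forall l c d, derivable (christoffel g l c d) x (delta_mx 0 a)) ->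
    \sum_l partial a (christoffel g l b k) x * g x l r =
    dot ('D_(delta_mx 0 a) (F2 b k) x) (F1 r x) + dot (II b k x) (II a r x)
    - \sum_l christoffel g l b k x * dot (F2 a l x) (F1 r x).
  move=> da.
  have : 'D_(delta_mx 0 a) (fun y => \sum_l christoffel g l b k y * g y l r) x =
    'D_(delta_mx 0 a) (fun y => dot (F2 b k y) (F1 r y)) x.
    by apply: near_eq_derive; apply: (near_open oD Dx) => z Dz; exact: christoffel_dot.
  rewrite derive_dot // derive_bigsum; last by move=> l; exact: derivableM.
  rewrite (_ : \sum_l _ = \sum_l (partial a (christoffel g l b k) x * g x l r
     + christoffel g l b k x * (dot (F2 a l x) (F1 r x) + dot (F1 l x) (F2 a r x)))).
    rewrite big_split /= => E.
    have {}E : \sum_l partial a (christoffel g l b k) x * g x l r =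
      dot ('D_(delta_mx 0 a) (F2 b k) x) (F1 r x) + dot (F2 b k x) ('D_(delta_mx 0 a) (F1 r) x)
      - \sum_l christoffel g l b k x * (dot (F2 a l x) (F1 r x) + dot (F1 l x) (F2 a r x)).
      by rewrite -E addrK.
    rewrite E F2x; under [X in _ - X]eq_bigr do rewrite mulrDr.
    rewrite big_split /=.
    have -> : \sum_l christoffel g l b k x * dot (F1 l x) (F2 a r x) =
      dot (F2 b k x - II b k x) (F2 a r x).
      by rewrite IIE opprB addrC subrK dot_suml; apply: eq_bigr => l _; rewrite dotZl.
    have -> : dot (II b k x) (II a r x) = dot (II b k x) (F2 a r x).
      rewrite [X in dot _ X]IIE dotBr dotC [X in _ - X]dotC dot_suml big1 ?subr0 1?dotC// => l _.
      by rewrite dotZl dotC dot_second_fundamental_form // mulr0.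
    rewrite dotBl.
    by move: (dot _ _) (dot _ _) (dot _ _) (\sum_l _) => A B C S; ring.
  apply: eq_bigr => l _; rewrite deriveM // -partial_metric // addrC; congr (_ + _).
  by rewrite /partial /GRing.scale /= mulrC.
have E1 := main i j (fun l c d => (dc l c d).1).
have E2 := main j i (fun l c d => (dc l c d).2).
transitivity (\sum_l partial i (christoffel g l j k) x * g x l r
  - \sum_l partial j (christoffel g l i k) x * g x l r
  + \sum_l \sum_s (christoffel g l i s x * christoffel g s j k x
        - christoffel g l j s x * christoffel g s i k x) * g x l r).
  rewrite -sumrB -big_split; apply: eq_bigr => l _ /=.
  by rewrite -mulr_suml -mulrBl -mulrDl.
rewrite [X in X - _ + _]E1 [X in _ - X + _]E2 {E1 E2 main}.
rewrite exchange_big /=.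
(* Contracting the first Christoffel factor with the metric, again by [christoffel_dot], produces
   exactly the two sums left over by [main]. *)
have -> : \sum_s \sum_l (christoffel g l i s x * christoffel g s j k x -
     christoffel g l j s x * christoffel g s i k x) * g x l r =
   \sum_l christoffel g l j k x * dot (F2 i l x) (F1 r x)
   - \sum_l christoffel g l i k x * dot (F2 j l x) (F1 r x).
  rewrite -sumrB; apply: eq_bigr => s _.
  rewrite -!christoffel_dot // !mulr_sumr -sumrB; apply: eq_bigr => l _.
  by rewrite mulrBl mulrAC [in X in _ - X]mulrAC ![_ * g x l r * _]mulrC.
(* Symmetry of the second derivatives of [F1 k], which removes the third derivatives of F. *)
have -> : 'D_(delta_mx 0 i) (F2 j k) x = 'D_(delta_mx 0 j) (F2 i k) x.
  by rewrite !F2E; exact: (Schwarz_mx _ _ oD Dx).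
by move: (dot _ _) (dot _ _) (dot _ _) (\sum_l _) (\sum_l _) => a b c d e; ring.
Qed.
End Gauss.

#[local] Transparent dot delta_mx.

Lemma derive_row_sum (R : realType) m N (F : 'rV[R]_m -> 'rV[R]_N) x a :
  differentiable F x -> 'D_a F x = \sum_l a 0 l *: 'D_(delta_mx 0 l) F x.
Proof.
move=> dF; rewrite deriveEjacobian // mulmx_sum_row; apply: eq_bigr => l _.
by rewrite rowE deriveEjacobian.
Qed.

Lemma invmx_diag (R : fieldType) m (d : 'rV[R]_m) : (forall i, d 0 i != 0) ->
  (diag_mx d \in unitmx) * (invmx (diag_mx d) = diag_mx (\row_i (d 0 i)^-1)).
Proof.
move=> d0; have E : diag_mx (\row_i (d 0 i)^-1) *m diag_mx d = 1%:M.
  by rewrite mulmx_diag -diag_const_mx; congr diag_mx; apply/rowP => i; rewrite !mxE mulVf.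
have u := (mulmx1_unit E).2; split=> //.
by apply: (can_inj (mulmxK u)); rewrite E mulVmx.
Qed.

(** * Immersions with principal coordinate directions *)

Section Principal.
Context {R : realType} {m N : nat}.
Implicit Types (x : 'rV[R]_m) (F : 'rV[R]_m -> 'rV[R]_N).

(* [nu i] is the normal curvature vector of the i-th coordinate direction and
   [kappa i j] the sectional curvature of the coordinate plane (i, j); the
   coordinate directions are principal for every normal vector. *)
Definition principal_at F (gam : 'I_m -> R) (kappa : 'I_m -> 'I_m -> R) x :=
  exists nu : 'I_m -> 'rV[R]_N,
  [/\ forall i j, exists a, 'D_(delta_mx 0 i) ('D_(delta_mx 0 j) F) x
        = 'D_a F x + (i == j)%:R *: nu i,
      forall i v, dot (nu i) ('D_v F x) = 0 &
      forall i j, i != j -> dot (nu i) (nu j) = kappa i j * gam i * gam j].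

(** For a diagonal metric, multiplying by [gam r] lowers the index r. The condition says that every
    coordinate bivector is an eigenvector of the curvature operator, with eigenvalue the sectional
    curvature [kappa i j]. *)
Definition diagonal_curvature (g : 'rV[R]_m -> 'M[R]_m) (gam : 'I_m -> R)
    (kappa : 'I_m -> 'I_m -> R) x :=
  [/\ g x = diag_mx (\row_i gam i), forall i, 0 < gam i &
    forall r i j k, riemann_coef g r i j k x * gam r =
    (((j == k) && (i == r))%:R - ((i == k) && (j == r))%:R)
      * (kappa i j * gam i * gam j)].

Variables (g : 'rV[R]_m -> 'M[R]_m) (F : 'rV[R]_m -> 'rV[R]_N).
Variables (D : set 'rV[R]_m) (gam : 'I_m -> 'rV[R]_m -> R).
Hypotheses (oD : open D) (sF : smooth_on D F).
Hypothesis gE : forall y, D y -> induced_metric F y = g y.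
Hypothesis gdiag : forall y, D y -> g y = diag_mx (\row_i gam i y).
Hypothesis gam_gt0 : forall i y, D y -> 0 < gam i y.

Let kF k : Ck k D F. Proof. by move: k; apply/smooth_onE. Qed.

Let gam_neq0 y i : D y -> (\row_i gam i y) 0 i != 0.
Proof. by move=> Dy; rewrite mxE lt0r_neq0 // gam_gt0. Qed.

Lemma Ck_induced_metric k : Ck k D g.
Proof.
apply/(Ck_mxP _ _ oD) => i j.
have kF1 a : Ck k D ('D_(delta_mx 0 a) F) by apply: Ck_derive.
apply: (eq_Ck oD _ (Ck_dot oD (kF1 i) (kF1 j))) => y Dy.
by rewrite -(gE Dy) (induced_metricE _ _ (Ck_differentiable (@kF 0%N) Dy)).
Qed.

Lemma Ck_invmx_metric k : Ck k D (fun y => invmx (g y)).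
Proof.
apply/(Ck_mxP _ _ oD) => i j.
have Ckg a : Ck k D (fun y => g y a a) by have /(Ck_mxP _ _ oD) := @Ck_induced_metric k; exact.
have gaa a y : D y -> g y a a = gam a y by move=> Dy; rewrite gdiag // !mxE eqxx.
have E y : D y -> invmx (g y) i j = (i == j)%:R * (g y j j)^-1.
  move=> Dy; rewrite gaa // gdiag // (invmx_diag (fun i => gam_neq0 i Dy)) !mxE.
  by rewrite mulr_natl; case: eqP => [->|].
apply: (@eq_Ck _ _ _ D k (fun y => (i == j)%:R * (g y j j)^-1) _ oD) => [y /E//|].
apply: CkM => //; first exact: Ck_cst.
by apply: CkV => // y Dy; rewrite gaa // lt0r_neq0 // gam_gt0.
Qed.

Lemma Ck_christoffel k l i j : Ck k D (christoffel g l i j).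
Proof.
have Ckp a b c : Ck k D (partial a (fun y => g y b c)).
  by apply: Ck_derive; have /(Ck_mxP _ _ oD) := @Ck_induced_metric k.+1; exact.
have Cki a b : Ck k D (fun y => invmx (g y) a b).
  by have /(Ck_mxP _ _ oD) := @Ck_invmx_metric k; exact.
apply: CkM => //; first exact: Ck_cst.
apply: Ck_sum => // r; apply: CkM => //; apply: CkB => //; exact: CkD.
Qed.

(** The second fundamental form of two coordinate directions is [nu] on the diagonal and zero off
    it, so the Gauss equation involves only the products of [nu i] and [nu j]. *)
Lemma principal_diagonal_curvature x kappa : D x ->
  principal_at F (gam^~ x) kappa x -> diagonal_curvature g (gam^~ x) kappa x.
Proof.
move=> Dx [nu [Fij nu_n nunu]]; split=> [|i|r i j k]; [exact: gdiag|exact: gam_gt0|].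
have gU y : D y -> g y \in unitmx.
  by move=> Dy; rewrite gdiag // (invmx_diag (fun i => gam_neq0 i Dy)).
have dF : differentiable F x := Ck_differentiable (@kF 0%N) Dx.
pose F1 (i : 'I_m) : 'rV[R]_m -> 'rV[R]_N := 'D_(delta_mx 0 i) F.
pose F2 (i j : 'I_m) : 'rV[R]_m -> 'rV[R]_N := 'D_(delta_mx 0 i) (F1 j).
pose II i j x := F2 i j x - \sum_l christoffel g l i j x *: F1 l x.
have IIn a b c : dot (II a b x) (F1 c x) = 0.
  exact: (@dot_second_fundamental_form _ _ _ g F D oD (@kF 2) gE gU F1 F2 _ _ II).
(* Both sides are normal and both differ from the second derivative of F by a tangent vector; their
   difference is tangent and normal, hence orthogonal to itself. *)
have IIE a b : II a b x = (a == b)%:R *: nu a.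
  have [w Fw] := Fij a b.
  apply/subr0_eq/dot_eq0.
  have dotF c : dot (II a b x - (a == b)%:R *: nu a) (F1 c x) = 0.
    by rewrite dotBl IIn dotZl nu_n mulr0 subr0.
  have WE : II a b x - (a == b)%:R *: nu a = \sum_l (w 0 l - christoffel g l a b x) *: F1 l x.
    rewrite /II /F2 Fw (derive_row_sum _ dF) addrAC addrK -sumrB.
    by apply: eq_bigr => l _; rewrite scalerBl.
  rewrite [X in dot X _]WE dot_suml big1 // => l _.
  by rewrite dotZl dotC dotF mulr0.
have dc v l a b : derivable (christoffel g l a b) x v.
  by apply: diff_derivable; exact: Ck_differentiable (@Ck_christoffel 0%N l a b) Dx.
have := @Gauss_equation _ _ _ g F D oD (@kF 2) gE gU F1 F2 (fun=> erefl) (fun _ _ => erefl)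
  II (fun _ _ _ => erefl) i j k r x Dx (fun l a b => conj (dc _ l a b) (dc _ l a b)).
rewrite (bigD1 r) //= big1 ?addr0 => [|l lr]; last first.
  by rewrite gdiag // !mxE (negPf lr) mulr0.
have -> : g x r r = gam r x by rewrite gdiag // !mxE eqxx mulr1n.
move=> ->.
rewrite !IIE !dotZl !dotZr.
(* [nunu] speaks only of distinct indices; for i = j both sides vanish by antisymmetry. *)
have [->|ij] := eqVneq i j.
  by rewrite subrr andbC [(j == r) && _]andbC subrr mul0r.
rewrite (dotC (nu j)) nunu //.
by case: (j == k); case: (i == r); case: (i == k); case: (j == r); rewrite /=; ring.
Qed.
End Principal.

(** * Normal connection and flat normal bundle *)

Lemma derive_mulmx (R : realType) (V : normedModType R) m n p
    (A : V -> 'M[R]_(m, n)) (B : V -> 'M[R]_(n, p)) x v :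
  differentiable A x -> differentiable B x ->
  'D_v (fun y => A y *m B y) x = 'D_v A x *m B x + A x *m 'D_v B x.
Proof.
move=> dA dB; have dAi i j : differentiable (fun y => A y i j) x.
  by move/differentiable_mxP : dA; exact.
have dBi i j : differentiable (fun y => B y i j) x.
  by move/differentiable_mxP : dB; exact.
have dAB : differentiable (fun y => A y *m B y) x.
  apply/differentiable_mxP => i j; under eq_fun do rewrite mxE.
  have -> : (fun y => \sum_k A y i k * B y k j) = \sum_k (fun y => A y i k * B y k j).
    by apply/funext => y; rewrite fct_sumE.
  by apply: differentiable_sum => k; exact: differentiableM.
apply/matrixP => i j; rewrite [LHS](derive_mxE v i j dAB).
under eq_fun do rewrite mxE; rewrite derive_bigsum; last first.
  by move=> k; apply: derivableM; exact: diff_derivable.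
rewrite !mxE -big_split; apply: eq_bigr => k _ /=.
rewrite deriveM; [|exact: diff_derivable..].
rewrite [X in _ = X * _ + _](derive_mxE v i k dA) [X in _ = _ + _ * X](derive_mxE v k j dB).
by rewrite addrC /GRing.scale /= [_ * B x k j]mulrC.
Qed.

(** This form avoids the derivative of G. From P P = P one gets DP P = (1 - P) DP = J^T G J DP; then
    J P = 0 moves the derivative from P to J, and xi J^T = 0 moves the other one from xi to J. *)
Lemma normal_connection_algebra (R : comNzRingType) m N (xi Dxi : 'rV[R]_N)
    (J DJ DJ' : 'M[R]_(m, N)) (G : 'M[R]_m) (P DP : 'M[R]_N) :
  P = 1%:M - J^T *m G *m J -> DP *m P + P *m DP = DP ->
  DJ *m P + J *m DP = 0 -> Dxi *m J^T + xi *m DJ'^T = 0 ->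
  Dxi *m DP *m P = xi *m DJ'^T *m G *m (DJ *m P).
Proof.
move=> PE EP EJP ExiJ.
have DPP : DP *m P = J^T *m G *m (J *m DP).
  by rewrite -[LHS](addrK (P *m DP)) EP PE mulmxBl mul1mx opprB addrC subrK !mulmxA.
have {}EJP : J *m DP = - (DJ *m P) by apply/eqP; rewrite -addr_eq0 addrC EJP.
have {}ExiJ : Dxi *m J^T = - (xi *m DJ'^T) by apply/eqP; rewrite -addr_eq0 ExiJ.
by rewrite -mulmxA DPP EJP !mulmxN !mulmxA ExiJ !mulNmx opprK.
Qed.

Section FlatNormal.
Context {R : realType} {m N : nat}.
Variables (W : set 'rV[R]_m) (J : 'rV[R]_m -> 'M[R]_(m, N)).
Variables (P : 'rV[R]_m -> 'M[R]_N) (G : 'rV[R]_m -> 'M[R]_m).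
Variables (xi : 'rV[R]_m -> 'rV[R]_N).
Hypotheses (oW : open W) (kJ : Ck 0 W J) (kP : Ck 0 W P) (kxi : Ck 1 W xi).
Hypothesis PE : forall y, W y -> P y = 1%:M - (J y)^T *m G y *m J y.
Hypothesis PP : forall y, W y -> P y *m P y = P y.
Hypothesis JP : forall y, W y -> J y *m P y = 0.
Hypothesis xiJ : forall y, W y -> xi y *m (J y)^T = 0.

Let dconst n p (f : 'rV[R]_m -> 'M[R]_(n, p)) (a : 'M[R]_(n, p)) x v :
  W x -> (forall y, W y -> f y = a) -> 'D_v f x = 0.
Proof.
move=> Wx fa; rewrite -[RHS](derive_cst a x v).
by apply: near_eq_derive; exact: (near_open oW Wx).
Qed.

Let derive_trmx x v : W x -> 'D_v (fun y => (J y)^T) x = ('D_v J x)^T.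
Proof.
move=> Wx; have dJ : differentiable J x := Ck_differentiable kJ Wx.
have dJT : differentiable (fun y => (J y)^T) x.
  apply/differentiable_mxP => i j; under eq_fun do rewrite mxE.
  by move/differentiable_mxP : dJ; exact.
apply/matrixP => i j; rewrite [LHS](derive_mxE v i j dJT) [RHS]mxE [RHS](derive_mxE v j i dJ).
by under eq_fun do rewrite mxE.
Qed.

Let differentiable_trmx x : W x -> differentiable (fun y => (J y)^T) x.
Proof.
move=> Wx; have /differentiable_mxP dJ := Ck_differentiable kJ Wx.
by apply/differentiable_mxP => i j; under eq_fun do rewrite mxE.
Qed.

(* Differentiate [P P = P], [J P = 0] and [xi J^T = 0]. *)
Lemma derive_normal_connection x v w : W x ->
  'D_v (fun y => 'D_w xi y *m P y) x *m P x =
    'D_v ('D_w xi) x *m P x + xi x *m ('D_w J x)^T *m G x *m ('D_v J x *m P x).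
Proof.
move=> Wx.
have dJ : differentiable J x := Ck_differentiable kJ Wx.
have dP : differentiable P x := Ck_differentiable kP Wx.
have dxi : differentiable xi x := Ck_differentiable kxi Wx.
have dwxi : differentiable ('D_w xi) x := Ck_differentiable (Ck_derive w kxi) Wx.
have EP : 'D_v P x *m P x + P x *m 'D_v P x = 'D_v P x.
  rewrite -(derive_mulmx _ dP dP); apply: near_eq_derive.
  exact: (near_open oW Wx).
have EJP : 'D_v J x *m P x + J x *m 'D_v P x = 0.
  by rewrite -(derive_mulmx _ dJ dP); exact: dconst JP.
have ExiJ : 'D_w xi x *m (J x)^T + xi x *m ('D_w J x)^T = 0.
  rewrite -(derive_trmx w Wx) -(derive_mulmx w dxi (differentiable_trmx Wx)).
  exact: dconst xiJ.
rewrite (derive_mulmx v dwxi dP) mulmxDl -mulmxA PP //; congr (_ + _).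
exact: normal_connection_algebra (PE Wx) EP EJP ExiJ.
Qed.

End FlatNormal.

(** In [derive_normal_connection] the second derivative of xi is symmetric in v and w. The other
    term is the sum over i of v_i w_i / gam_i times [dot xi (nu i)] times the normal part of [nu i],
    symmetric because the metric and all shape operators are diagonal in the same coordinates. *)
Lemma principal_flat_normal (R : realType) m N (F : 'rV[R]_m -> 'rV[R]_N)
    (D : set 'rV[R]_m) (gam : 'I_m -> 'rV[R]_m -> R) kappa :
  open D -> smooth_on D F ->
  (forall y, D y -> induced_metric F y = diag_mx (\row_i gam i y)) ->
  (forall i y, D y -> 0 < gam i y) ->
  (forall x, D x -> principal_at F (gam^~ x) (kappa x) x) ->
  flat_normal_on F D.
Proof.
move=> oD sF gdiag gam_gt0 prin W xi oW WD [sxi xin] v w x Wx.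
have kF k : Ck k W F by apply: Ck_subset WD _; move: k; apply/smooth_onE.
have kxi k : Ck k W xi by move: k; apply/smooth_onE.
have dF y : W y -> differentiable F y by exact: Ck_differentiable (kF 0%N).
have JE y i : W y -> row i ('J F y) = 'D_(delta_mx 0 i) F y.
  by move=> Wy; rewrite rowE deriveEjacobian //; exact: dF.
have kJ : Ck 0 W (fun y => 'J F y).
  apply/(Ck_mxP _ _ oW) => i j.
  have /(Ck_mxP _ _ oW)/(_ 0 j) := Ck_derive (delta_mx 0 i) (kF 1%N).
  by apply: (eq_Ck oW) => y Wy; rewrite -JE // mxE.
have gam0 i y : W y -> (\row_i gam i y) 0 i != 0.
  by move=> Wy; rewrite mxE lt0r_neq0 // gam_gt0 //; exact: WD.
have kG : Ck 0 W (fun y => invmx (induced_metric F y)).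
  apply: Ck_subset WD _.
  exact: (@Ck_invmx_metric _ _ _ (induced_metric F) F D gam oD sF (fun _ _ => erefl) gdiag gam_gt0 0%N).
have gu y : W y -> induced_metric F y \in unitmx.
  by move=> Wy; rewrite gdiag ?(invmx_diag (fun i => gam0 i y Wy)) //; exact: WD.
have kJT : Ck 0 W (fun y => ('J F y)^T).
  apply/(Ck_mxP _ _ oW) => i j; under eq_fun do rewrite mxE.
  by have /(Ck_mxP _ _ oW) := kJ; exact.
have kP : Ck 0 W (normal_proj F).
  apply: CkB => //; first exact: Ck_cst.
  by apply: Ck_mulmx => //; exact: Ck_mulmx.
have JP y : W y -> 'J F y *m normal_proj F y = 0.
  by move=> Wy; rewrite mulmxBr mulmx1 !mulmxA mulmxV ?gu // mul1mx subrr.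
have PP y : W y -> normal_proj F y *m normal_proj F y = normal_proj F y.
  by move=> Wy; rewrite {1}/normal_proj mulmxBl mul1mx -[_ *m 'J F y *m _]mulmxA JP // mulmx0 subr0.
have xiJ y : W y -> xi y *m ('J F y)^T = 0.
  move=> Wy; apply/rowP => i; rewrite [RHS]mxE -[RHS](xin y Wy (delta_mx 0 i)) dotC /dot.
  by rewrite trmx_mul mulmxA trmx_delta -colE !mxE.
have main a b := @derive_normal_connection R m N W (jacobian F) (normal_proj F)
  (fun y => invmx (induced_metric F y)) xi oW kJ kP (kxi 1%N) (fun _ _ => erefl) PP JP xiJ x a b Wx.
have [nu [Fij nu_n _]] := prin x (WD x Wx).
have dJ : differentiable (jacobian F) x := Ck_differentiable kJ Wx.
(* The rows of the differentiated Jacobian are second derivatives of F; modulo tangent vectors only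
   the principal one survives. *)
have rowDJ a i : exists b : 'rV[R]_m, row i ('D_a (jacobian F) x) = b *m 'J F x + a 0 i *: nu i.
  have [c cE] := choice (fun j => Fij j i).
  exists (\sum_j a 0 j *: c j).
  have dFi : differentiable ('D_(delta_mx 0 i) F) x :=
    Ck_differentiable (Ck_derive (delta_mx 0 i) (kF 1%N)) Wx.
  transitivity ('D_a ('D_(delta_mx 0 i) F) x).
    apply/rowP => k; rewrite [LHS]mxE [LHS](derive_mxE a i k dJ) [RHS](derive_mxE a 0 k dFi).
    by apply: near_eq_derive; apply: (near_open oW Wx) => y Wy; rewrite -JE // [RHS]mxE.
  rewrite (derive_row_sum a dFi) mulmx_suml.
  under eq_bigr => j _ do rewrite cE scalerDr.
  rewrite big_split /=; congr (_ + _).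
    apply: eq_bigr => j _; rewrite -scalemxAl; congr (_ *: _).
    by apply: deriveEjacobian; exact: dF.
  rewrite (bigD1 i) //= eqxx scale1r big1 ?addr0 // => j ji.
  by rewrite (negPf ji) scale0r scaler0.
have xiDJ a : xi x *m ('D_a (jacobian F) x)^T = \row_i (a 0 i * dot (xi x) (nu i)).
  apply/rowP => i; rewrite !mxE; have [b bE] := rowDJ a i.
  transitivity (dot (xi x) (row i ('D_a (jacobian F) x))).
    by rewrite dotE; apply: eq_bigr => k _; rewrite !mxE.
  by rewrite bE dotDr dotZr dotC xin // add0r.
have DJP a : 'D_a (jacobian F) x *m normal_proj F x =
    \matrix_i (a 0 i *: (nu i *m normal_proj F x)).
  apply/row_matrixP => i; rewrite row_mul rowK; have [b ->] := rowDJ a i.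
  by rewrite mulmxDl -mulmxA JP // mulmx0 add0r scalemxAl.
apply/eqP; rewrite subr_eq0; apply/eqP.
have combine (A A' B B' : 'rV[R]_N) (Q : 'M[R]_N) :
  A = A' -> B = B' -> A *m Q + B = A' *m Q + B' by move=> -> ->.
apply: (etrans (main v w)); apply/esym/(etrans (main w v)).
apply: combine; first exact: (Schwarz_mx v w oW Wx (kxi 1%N)).
rewrite [X in X *m _ *m _ = _]xiDJ [X in _ = X *m _ *m _]xiDJ.
rewrite [X in _ *m _ *m X = _]DJP [X in _ = _ *m _ *m X]DJP gdiag; last exact: WD.
rewrite (invmx_diag (fun i => gam0 i x Wx)).
apply/rowP => k; rewrite !mxE; apply: eq_bigr => i _.
rewrite !mul_mx_diag !mxE; move: (\sum_(j < N) _) (dot _ _) (gam i x) => p q r.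
by ring.
Qed.

(** * Diagonal curvature tensors *)

Section DiagonalCurvature.
Context {R : realType} {m : nat}.
Implicit Types (g : 'rV[R]_m -> 'M[R]_m) (x y u v w z : 'rV[R]_m).

Lemma inner_diag (d u v : 'rV[R]_m) :
  inner (diag_mx d) u v = \sum_i d 0 i * (u 0 i * v 0 i).
Proof.
rewrite /inner mxE; apply: eq_bigr => i _.
by rewrite mul_mx_diag !mxE mulrAC mulrC mulrA.
Qed.

Lemma ricci_diagonal g gam kappa x : diagonal_curvature g gam kappa x ->
  ricci g x = diag_mx (\row_j (gam j * \sum_(i | i != j) kappa i j)).
Proof.
move=> [_ gam_gt0 Rg]; apply/matrixP => j k; rewrite !mxE.
have coefE i : riemann_coef g i i j k x =
    ((j == k)%:R - ((i == k) && (j == i))%:R) * (kappa i j * gam j).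
  apply: (mulIf (lt0r_neq0 (gam_gt0 i))); rewrite Rg eqxx andbT.
  by ring.
under eq_bigr do rewrite coefE.
have [<-|jk] := eqVneq j k; last first.
  rewrite mulr0n big1 // => i _; case: eqP => [->|]; last by rewrite subr0 mul0r.
  by rewrite (negPf jk) subr0 mul0r.
rewrite mulr1n (bigD1 j) //= eqxx subrr mul0r add0r mulr_sumr.
by apply: eq_bigr => i ij; rewrite (negPf ij) subr0 mul1r mulrC.
Qed.

Lemma ricci_endo_diagonal g gam kappa x : diagonal_curvature g gam kappa x ->
  ricci_endo g x = diag_mx (\row_j \sum_(i | i != j) kappa i j).
Proof.
move=> dc; have [gE gam_gt0 _] := dc; rewrite /ricci_endo (ricci_diagonal dc) gE.
have gam0 i : (\row_i gam i) 0 i != 0 by rewrite mxE lt0r_neq0.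
rewrite (invmx_diag gam0) mulmx_diag; congr diag_mx; apply/rowP => j; rewrite !mxE.
by rewrite mulrAC mulfV ?mul1r // lt0r_neq0.
Qed.

Lemma riemann_diagonal g gam kappa x u v w z : diagonal_curvature g gam kappa x ->
  riemann g x u v w z = \sum_i \sum_j kappa i j * gam i * gam j
    * (u 0 i * v 0 j * (w 0 j * z 0 i - w 0 i * z 0 j)).
Proof.
move=> [gE _ Rg]; rewrite /riemann gE inner_diag.
have termE l i j k : gam l * (u 0 i * v 0 j * w 0 k * riemann_coef g l i j k x * z 0 l) =
  (((j == k) && (i == l))%:R - ((i == k) && (j == l))%:R)
      * (kappa i j * gam i * gam j) * (u 0 i * v 0 j * w 0 k * z 0 l).
  by rewrite -Rg; ring.
transitivity (\sum_l \sum_i \sum_j \sum_k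
  (((j == k) && (i == l))%:R - ((i == k) && (j == l))%:R)
      * (kappa i j * gam i * gam j) * (u 0 i * v 0 j * w 0 k * z 0 l)).
  apply: eq_bigr => l _; rewrite !mxE mulr_suml mulr_sumr; apply: eq_bigr => i _.
  rewrite mulr_suml mulr_sumr; apply: eq_bigr => j _.
  by rewrite mulr_suml mulr_sumr; apply: eq_bigr => k _; rewrite -termE.
rewrite exchange_big; apply: eq_bigr => i _; rewrite exchange_big; apply: eq_bigr => j _ /=.
transitivity (\sum_l \sum_k ((j == k)%:R * w 0 k) * ((i == l)%:R * z 0 l) * (kappa i j * gam i * gam j * (u 0 i * v 0 j))
  - \sum_l \sum_k ((i == k)%:R * w 0 k) * ((j == l)%:R * z 0 l) * (kappa i j * gam i * gam j * (u 0 i * v 0 j))).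
  rewrite -sumrB; apply: eq_bigr => l _; rewrite -sumrB; apply: eq_bigr => k _.
  by rewrite -!mulnb !natrM; ring.
have delta (a : 'I_m) (f : 'rV[R]_m) : \sum_k (a == k)%:R * f 0 k = f 0 a.
  rewrite (bigD1 a) //= eqxx mul1r big1 ?addr0 // => k ka.
  by rewrite eq_sym (negPf ka) mul0r.
have dd (a b : 'I_m) c : \sum_l \sum_k ((a == k)%:R * w 0 k) * ((b == l)%:R * z 0 l) * c =
    w 0 a * z 0 b * c.
  under eq_bigr => l _ do rewrite -mulr_suml -mulr_suml delta.
  by rewrite -mulr_suml -mulr_sumr delta.
by rewrite !dd; ring.
Qed.

(** The image under J of the coordinate plane (i, j) has the same sectional curvature. For a
    diagonal curvature tensor this is a mean of the [kappa' p q] with nonnegative weights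
    proportional to gam'_p gam'_q (a_p b_q - a_q b_p)^2, so a bound on the coordinate planes bounds
    every plane. *)
Lemma isometry_curvature_le g g' gam gam' kappa kappa' x y (B : R) (J : 'M[R]_m) :
  diagonal_curvature g gam kappa x -> diagonal_curvature g' gam' kappa' y ->
  (forall i j, kappa' i j = kappa' j i) ->
  (forall i j, i != j -> kappa' i j <= B) ->
  (forall u v, inner (g' y) (u *m J) (v *m J) = inner (g x) u v) ->
  (forall u v w z, riemann g' y (u *m J) (v *m J) (w *m J) (z *m J)
      = riemann g x u v w z) ->
  forall i j, i != j -> kappa i j <= B.
Proof.
move=> dc dc' ks kB isoI isoR i j ij.
have [gE gam_gt0 _] := dc; have [gE' gam_gt0' _] := dc'.
pose u : 'rV[R]_m := delta_mx 0 i; pose v : 'rV[R]_m := delta_mx 0 j.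
have innerd a b : inner (g x) (delta_mx 0 a) (delta_mx 0 b) = (a == b)%:R * gam a.
  rewrite gE inner_diag (bigD1 a) //= big1 => [|c ca]; last by rewrite !mxE (negPf ca) mul0r mulr0.
  by rewrite !mxE !eqxx /= addr0 mul1r mulrC.
set a := u *m J; set b := v *m J.
(* Lagrange's identity: the same weighted sum with all curvatures equal to 1 is the squared area
   spanned by a and b. *)
have E : \sum_i \sum_j gam' i * gam' j * (a 0 i * b 0 j * (b 0 j * a 0 i - b 0 i * a 0 j))
    = gam i * gam j.
  transitivity (inner (g' y) a a * inner (g' y) b b - inner (g' y) a b ^+ 2).
    rewrite gE' !inner_diag expr2 !big_distrlr /= -sumrB; apply: eq_bigr => p _.
    by rewrite -sumrB; apply: eq_bigr => q _; rewrite !mxE; ring.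
  by rewrite /a /b !isoI /u /v !innerd !eqxx (negPf ij) !mul1r mul0r expr0n subr0.
have Q : riemann g x u v v u = kappa i j * (gam i * gam j).
  rewrite (riemann_diagonal _ _ _ _ dc) (bigD1 i) //= [X in _ + X]big1 ?addr0 => [|k ki]; last first.
    by rewrite big1 // => l _; rewrite /u !mxE (negPf ki) andbF !(mulr0, mul0r).
  rewrite (bigD1 j) //= big1 ?addr0 => [|k kj]; last first.
    by rewrite /v !mxE (negPf kj) andbF !(mulr0, mul0r).
  have ji : (j == i) = false by rewrite eq_sym (negPf ij).
  by rewrite /u /v !mxE !eqxx (negPf ij) ji /=; ring.
have gg : 0 < gam i * gam j by rewrite mulr_gt0.
rewrite -(ler_pM2r gg) -Q -isoR -/a -/b -[X in _ <= B * X]E (riemann_diagonal _ _ _ _ dc').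
rewrite -subr_ge0 mulr_sumr -sumrB.
set S := \sum_p _.
(* A single summand has no sign; adding the one with p and q exchanged completes the square. *)
have S2 : S + S = \sum_p \sum_q (B - kappa' p q) * gam' p * gam' q * (a 0 p * b 0 q - a 0 q * b 0 p) ^+ 2.
  have -> : S = \sum_p \sum_q (B - kappa' p q) * gam' p * gam' q * (a 0 p * b 0 q * (b 0 q * a 0 p - b 0 p * a 0 q)).
    by apply: eq_bigr => p _; rewrite mulr_sumr -sumrB; apply: eq_bigr => q _; ring.
  rewrite [X in _ + X]exchange_big -big_split; apply: eq_bigr => p _ /=.
  by rewrite -big_split; apply: eq_bigr => q _ /=; rewrite (ks q p); ring.
have : 0 <= S + S.
  rewrite S2; apply: sumr_ge0 => p _; apply: sumr_ge0 => q _.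
  have [->|pq] := eqVneq p q; first by rewrite subrr expr0n mulr0.
  apply: mulr_ge0; last exact: sqr_ge0.
  apply: mulr_ge0; last exact: ltW.
  by apply: mulr_ge0; [rewrite subr_ge0 kB | exact: ltW].
by rewrite -mulr2n pmulrn_lge0.
Qed.

(* The two Laplace expansions of the 4x4 determinant along the row pairs (0, 1)
   and (0, 2). *)
Lemma laplace_4x4 (q : R) (h : 'I_m -> 'I_m -> R) (i j k l : 'I_m)
    (M : 'I_m -> 'I_m -> 'I_m -> 'I_m -> R) :
  (forall a b c d, M a b c d = q * (h b c * h a d - h a c * h b d)) ->
  M i j i k = 0 -> M i j i l = 0 -> M i j j k = 0 -> M i j j l = 0 ->
  M i j k l = 0 -> M i k i j = 0 -> M i k i l = 0 -> M i k j k = 0 ->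
  M i k j l = 0 -> M i k k l = 0 ->
  M i j j i * M k l l k = M i k k i * M j l l j.
Proof.
move=> ME H1 H2 H3 H4 H5 H6 H7 H8 H9 H10.
have -> : M i j j i * M k l l k = M i k k i * M j l l j
  + M i j i k * M k l j l - M i j i l * M k l j k - M i j j k * M k l i l
  + M i j j l * M k l i k - M i j k l * M k l i j - M i k i j * M j l k l
  - M i k i l * M j l j k - M i k j k * M j l i l + M i k j l * M j l i k
  - M i k k l * M j l i j by rewrite !ME; ring.
by rewrite H1 H2 H3 H4 H5 H6 H7 H8 H9 H10 !mul0r !(subr0, addr0).
Qed.

Lemma rank1_rowP n p (K : 'M[R]_(p, n)) : (\rank K <= 1)%N ->
  exists nu : 'rV[R]_n, forall w : 'rV[R]_n, (w <= K)%MS -> exists a, w = a *: nu.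
Proof.
move=> K1; exists (nz_row K) => w wK; apply/sub_rVP/(submx_trans wK).
have [->|K0] := eqVneq K 0; first exact: sub0mx.
rewrite -(geq_leqif (mxrank_leqif_sup (nz_row_sub K))).
by rewrite rank_rV nz_row_eq0 K0.
Qed.

(* The normal space has dimension at most one, so the second fundamental form is
   a multiple [h] of a single vector. *)
Lemma diagonal_curvature_codim_le1 N g gam kappa (f : 'rV[R]_m -> 'rV[R]_N)
    (W : set 'rV[R]_m) x (i j k l : 'I_m) :
  diagonal_curvature g gam kappa x -> open W -> smooth_on W f -> W x ->
  (forall y, W y -> induced_metric f y = g y) ->
  (forall y, W y -> g y \in unitmx) ->
  (forall a b c, differentiable (christoffel g a b c) x) ->
  (N <= m.+1)%N -> uniq [:: i; j; k; l] ->
  kappa i j * kappa k l = kappa i k * kappa j l.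
Proof.
move=> [gE gam_gt0 Rg] oW sf Wx fg gU dchr Nm uq.
have kf : Ck 2 W f by move: {1}2%N; apply/smooth_onE.
have df : differentiable f x := Ck_differentiable kf Wx.
pose F1 (i : 'I_m) : 'rV[R]_m -> 'rV[R]_N := 'D_(delta_mx 0 i) f.
pose F2 (i j : 'I_m) : 'rV[R]_m -> 'rV[R]_N := 'D_(delta_mx 0 i) (F1 j).
pose II i j x := F2 i j x - \sum_l christoffel g l i j x *: F1 l x.
have IIn a b c : dot (II a b x) (F1 c x) = 0.
  exact: (@dot_second_fundamental_form _ _ _ g f W oW kf fg gU F1 F2 _ _ II).
have dc v a b c : derivable (christoffel g a b c) x v by apply: diff_derivable.
have Gauss a b c r := @Gauss_equation _ _ _ g f W oW kf fg gU F1 F2 (fun=> erefl)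
  (fun _ _ => erefl) II (fun _ _ _ => erefl) a b c r x Wx (fun l a b => conj (dc _ l a b) (dc _ l a b)).
pose J : 'M[R]_(m, N) := 'J f x.
have rJ : \rank J = m.
  apply/eqP; rewrite eqn_leq rank_leq_row /= -{1}(mxrank_unit (gU _ Wx)) -fg //.
  by rewrite /induced_metric mxrankM_maxl.
(* The normal space is the kernel of J^T, of dimension N - m, which is at most 1. *)
have [|nu nuP] := @rank1_rowP N N (kermx J^T).
  by rewrite mxrank_ker mxrank_tr rJ leq_subLR addn1.
have IInu a b : exists h, II a b x = h *: nu.
  apply: nuP; apply/sub_kermxP/rowP => c; rewrite [RHS]mxE -[RHS](IIn a b c).
  rewrite /F1 deriveEjacobian // -/J dotE -rowE mxE.
  by apply: eq_bigr => e _; rewrite !mxE.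
have [h hE] := choice (fun ab : 'I_m * 'I_m => IInu ab.1 ab.2).
pose hh a b := h (a, b); pose q := dot nu nu.
(* [M] consists of the 2x2 minors of [hh] up to the factor q, and by the Gauss equation it is the
   curvature tensor. Diagonality makes the mixed minors required by [laplace_4x4] vanish. *)
pose M a b c d := q * (hh b c * hh a d - hh a c * hh b d).
have ME a b c d : M a b c d = (((b == c) && (a == d))%:R - ((a == c) && (b == d))%:R)
      * (kappa a b * gam a * gam b).
  rewrite -Rg; have := Gauss a b c d.
  rewrite (bigD1 d) //= big1 ?addr0 => [|e ed]; last by rewrite gE !mxE (negPf ed) mulr0.
  rewrite gE !mxE eqxx mulr1n => ->.
  have hhE a' b' : II a' b' x = hh a' b' *: nu by exact: hE (a', b').
  by rewrite !hhE !dotZl !dotZr /M -/q; ring.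
move: uq; rewrite /= !inE !negb_or ?andbT -!andbA => /and5P[ij ik il jk /andP[jl kl]].
have [[ji ki] li] := (eq_sym j i, eq_sym k i, eq_sym l i).
have [[kj lj] lk] := (eq_sym k j, eq_sym l j, eq_sym l k).
have := @laplace_4x4 q hh i j k l M (fun _ _ _ _ => erefl); rewrite !ME.
rewrite ?eqxx ?ji ?ki ?li ?kj ?lj ?lk ?(negPf ij) ?(negPf ik) ?(negPf il) ?(negPf jk) ?(negPf jl) ?(negPf kl).
rewrite /= !subr0 !mul0r !mul1r => /(_ erefl erefl erefl erefl erefl erefl erefl erefl erefl erefl) E.
have gg : gam i * gam j * gam k * gam l != 0 by rewrite !mulf_neq0 // lt0r_neq0.
apply: (mulIf gg).
transitivity (kappa i j * gam i * gam j * (kappa k l * gam k * gam l)); first by ring.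
by rewrite E; ring.
Qed.

End DiagonalCurvature.

(** * Derivative rules for explicit formulas *)

Section DerivativeTools.
Context {R : realType} {V : normedModType R}.
Implicit Types (x v : V).

Lemma is_derive_mx m n (f : V -> 'M[R]_(m, n)) (df : 'M[R]_(m, n)) x v :
  (forall i j, is_derive x v (fun y => f y i j) (df i j)) -> is_derive x v f df.
Proof.
move=> H; have dF : derivable f x v by apply/derivable_mxP => i j; have [] := H i j.
split=> //; rewrite (derive_mx dF); apply/matrixP => i j; rewrite mxE.
by have [_ ->] := H i j.
Qed.

Lemma is_derive_coord m n (f : V -> 'M[R]_(m, n)) df x v i j :
  is_derive x v f df -> is_derive x v (fun y => f y i j) (df i j).
Proof.
move=> [dF <-]; rewrite (derive_mx dF) mxE; apply: derivableP.
by move/derivable_mxP : dF; exact.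
Qed.

Lemma is_derive_mulr (f g : V -> R) df dg x v :
  is_derive x v f df -> is_derive x v g dg ->
  is_derive x v (fun y => f y * g y) (df * g x + f x * dg).
Proof.
move=> Hf Hg; apply: (is_derive_eq (is_deriveM Hf Hg)).
by rewrite addrC /GRing.scale /= mulrC.
Qed.

Lemma is_derive_addr (W : normedModType R) (f g : V -> W) df dg x v :
  is_derive x v f df -> is_derive x v g dg ->
  is_derive x v (fun y => f y + g y) (df + dg).
Proof. exact: is_deriveD. Qed.

Lemma is_derive_subr (W : normedModType R) (f g : V -> W) df dg x v :
  is_derive x v f df -> is_derive x v g dg ->
  is_derive x v (fun y => f y - g y) (df - dg).
Proof. exact: is_deriveB. Qed.

Lemma is_derive_const (W : normedModType R) (a : W) x v :
  is_derive x v (fun=> a) 0.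
Proof. exact: is_derive_cst. Qed.

Lemma is_derive_scale m n (a : V -> R) (f : V -> 'M[R]_(m, n)) da df x v :
  is_derive x v a da -> is_derive x v f df ->
  is_derive x v (fun y => a y *: f y) (da *: f x + a x *: df).
Proof.
move=> Ha Hf; apply: is_derive_mx => i j.
under eq_fun do rewrite mxE; rewrite !mxE.
exact: is_derive_mulr Ha (is_derive_coord i j Hf).
Qed.

Lemma is_derive_row_mx m n1 n2 (f : V -> 'M[R]_(m, n1)) (g : V -> 'M[R]_(m, n2)) df dg x v :
  is_derive x v f df -> is_derive x v g dg ->
  is_derive x v (fun y => row_mx (f y) (g y)) (row_mx df dg).
Proof.
move=> Hf Hg; apply: is_derive_mx => i j; rewrite -(splitK j).
case: (fintype.split j) => j' /=; rewrite ?row_mxEl ?row_mxEr.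
  by under eq_fun do rewrite row_mxEl; exact: is_derive_coord.
by under eq_fun do rewrite row_mxEr; exact: is_derive_coord.
Qed.

Lemma is_derive_scalar_mx (f : V -> R) df x v :
  is_derive x v f df -> is_derive x v (fun y => (f y)%:M : 'rV[R]_1) df%:M.
Proof.
move=> Hf; apply: is_derive_mx => i j; rewrite !ord1 mxE.
by under eq_fun do rewrite mxE.
Qed.

Lemma Ck_scale m n k (U : set V) (a : V -> R) (f : V -> 'M[R]_(m, n)) : open U ->
  Ck k U a -> Ck k U f -> Ck k U (fun y => a y *: f y).
Proof.
move=> oU ka /(Ck_mxP _ _ oU) kf; apply/(Ck_mxP _ _ oU) => i j.
by apply: (eq_Ck oU _ (CkM oU ka (kf i j))) => y _; rewrite mxE.
Qed.

Lemma Ck_row_mx m n1 n2 k (U : set V) (f : V -> 'M[R]_(m, n1)) (g : V -> 'M[R]_(m, n2)) :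
  open U -> Ck k U f -> Ck k U g -> Ck k U (fun y => row_mx (f y) (g y)).
Proof.
move=> oU /(Ck_mxP _ _ oU) kf /(Ck_mxP _ _ oU) kg; apply/(Ck_mxP _ _ oU) => i j.
rewrite -(splitK j); case: (fintype.split j) => j' /=.
  by apply: (eq_Ck oU _ (kf i j')) => y _; rewrite row_mxEl.
by apply: (eq_Ck oU _ (kg i j')) => y _; rewrite row_mxEr.
Qed.

Lemma Ck_scalar_mx k (U : set V) (f : V -> R) : open U ->
  Ck k U f -> Ck k U (fun y => (f y)%:M : 'rV[R]_1).
Proof.
move=> oU kf; apply/(Ck_mxP _ _ oU) => i j; rewrite !ord1.
by apply: (eq_Ck oU _ kf) => y _; rewrite mxE.
Qed.

Lemma is_derive_dot n (f g : V -> 'rV[R]_n) df dg x v :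
  is_derive x v f df -> is_derive x v g dg ->
  is_derive x v (fun y => dot (f y) (g y)) (dot df (g x) + dot (f x) dg).
Proof.
move=> Hf Hg; under eq_fun do rewrite dotE.
rewrite !dotE -big_split /=.
have -> : (fun y => \sum_k f y 0 k * g y 0 k) = \sum_k (fun y => f y 0 k * g y 0 k).
  by apply/funext => y; rewrite fct_sumE.
apply: is_derive_sum => k; apply: is_derive_mulr; exact: is_derive_coord.
Qed.

Lemma is_derive_inv (f : V -> R) df x v : is_derive x v f df -> f x != 0 ->
  is_derive x v (fun y => (f y)^-1) (- (f x)^-1 ^+ 2 * df).
Proof.
move=> [dF <-] fx0; split; first exact: derivableV.
by rewrite deriveV // /GRing.scale /= exprVn.
Qed.

Lemma is_derive_comp (W W' : normedModType R) (f : V -> W) (g : W -> W') x v w dg :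
  differentiable f x -> differentiable g (f x) ->
  is_derive x v f w -> is_derive (f x) w g dg ->
  is_derive x v (g \o f) dg.
Proof.
move=> df dg' [_ fw] [_ <-]; split.
  by apply: diff_derivable; exact: differentiable_comp.
by rewrite derive_comp // fw.
Qed.

Lemma is_derive_comp1 (f : V -> R) (g : R -> R) x v df :
  differentiable f x -> derivable g (f x) 1 -> is_derive x v f df ->
  is_derive x v (fun y => g (f y)) ((g^`())%classic (f x) * df).
Proof.
move=> dF /derivable1_diffP dg Hf.
have -> : (g^`())%classic (f x) * df = 'D_df g (f x).
  by rewrite derive1E !deriveE // -[in RHS](mulr1 df) mulrC [RHS]linearZ.
apply: (is_derive_comp dF dg Hf); apply: derivableP; exact: diff_derivable.
Qed.

Lemma dot_row_mx n1 n2 (u1 v1 : 'rV[R]_n1) (u2 v2 : 'rV[R]_n2) :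
  dot (row_mx u1 u2) (row_mx v1 v2) = dot u1 v1 + dot u2 v2.
Proof. by rewrite /dot tr_row_mx mul_row_col mxE. Qed.

Lemma dot_deltal n (i : 'I_n) (u : 'rV[R]_n) : dot (delta_mx 0 i) u = u 0 i.
Proof.
rewrite dotE (bigD1 i) //= big1 ?addr0 => [|c ci]; first by rewrite mxE !eqxx mul1r.
by rewrite mxE (negPf ci) andbF mul0r.
Qed.

Lemma dot_scalar_mx (a b : R) : dot (a%:M : 'rV_1) b%:M = a * b.
Proof. by rewrite dotE big_ord1 !mxE. Qed.

End DerivativeTools.

(** * Stereographic coordinates on the sphere *)

Section Stereographic.
Context {R : realType} {d : nat} (s : bool).
Implicit Types (y w z : 'rV[R]_d).

Definition conformal_factor y : R := 2 / (dot y y + 1).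
Local Notation lam := conformal_factor.

Lemma dot1_gt0 y : 0 < dot y y + 1.
Proof. by rewrite ltr_wpDl // dot_ge0. Qed.

Lemma conformal_factor_gt0 y : 0 < lam y.
Proof. by rewrite divr_gt0 // dot1_gt0. Qed.

(** The relation that eliminates the squared length of y from the computations below. *)
Lemma conformal_factor_dot y : lam y * dot y y = 2 - lam y.
Proof. by rewrite /lam; field; rewrite lt0r_neq0 // dot1_gt0. Qed.

Definition inv_stereo1 y w : 'rV[R]_(d + 1) :=
  row_mx (lam y *: w - (lam y ^+ 2 * dot y w) *: y)
    ((-1) ^+ s * (lam y ^+ 2 * dot y w))%:M.

Lemma inv_stereoE y : inv_stereo s y =
  row_mx (lam y *: y) ((-1) ^+ s * (1 - lam y))%:M.
Proof.
congr (row_mx _ _%:M); congr (_ * _); rewrite /lam; field.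
by rewrite lt0r_neq0 // dot1_gt0.
Qed.

Lemma is_derive_conformal_factor y w : is_derive y w lam (- lam y ^+ 2 * dot y w).
Proof.
have H := is_derive_addr (is_derive_dot (is_derive_id y w) (is_derive_id y w))
  (is_derive_const (1 : R) y w).
have n0 : dot y y + 1 != 0 by rewrite lt0r_neq0 // dot1_gt0.
rewrite -[conformal_factor]/(fun y => 2 / (dot y y + 1)).
apply: (is_derive_eq (is_derive_mulr (is_derive_const (2 : R) y w) (is_derive_inv H n0))).
by rewrite (dotC w) addr0 /lam; field.
Qed.

Lemma is_derive_inv_stereo y w : is_derive y w (inv_stereo s) (inv_stereo1 y w).
Proof.
rewrite (_ : inv_stereo s = fun y => row_mx (lam y *: y) ((-1) ^+ s * (1 - lam y))%:M); last first.
  by apply/funext => z; exact: inv_stereoE.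
have dl := is_derive_conformal_factor y w.
apply: is_derive_row_mx.
  by apply: (is_derive_eq (is_derive_scale dl (is_derive_id y w))); rewrite mulNr scaleNr addrC.
apply: is_derive_scalar_mx.
apply: (is_derive_eq (is_derive_mulr (is_derive_const _ y w)
  (is_derive_subr (is_derive_const (1 : R) y w) dl))).
by ring.
Qed.

(** The Gauss formula of the unit sphere. The three [inv_stereo1] terms are the Levi-Civita
    connection of the conformal metric lam^2 |dy|^2; the last term is normal and equals minus the
    metric of w and z times the position vector. *)
Lemma is_derive_inv_stereo1 y w z : is_derive y z (inv_stereo1^~ w)
  (- (lam y * dot y z) *: inv_stereo1 y w - (lam y * dot y w) *: inv_stereo1 y z
   + (lam y * dot w z) *: inv_stereo1 y y - (lam y ^+ 2 * dot w z) *: inv_stereo s y).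
Proof.
have dl := is_derive_conformal_factor y z.
have dlw : is_derive y z (fun y => lam y ^+ 2 * dot y w)
   (- 2 * lam y ^+ 3 * dot y z * dot y w + lam y ^+ 2 * dot z w).
  apply: (is_derive_eq (is_derive_mulr (is_derive_mulr dl dl)
     (is_derive_dot (is_derive_id y z) (is_derive_const w y z)))).
  by rewrite dot0r; ring.
have H := is_derive_row_mx
  (is_derive_subr (is_derive_scale dl (is_derive_const w y z))
     (is_derive_scale dlw (is_derive_id y z)))
  (is_derive_scalar_mx (is_derive_mulr (is_derive_const ((-1) ^+ s : R) y z) dlw)).
apply: (is_derive_eq H).
rewrite inv_stereoE /inv_stereo1 !scale_row_mx !opp_row_mx !add_row_mx.
have E := conformal_factor_dot y.
congr (row_mx _ _).
  apply/rowP => i; rewrite !mxE (dotC z w).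
  have -> : lam y ^+ 2 * dot y y = lam y * (2 - lam y) by rewrite -E; ring.
  by ring.
apply/rowP => i; rewrite !ord1 !mxE (dotC z w) !mulr1n.
have -> : lam y ^+ 2 * dot y y = lam y * (2 - lam y) by rewrite -E; ring.
by ring.
Qed.

Let sign_mulK (a b : R) : (-1) ^+ s * a * ((-1) ^+ s * b) = a * b.
Proof. by rewrite mulrACA -expr2 sqrr_sign mul1r. Qed.

Lemma dot_inv_stereo y : dot (inv_stereo s y) (inv_stereo s y) = 1.
Proof.
rewrite inv_stereoE dot_row_mx dot_scalar_mx dotZl dotZr.
rewrite conformal_factor_dot sign_mulK; ring.
Qed.

Lemma dot_inv_stereo1 y w : dot (inv_stereo s y) (inv_stereo1 y w) = 0.
Proof.
rewrite inv_stereoE dot_row_mx dot_scalar_mx dotZl dotBr !dotZr.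
have -> : lam y * (lam y * dot y w - lam y ^+ 2 * dot y w * dot y y) =
  lam y ^+ 2 * dot y w * (1 - lam y * dot y y) by ring.
rewrite conformal_factor_dot sign_mulK; ring.
Qed.

Lemma dot_inv_stereo11 y w z :
  dot (inv_stereo1 y w) (inv_stereo1 y z) = lam y ^+ 2 * dot w z.
Proof.
rewrite dot_row_mx dot_scalar_mx dotBl !dotBr !dotZl !dotZr.
rewrite sign_mulK (dotC w y).
have E := conformal_factor_dot y.
transitivity (lam y ^+ 2 * dot w z - 2 * lam y ^+ 3 * dot y w * dot y z
  + lam y ^+ 3 * dot y w * dot y z * (lam y * dot y y)
  + lam y ^+ 4 * dot y w * dot y z); first by ring.
by rewrite E; ring.
Qed.

Lemma smooth_conformal_factor : smooth_on setT lam.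
Proof.
apply/smooth_onE => k; have oT : open [set: 'rV[R]_d] := openT.
have kid : Ck k setT (@idfun 'rV[R]_d) by apply: linear_Ck => x.
apply: CkM => //; first exact: Ck_cst.
apply: CkV => // [y _|]; first by rewrite lt0r_neq0 // dot1_gt0.
by apply: CkD => //; [exact: Ck_dot|exact: Ck_cst].
Qed.

Lemma smooth_inv_stereo : smooth_on setT (@inv_stereo R d s).
Proof.
have oT : open [set: 'rV[R]_d] := openT.
apply/smooth_onE => k; have kl : Ck k setT lam by move: k; apply/smooth_onE/smooth_conformal_factor.
have kid : Ck k setT (@idfun 'rV[R]_d) by apply: linear_Ck => x.
rewrite (_ : inv_stereo s = fun y => row_mx (lam y *: y) ((-1) ^+ s * (1 - lam y))%:M); last first.
  by apply/funext => z; exact: inv_stereoE.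
apply: Ck_row_mx => //; first exact: Ck_scale.
apply: Ck_scalar_mx => //; apply: CkM => //; first exact: Ck_cst.
by apply: CkB => //; exact: Ck_cst.
Qed.

Lemma induced_metric_inv_stereo y :
  induced_metric (@inv_stereo R d s) y = (lam y ^+ 2)%:M.
Proof.
have dS : differentiable (@inv_stereo R d s) y.
  by move/smooth_onE: smooth_inv_stereo => /(_ 0%N)/Ck_differentiable; exact.
apply/matrixP => i j; rewrite induced_metricE //.
have [_ ->] := is_derive_inv_stereo y (delta_mx 0 i).
have [_ ->] := is_derive_inv_stereo y (delta_mx 0 j).
rewrite dot_inv_stereo11 [RHS]mxE -[RHS]mulr_natr; congr (_ * _).
by rewrite dot_deltal mxE eqxx.
Qed.

End Stereographic.

Lemma Ck_derive1 (R : realType) (I : set R) (f : R -> R) k :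
  open I -> Ck k.+1 I f -> Ck k I (f^`())%classic.
Proof.
move=> oI kf; apply: (eq_Ck oI _ (Ck_derive (1 : R) kf)) => t It.
by rewrite derive1E.
Qed.

Lemma smooth_derive1 (R : realType) (I : set R) (f : R -> R) :
  open I -> smooth_on I f -> smooth_on I (f^`())%classic.
Proof. by move=> oI /smooth_onE sf; apply/smooth_onE => k; exact: Ck_derive1. Qed.

Lemma smooth_derivable (R : realType) (I : set R) (f : R -> R) t :
  smooth_on I f -> I t -> derivable f t 1.
Proof. by move=> sf It; apply/derivable1_diffP; exact: (sf [::]). Qed.

Section InvStereo1.
Context {R : realType} {d : nat} (s : bool).
Implicit Types (y w : 'rV[R]_d).

Lemma inv_stereo1D y w w' : inv_stereo1 s y (w + w') = inv_stereo1 s y w + inv_stereo1 s y w'.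
Proof.
rewrite /inv_stereo1 add_row_mx dotDr; congr (row_mx _ _).
  by apply/rowP => i; rewrite !mxE; ring.
by apply/rowP => i; rewrite !mxE !ord1 /= !mulr1n; ring.
Qed.

Lemma inv_stereo1Z y a w : inv_stereo1 s y (a *: w) = a *: inv_stereo1 s y w.
Proof.
rewrite /inv_stereo1 scale_row_mx dotZr; congr (row_mx _ _).
  by apply/rowP => i; rewrite !mxE; ring.
by apply/rowP => i; rewrite !mxE !ord1 /= !mulr1n; ring.
Qed.

End InvStereo1.

Section Circle.
Context {R : realType}.

Definition circle (a : R) : 'rV[R]_2 := row_mx (cos a)%:M (sin a)%:M.
Definition circle_normal (a : R) : 'rV[R]_2 := row_mx (- sin a)%:M (cos a)%:M.

Lemma dot_circle a : dot (circle a) (circle a) = 1.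
Proof. by rewrite (@dot_row_mx _ 1 1) !dot_scalar_mx -!expr2 cos2Dsin2. Qed.

Lemma dot_circle_normal a : dot (circle_normal a) (circle_normal a) = 1.
Proof. by rewrite (@dot_row_mx _ 1 1) !dot_scalar_mx mulrNN -!expr2 addrC cos2Dsin2. Qed.

Lemma dot_circle_circle_normal a : dot (circle a) (circle_normal a) = 0.
Proof. by rewrite (@dot_row_mx _ 1 1) !dot_scalar_mx; ring. Qed.

Lemma is_derive_circle (V : normedModType R) (f : V -> R) df x v :
  differentiable f x -> is_derive x v f df ->
  is_derive x v (fun y => circle (f y)) (df *: circle_normal (f x)).
Proof.
move=> dF Hf; have dcos : derivable (@cos R) (f x) 1 by exact: derivable_cos.
have dsin : derivable (@sin R) (f x) 1 by exact: derivable_sin.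
have H := @is_derive_row_mx _ _ 1 1 1 _ _ _ _ _ _
   (is_derive_scalar_mx (is_derive_comp1 dF dcos Hf))
  (is_derive_scalar_mx (is_derive_comp1 dF dsin Hf)).
apply: (is_derive_eq H); rewrite !derive1E !derive_val /circle_normal (@scale_row_mx _ 1 1 1).
by congr (row_mx _ _); rewrite scale_scalar_mx mulrC.
Qed.

Lemma is_derive_circle_normal (V : normedModType R) (f : V -> R) df x v :
  differentiable f x -> is_derive x v f df ->
  is_derive x v (fun y => circle_normal (f y)) (- df *: circle (f x)).
Proof.
move=> dF Hf; have dcos : derivable (@cos R) (f x) 1 by exact: derivable_cos.
have dsin : derivable (@sin R) (f x) 1 by exact: derivable_sin.
have H := @is_derive_row_mx _ _ 1 1 1 _ _ _ _ _ _
   (is_derive_scalar_mx (is_deriveN (is_derive_comp1 dF dsin Hf)))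
  (is_derive_scalar_mx (is_derive_comp1 dF dcos Hf)).
apply: (is_derive_eq H); rewrite !derive1E !derive_val /circle (@scale_row_mx _ 1 1 1).
by congr (row_mx _ _); rewrite scale_scalar_mx; congr (_%:M); ring.
Qed.

(** A joint induction, since each function is up to sign the derivative of the other. *)
Lemma smooth_cos_sin k : Ck k setT (@cos R) /\ Ck k setT (@sin R).
Proof.
have oT : open [set: R] := openT.
have dc (t : R) : derivable (@cos R) t 1 by exact: derivable_cos.
have ds (t : R) : derivable (@sin R) t 1 by exact: derivable_sin.
have dE (f : R -> R) (t v : R) : derivable f t 1 -> 'D_v f t = v * 'D_1 f t.
  move=> /derivable1_diffP df; rewrite !deriveE // -[in LHS](mulr1 v) [LHS]linearZ //.
elim: k => [|k [kc ks]].
  by split; apply/CkP; split=> // t _; apply/derivable1_diffP.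
split; apply/CkP; (split=> [t _|v]; first by apply/derivable1_diffP).
  apply: (eq_Ck oT _ (CkM oT (Ck_cst (- v)) ks)) => t _.
  by rewrite dE // derive_val mulrN mulNr.
apply: (eq_Ck oT _ (CkM oT (Ck_cst v) kc)) => t _.
by rewrite dE // derive_val.
Qed.

End Circle.

(** * The rotational immersion *)

(* Coordinate indices 0, 1, 2 <= i < d + 2 and d + 2 <= i belong to t, u, the
   sphere and the flat factor. *)
Definition index_class (d i : nat) : nat :=
  if (i < 2)%N then i else if (i < 2 + d)%N then 2 else 3.

Definition class_gam (R : realType) (a b : R) (p : nat) : R :=
  match p with 1 => a | 2 => b | _ => 1 end.

(** Values for an index paired with itself are dummies: the classes 0 and 1 contain one coordinate
    each and get 0, while a sphere index gets [c], which [sum_kap] subtracts again. *)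
Definition class_kappa (R : realType) (a b c : R) (p q : nat) : R :=
  match p, q with
  | 0, 1 | 1, 0 => a
  | 0, 2 | 2, 0 | 1, 2 | 2, 1 => b
  | 2, 2 => c
  | _, _ => 0
  end.

Section Rotation.
Context {R : realType} {d : nat} (s : bool).
Variables (k : R) (phi eta : R -> R) (I : set R).
Hypotheses (oI : open I) (k0 : k != 0).
Hypotheses (sphi : smooth_on I phi) (seta : smooth_on I eta).
Local Notation f0 := phi.
Local Notation f1 := (phi^`())%classic.
Local Notation f2 := (f1^`())%classic.
Local Notation f3 := (f2^`())%classic.
Local Notation e1 := (eta^`())%classic.
Local Notation e2 := (e1^`())%classic.
Hypothesis phi_gt0 : forall t, I t -> 0 < f0 t.
Hypothesis phi1_neq0 : forall t, I t -> f1 t != 0.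
Hypothesis unit_speed : forall t, I t ->
  (k * f2 t) ^+ 2 + f1 t ^+ 2 + e1 t ^+ 2 = 1.

Let V := 'rV[R]_(2 + d).
Implicit Types (x v w z : V).

Let tc x : R := (lsubmx x) 0 0.
Let uc x : R := (lsubmx x) 0 1.
Let yc x : 'rV[R]_d := rsubmx x.
Let om x := inv_stereo s (yc x).
Let om1 x (w : 'rV[R]_d) := inv_stereo1 s (yc x) w.
Let lam x := conformal_factor (yc x).

Definition rot x : 'rV[R]_(2 + (d + 1) + 1) :=
  row_mx (row_mx ((k * f1 (tc x)) *: circle (uc x / k)) (f0 (tc x) *: om x))
    (eta (tc x))%:M.

Definition rot1 v x : 'rV[R]_(2 + (d + 1) + 1) :=
  row_mx (row_mx
    ((k * f2 (tc x) * tc v) *: circle (uc x / k)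
       + (f1 (tc x) * uc v) *: circle_normal (uc x / k))
    ((f1 (tc x) * tc v) *: om x + f0 (tc x) *: om1 x (yc v)))
  (e1 (tc x) * tc v)%:M.

Let df1 t : I t -> derivable f1 t 1.
Proof. by apply: smooth_derivable; exact: smooth_derive1. Qed.
Let df2 t : I t -> derivable f2 t 1.
Proof. by apply: smooth_derivable; apply: smooth_derive1 => //; exact: smooth_derive1. Qed.
Let de1 t : I t -> derivable e1 t 1.
Proof. by apply: smooth_derivable; exact: smooth_derive1. Qed.

Let is_derive_tc x v : is_derive x v tc (tc v).
Proof.
rewrite /tc mxE (_ : (fun x : V => _) = fun x : V => x 0 (lshift d 0)).
  by apply: is_derive_coord; exact: is_derive_id.
by apply/funext => z; rewrite mxE.
Qed.

Let is_derive_uc x v : is_derive x v uc (uc v).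
Proof.
rewrite /uc mxE (_ : (fun x : V => _) = fun x : V => x 0 (lshift d 1)).
  by apply: is_derive_coord; exact: is_derive_id.
by apply/funext => z; rewrite mxE.
Qed.

Let diff_tc x : differentiable tc x.
Proof. exact: differentiable_comp (differentiable_lsubmx _) (differentiable_coord _ _ _). Qed.

Let diff_uck x : differentiable (fun x => uc x / k) x.
Proof.
apply: differentiableM => //.
exact: differentiable_comp (differentiable_lsubmx _) (differentiable_coord _ _ _).
Qed.

Let is_derive_uck x v : is_derive x v (fun x => uc x / k) (uc v / k).
Proof.
apply: (is_derive_eq (is_derive_mulr (is_derive_uc x v) (is_derive_const (k^-1) x v))).
by rewrite mulr0 addr0.
Qed.

Let is_derive_yc x v : is_derive x v yc (yc v).
Proof.
apply: is_derive_mx => i j; rewrite /yc mxE.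
rewrite (_ : (fun x : V => _) = fun x : V => x i (rshift 2 j)).
  by apply: is_derive_coord; exact: is_derive_id.
by apply/funext => z; rewrite mxE.
Qed.

Let is_derive_tcomp (f : R -> R) x v : derivable f (tc x) 1 ->
  is_derive x v (fun x => f (tc x)) ((f^`())%classic (tc x) * tc v).
Proof. by move=> df; apply: is_derive_comp1 => //; exact: diff_tc. Qed.

Let diff_yc x : differentiable yc x.
Proof. exact: differentiable_rsubmx. Qed.

Let diff_inv_stereo y : differentiable (@inv_stereo R d s) y.
Proof. exact: (@smooth_inv_stereo R d s [::] y). Qed.

Let smooth_inv_stereo1 (w : 'rV[R]_d) : smooth_on setT (fun y => inv_stereo1 s y w).
Proof.
have oT : open [set: 'rV[R]_d] := openT.
apply/smooth_onE => j.
have := (smooth_onE _ _).1 (@smooth_inv_stereo R d s) j.+1.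
move=> /(Ck_derive w); apply: (eq_Ck oT) => y _.
by have [_ ->] := is_derive_inv_stereo s y w.
Qed.

Let is_derive_om x v : is_derive x v om (om1 x (yc v)).
Proof.
apply: (is_derive_comp (diff_yc x) (diff_inv_stereo _) (is_derive_yc x v)).
exact: is_derive_inv_stereo.
Qed.

Let is_derive_om1 (w : 'rV[R]_d) x v : is_derive x v (om1^~ w)
  (- (lam x * dot (yc x) (yc v)) *: om1 x w - (lam x * dot (yc x) w) *: om1 x (yc v)
   + (lam x * dot w (yc v)) *: om1 x (yc x) - (lam x ^+ 2 * dot w (yc v)) *: om x).
Proof.
apply: (is_derive_comp (g := fun y => inv_stereo1 s y w) (diff_yc x) _ (is_derive_yc x v)).
  exact: (@smooth_inv_stereo1 w [::]).
exact: is_derive_inv_stereo1.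
Qed.

Lemma is_derive_rot x v : I (tc x) -> is_derive x v rot (rot1 v x).
Proof.
move=> It.
have H1 := is_derive_scale (is_derive_mulr (is_derive_const (k : R) x v) (is_derive_tcomp v (df1 It)))
  (is_derive_circle (diff_uck x) (is_derive_uck x v)).
have H2 := is_derive_scale (is_derive_tcomp v (smooth_derivable sphi It)) (is_derive_om x v).
have H3 := is_derive_scalar_mx (is_derive_tcomp v (smooth_derivable seta It)).
apply: (is_derive_eq (is_derive_row_mx (is_derive_row_mx H1 H2) H3)).
rewrite /rot1; congr (row_mx (row_mx _ _) _).
rewrite scalerA mul0r add0r; congr (_ *: _ + _ *: _); first by rewrite mulrA.
by field.
Qed.

(** Coordinates in an orthonormal triple: the radial direction of the circle, that of the sphere,
    and the axis. The tangent of the profile curve is (k phi'', phi', eta') in this triple, and the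
    u and sphere directions are orthogonal to it, so the normal vectors can be sought here. *)
Definition frame p q r x : 'rV[R]_(2 + (d + 1) + 1) :=
  row_mx (row_mx (p *: circle (uc x / k)) (q *: om x)) r%:M.

(* The normal curvature vectors of the t, u and sphere directions; [coeff z v x]
   are the coordinates of the tangential part of the second derivative. *)
Let Nt x := frame (k * f3 (tc x)) (f2 (tc x)) (e2 (tc x)) x.
Let Nu x := frame (- f1 (tc x) / k + k * f1 (tc x) * f2 (tc x) ^+ 2)
  (f1 (tc x) ^+ 2 * f2 (tc x)) (f1 (tc x) * f2 (tc x) * e1 (tc x)) x.
Let Ny x := frame (lam x ^+ 2 * f0 (tc x) * f1 (tc x) * (k * f2 (tc x)))
  (lam x ^+ 2 * f0 (tc x) * (f1 (tc x) ^+ 2 - 1))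
  (lam x ^+ 2 * f0 (tc x) * f1 (tc x) * e1 (tc x)) x.

Let coeff z v x : V :=
  row_mx (row_mx
    (- (f1 (tc x) * f2 (tc x) * (uc v * uc z))
     - f0 (tc x) * f1 (tc x) * lam x ^+ 2 * dot (yc v) (yc z))%:M
    (f2 (tc x) / f1 (tc x) * (tc v * uc z + tc z * uc v))%:M : 'rV[R]_2)
  ((f1 (tc x) / f0 (tc x)) *: (tc v *: yc z + tc z *: yc v)
    - (lam x * dot (yc x) (yc z)) *: yc v - (lam x * dot (yc x) (yc v)) *: yc z
    + (lam x * dot (yc v) (yc z)) *: yc x).

Let tc_row (a b : R) (y : 'rV[R]_d) : tc (row_mx (row_mx a%:M b%:M : 'rV[R]_2) y) = a.
Proof.
rewrite /tc row_mxKl mxE; case: fintype.splitP => j //= _.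
by rewrite !ord1 mxE.
Qed.

Let uc_row (a b : R) (y : 'rV[R]_d) : uc (row_mx (row_mx a%:M b%:M : 'rV[R]_2) y) = b.
Proof.
rewrite /uc row_mxKl mxE; case: fintype.splitP => j /=; first by rewrite (ord1 j).
by move=> _; rewrite !ord1 mxE.
Qed.

Let om1_coeff z v x : om1 x (yc (coeff z v x)) =
  (f1 (tc x) / f0 (tc x)) *: (tc v *: om1 x (yc z) + tc z *: om1 x (yc v))
    - (lam x * dot (yc x) (yc z)) *: om1 x (yc v) - (lam x * dot (yc x) (yc v)) *: om1 x (yc z)
    + (lam x * dot (yc v) (yc z)) *: om1 x (yc x).
Proof.
rewrite /om1 [yc (coeff _ _ _)]row_mxKr.
by rewrite !inv_stereo1D -!scaleNr !inv_stereo1Z inv_stereo1D !inv_stereo1Z.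
Qed.

(** The Gauss formula of the rotation. The plain second derivatives in u and in the sphere have
    radial parts - phi' / k and - lam^2 phi; removing their components along the profile tangent (k
    phi'', phi', eta') gives [Nu] and [Ny]. The normal part contains no mixed products, which makes
    the coordinate directions principal. *)
Lemma is_derive_rot1 x v z : I (tc x) -> is_derive x z (rot1 v)
  (rot1 (coeff z v x) x + (tc v * tc z) *: Nt x + (uc v * uc z) *: Nu x
     + dot (yc v) (yc z) *: Ny x).
Proof.
move=> It.
have H1 := is_derive_scale (is_derive_mulr (is_derive_mulr (is_derive_const (k : R) x z)
    (is_derive_tcomp z (df2 It))) (is_derive_const (tc v) x z))
  (is_derive_circle (diff_uck x) (is_derive_uck x z)).
have H1' := is_derive_scale (is_derive_mulr (is_derive_tcomp z (df1 It))
    (is_derive_const (uc v) x z))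
  (is_derive_circle_normal (diff_uck x) (is_derive_uck x z)).
have H2 := is_derive_scale (is_derive_mulr (is_derive_tcomp z (df1 It))
  (is_derive_const (tc v) x z)) (is_derive_om x z).
have H2' := is_derive_scale (is_derive_tcomp z (smooth_derivable sphi It)) (is_derive_om1 (yc v) x z).
have H3 := is_derive_scalar_mx (is_derive_mulr (is_derive_tcomp z (de1 It)) (is_derive_const (tc v) x z)).
apply: (is_derive_eq (is_derive_row_mx (is_derive_row_mx
  (is_derive_addr H1 H1') (is_derive_addr H2 H2')) H3)).
have f10 := phi1_neq0 It; have f00 := lt0r_neq0 (phi_gt0 It).
rewrite /rot1 /Nt /Nu /Ny /frame om1_coeff ![tc (coeff _ _ _)]tc_row [uc (coeff _ _ _)]uc_row.
move: f10 f00.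
move: (om1 x (yc x)) (om1 x (yc v)) (om1 x (yc z)) (om x) => a b c o.
move: (dot (yc v) (yc z)) (dot (yc x) (yc v)) (dot (yc x) (yc z)) (lam x) => D1 D2 D3 la.
move: (circle _) (circle_normal _) => p q.
move: (f3 (tc x)) (f2 (tc x)) (f1 (tc x)) (f0 (tc x)) (e2 (tc x)) (e1 (tc x)).
move: (tc v) (tc z) (uc v) (uc z) => tv tz uv uz F3 F2 F1 F0 E2 E1 f10 f00.
rewrite !scale_row_mx !add_row_mx.
congr (row_mx (row_mx _ _) _).
- by apply/rowP => i; rewrite !mxE; field; rewrite k0 f10.
- by apply/rowP => i; rewrite !mxE; field; rewrite f00.
by apply/rowP => i; rewrite !mxE !ord1 /= !mulr1n; ring.
Qed.

Lemma dot_frame p q r p' q' r' x :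
  dot (frame p q r x) (frame p' q' r' x) = p * p' + q * q' + r * r'.
Proof.
rewrite !dot_row_mx dot_scalar_mx !dotZl !dotZr dot_circle dot_inv_stereo.
by ring.
Qed.

Lemma dot_frame_rot1 p q r v x : dot (frame p q r x) (rot1 v x) =
  tc v * (p * (k * f2 (tc x)) + q * f1 (tc x) + r * e1 (tc x)).
Proof.
rewrite !dot_row_mx dot_scalar_mx !dotZl !dotDr !dotZr dot_circle dot_inv_stereo.
rewrite dot_circle_circle_normal dot_inv_stereo1.
by ring.
Qed.

Lemma dot_rot1 v z x : I (tc x) -> dot (rot1 v x) (rot1 z x) =
  tc v * tc z + f1 (tc x) ^+ 2 * (uc v * uc z)
  + (f0 (tc x) * lam x) ^+ 2 * dot (yc v) (yc z).
Proof.
move=> It; rewrite !dot_row_mx dot_scalar_mx !dotDl !dotDr !dotZl !dotZr.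
rewrite [dot (circle_normal _) (circle _)]dotC [dot (om1 _ _) (om _)]dotC.
rewrite dot_circle dot_circle_normal dot_circle_circle_normal.
rewrite dot_inv_stereo !dot_inv_stereo1 dot_inv_stereo11 -/(lam x).
rewrite -[tc v * tc z in RHS]mulr1 -[X in _ = tc v * tc z * X + _ + _](unit_speed It).
by ring.
Qed.

(** Half the derivative of [unit_speed]: the acceleration [Nt] of the profile curve is orthogonal to
    its tangent. *)
Lemma unit_speed1 t : I t -> k ^+ 2 * f2 t * f3 t + f1 t * f2 t + e1 t * e2 t = 0.
Proof.
move=> It.
have D (f : R -> R) : derivable f t 1 -> is_derive t (1 : R) f ((f^`())%classic t).
  by move=> df; rewrite derive1E; exact: derivableP.
have dk := is_derive_mulr (is_derive_const (k : R) t (1 : R)) (D _ (df2 It)).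
have df1' := D _ (df1 It); have de1' := D _ (de1 It).
have H := is_derive_addr (is_derive_addr (is_derive_mulr dk dk)
   (is_derive_mulr df1' df1')) (is_derive_mulr de1' de1').
have [_ E] := H.
have : 'D_(1 : R) (fun y => k * f2 y * (k * f2 y) + f1 y * f1 y + e1 y * e1 y) t = 0.
  rewrite -(derive_cst (1 : R) t (1 : R)); apply: near_eq_derive.
  by apply: (near_open oI It) => u Iu; rewrite -!expr2 unit_speed.
rewrite E => E0; apply: (@mulIf _ 2); first by rewrite pnatr_eq0.
rewrite mul0r -[RHS]E0.
by move: (e2 t) (e1 t) (f3 t) (f2 t) (f1 t) => a b c a' b'; ring.
Qed.

Lemma smooth_rot D : open D -> (forall x, D x -> I (tc x)) -> smooth_on D rot.
Proof.
move=> oD DI; apply/smooth_onE => j.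
have kid : Ck j D (@idfun V) by apply: linear_Ck => x.
have kx i : Ck j D (fun x : V => x 0 i) by have /(Ck_mxP _ _ oD) := kid; exact.
have Ckt : Ck j D tc by apply: (eq_Ck oD _ (kx (lshift d 0))) => x _; rewrite /tc mxE.
have Cku : Ck j D (fun x => uc x / k).
  apply: CkM => //; last exact: Ck_cst.
  by apply: (eq_Ck oD _ (kx (lshift d 1))) => x _; rewrite /uc mxE.
have Cky : Ck j D yc.
  apply/(Ck_mxP _ _ oD) => i i'; rewrite ord1.
  by apply: (eq_Ck oD _ (kx (rshift 2 i'))) => x _; rewrite /yc mxE.
have Ckcomp (f : R -> R) : smooth_on I f -> Ck j D (fun x => f (tc x)).
  by move=> /smooth_onE sf; exact: (Ck_comp1 oD DI (sf j) Ckt).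
have [cosC sinC] := @smooth_cos_sin R j.
apply: Ck_row_mx => //; last by apply: Ck_scalar_mx => //; exact: Ckcomp.
apply: Ck_row_mx => //; apply: Ck_scale => //.
- apply: CkM => //; first exact: Ck_cst.
  by apply: Ckcomp; exact: smooth_derive1.
- apply: (@Ck_row_mx _ _ 1 1 1) => //; apply: Ck_scalar_mx => //.
    exact: (Ck_comp1 (A := setT) oD _ cosC Cku).
  exact: (Ck_comp1 (A := setT) oD _ sinC Cku).
- exact: Ckcomp.
apply: (@Ck_comp R V d 1 (d + 1) j D setT yc (inv_stereo s) oD openT) => //.
by move: j {kid kx Cky Ckt Cku Ckcomp cosC sinC}; apply/smooth_onE/smooth_inv_stereo.
Qed.

Let e (i : 'I_(2 + d)) : V := delta_mx 0 i.

Let tc_e i : tc (e i) = (i == 0 :> nat)%:R.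
Proof. by rewrite /tc /e !mxE eqxx -val_eqE /= eq_sym. Qed.

Let uc_e i : uc (e i) = (i == 1 :> nat)%:R.
Proof. by rewrite /uc /e !mxE eqxx -val_eqE /= eq_sym. Qed.

Let dot_e i j : dot (yc (e i)) (yc (e j)) = ((i == j) && (2 <= i)%N)%:R.
Proof.
rewrite dotE; case: (fintype.split_ordP i) => a ->.
  rewrite big1 => [|c _]; first by rewrite leqNgt (ltn_ord a) andbF.
  by rewrite /yc /e !mxE eq_rlshift andbF mul0r.
rewrite (bigD1 a) //= big1 => [|c ca]; last first.
  by rewrite /yc /e !mxE eq_rshift (negPf ca) andbF mul0r.
by rewrite /yc /e !mxE !eqxx addr0 /= mul1r andbT.
Qed.

Let gam (x : V) (i : nat) :=
  class_gam (f1 (tc x) ^+ 2) ((f0 (tc x) * lam x) ^+ 2) (index_class d i).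

Lemma gam_gt0 x i : I (tc x) -> 0 < gam x i.
Proof.
move=> It; rewrite /gam; case: (index_class d i) => [|[|[|c]]] //=.
  by rewrite lt_def sqr_ge0 sqrf_eq0 phi1_neq0.
by rewrite exprn_gt0 // mulr_gt0 ?phi_gt0 // conformal_factor_gt0.
Qed.

Lemma open_rot_domain : open [set x : V | I ((lsubmx x) 0 0)].
Proof.
apply: (@open_comp V R tc I) => // x _.
exact/differentiable_continuous/diff_tc.
Qed.

Lemma induced_metric_rot x : I (tc x) ->
  induced_metric rot x = diag_mx (\row_i gam x i).
Proof.
move=> It; have dr : differentiable rot x.
  exact: (smooth_rot open_rot_domain (fun _ => id) [::]).
apply/matrixP => i j; rewrite induced_metricE //.
have [_ ->] := is_derive_rot (e i) It; have [_ ->] := is_derive_rot (e j) It.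
rewrite (dot_rot1 _ _ It) !tc_e !uc_e dot_e !mxE.
have [<-|ij] := eqVneq i j.
  rewrite mulr1n /= /gam /index_class; case: i => -[|[|i]] hi //=; last by rewrite hi /=; ring.
    by ring.
  by ring.
have {}ij : (i == j :> nat) = false by rewrite val_eqE (negPf ij).
rewrite /= mulr0 addr0 mulr0n.
by case: (i : nat) (j : nat) ij => [|[|p]] [|[|q]] //= _; ring.
Qed.

(** The curvatures are those of the warped product: - phi''' / phi', - phi'' / phi and (1 - phi'^2)
    / phi^2. Each inner product of normal vectors is rearranged so that eta enters only through the
    left-hand side of [unit_speed] or [unit_speed1], which removes eta from the result. *)
Lemma principal_rot x D : open D -> (forall x, D x -> I (tc x)) -> D x ->
  principal_at rot (fun i => gam x i)
   (fun i j => class_kappa (- f3 (tc x) / f1 (tc x)) (- f2 (tc x) / f0 (tc x))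
     ((1 - f1 (tc x) ^+ 2) / f0 (tc x) ^+ 2) (index_class d i) (index_class d j)) x.
Proof.
move=> oD DI Dx; have It := DI x Dx.
pose nu (i : 'I_(2 + d)) := match (i : nat) with 0 => Nt x | 1 => Nu x | _ => Ny x end.
have f10 := phi1_neq0 It; have f00 := lt0r_neq0 (phi_gt0 It).
have Drot v y : D y -> 'D_v rot y = rot1 v y.
  by move=> Dy; have [_ ->] := is_derive_rot v (DI y Dy).
exists nu; split.
- move=> i j; exists (coeff (e i) (e j) x).
  transitivity ('D_(e i) (rot1 (e j)) x).
    by apply: near_eq_derive; apply: (near_open oD Dx) => y; exact: Drot.
  have [_ ->] := is_derive_rot1 (e j) (e i) It.
  rewrite (Drot _ _ Dx) -!addrA; congr (_ + _).
  rewrite !tc_e !uc_e dot_e eq_sym.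
  have [<-|ij] := eqVneq i j.
    rewrite scale1r /nu; case: i => -[|[|i]] hi /=;
      rewrite ?(mulr1, mulr0, mul0r) !(scale0r, scale1r) ?addr0 ?add0r //.
  have {}ij : (i == j :> nat) = false by rewrite val_eqE (negPf ij).
  rewrite scale0r /= scale0r addr0.
  case: (i : nat) (j : nat) ij => [|[|p]] [|[|q]] //= _;
    by rewrite ?(mulr0, mul0r) !scale0r addr0.
- move=> i v; rewrite (Drot _ _ Dx) /nu.
  have U1 := unit_speed1 It; have U := unit_speed It.
  move: U1 U; case: (i : nat) => [|[|p]]; rewrite /Nt /Nu /Ny dot_frame_rot1.
  + move=> U1 _; rewrite -[RHS](mulr0 (tc v)) -[in RHS]U1; congr (_ * _).
    by move: (f3 _) (f2 _) (f1 _) (e1 _) (e2 _) => a b c a' b'; ring.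
  + move=> _; move: (f2 _) (f1 _) (e1 _) => a b c U.
    transitivity (tc v * (b * a * ((k * a) ^+ 2 + b ^+ 2 + c ^+ 2 - 1))); first by field.
    by rewrite U subrr !mulr0.
  move=> _; move: (f2 _) (f1 _) (e1 _) (f0 _) (lam x) => a b c f la U.
  transitivity (tc v * (la ^+ 2 * f * b * ((k * a) ^+ 2 + b ^+ 2 + c ^+ 2 - 1))); first by ring.
  by rewrite U subrr !mulr0.
move=> i j ij; have {}ij : (i == j :> nat) = false by rewrite val_eqE (negPf ij).
have U1 := unit_speed1 It; have U := unit_speed It.
have pE (p : 'I_(2 + d)) r : p = r.+2 :> nat -> index_class d r.+2 = 2.
  by move=> pr; rewrite /index_class -pr ltn_ord; case: ifP => //; rewrite pr.
rewrite /nu /gam; move: U1 U; rewrite /Nt /Nu /Ny.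
case Ei : (i : nat) ij => [|[|p]]; case Ej : (j : nat) => [|[|q]] //= _;
  rewrite ?(pE _ _ Ei) ?(pE _ _ Ej) dot_frame /=;
  move: f10 f00; move: (f3 _) (f2 _) (f1 _) (f0 _) (e1 _) (e2 _) (lam x) => F3 F2 F1 F0 E1 E2 la f10 f00 U1 U.
- transitivity (- F1 * F3 + F1 * F2 * (k ^+ 2 * F2 * F3 + F1 * F2 + E1 * E2)).
    by field; rewrite k0.
  by rewrite U1; field.
- transitivity (la ^+ 2 * F0 * (- F2 + F1 * (k ^+ 2 * F2 * F3 + F1 * F2 + E1 * E2))); first by ring.
  by rewrite U1; field.
- transitivity (- F1 * F3 + F1 * F2 * (k ^+ 2 * F2 * F3 + F1 * F2 + E1 * E2)).
    by field; rewrite k0.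
  by rewrite U1; field.
- transitivity (la ^+ 2 * F0 * F1 ^+ 2 * F2 * ((k * F2) ^+ 2 + F1 ^+ 2 + E1 ^+ 2 - 2)).
    by field; rewrite k0.
  by rewrite U; field.
- transitivity (la ^+ 2 * F0 * (- F2 + F1 * (k ^+ 2 * F2 * F3 + F1 * F2 + E1 * E2))); first by ring.
  by rewrite U1; field.
- transitivity (la ^+ 2 * F0 * F1 ^+ 2 * F2 * ((k * F2) ^+ 2 + F1 ^+ 2 + E1 ^+ 2 - 2)).
    by field; rewrite k0.
  by rewrite U; field.
transitivity (la ^+ 4 * F0 ^+ 2 * (F1 ^+ 2 * ((k * F2) ^+ 2 + F1 ^+ 2 + E1 ^+ 2) - 2 * F1 ^+ 2 + 1)).
  by ring.
by rewrite U; field.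
Qed.

End Rotation.

(** * Product of an immersion with the identity of flat space *)

Section ProductEuclidean.
Context {R : realType} {m N l : nat}.
Variables (F : 'rV[R]_m -> 'rV[R]_N) (D : set 'rV[R]_m).
Hypotheses (oD : open D) (sF : smooth_on D F).
Implicit Types x v w : 'rV[R]_(m + l).

Definition product_immersion x : 'rV[R]_(N + l) := row_mx (F (lsubmx x)) (rsubmx x).
Let DM : set 'rV[R]_(m + l) := [set x | D (lsubmx x)].

Lemma open_lsubmx_preimage : open DM.
Proof. by apply: open_comp oD => x _; exact: continuous_lsubmx. Qed.

Let is_derive_lsubmx x v : is_derive x v (lsubmx : 'rV[R]_(m + l) -> 'rV[R]_m) (lsubmx v).
Proof.
apply: is_derive_mx => i j; rewrite mxE.
rewrite (_ : (fun x => _) = fun x : 'rV[R]_(m + l) => x i (lshift l j)).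
  by apply: is_derive_coord; exact: is_derive_id.
by apply/funext => z; rewrite mxE.
Qed.

Let is_derive_rsubmx x v : is_derive x v (rsubmx : 'rV[R]_(m + l) -> 'rV[R]_l) (rsubmx v).
Proof.
apply: is_derive_mx => i j; rewrite mxE.
rewrite (_ : (fun x => _) = fun x : 'rV[R]_(m + l) => x i (rshift m j)).
  by apply: is_derive_coord; exact: is_derive_id.
by apply/funext => z; rewrite mxE.
Qed.

Lemma is_derive_product_immersion x v : DM x -> is_derive x v product_immersion
  (row_mx ('D_(lsubmx v) F (lsubmx x)) (rsubmx v)).
Proof.
move=> Dx; have dF : differentiable F (lsubmx x) := sF [::] Dx.
apply: is_derive_row_mx; last exact: is_derive_rsubmx.
apply: (is_derive_comp (differentiable_lsubmx x) dF (is_derive_lsubmx x v)).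
by apply: derivableP; exact: diff_derivable.
Qed.

Lemma smooth_product_immersion : smooth_on DM product_immersion.
Proof.
have oDM := open_lsubmx_preimage.
apply/smooth_onE => j.
have kid : Ck j DM (@idfun 'rV[R]_(m + l)) by apply: linear_Ck => x.
have kx i : Ck j DM (fun x => x 0 i) by have /(Ck_mxP _ _ oDM) := kid; exact.
apply: Ck_row_mx => //.
  apply: (@Ck_comp R _ m 1 N j DM D lsubmx F oDM oD) => //; first by move: j {kid kx}; apply/smooth_onE.
  apply/(Ck_mxP _ _ oDM) => i i'; rewrite ord1.
  by apply: (eq_Ck oDM _ (kx (lshift l i'))) => x _; rewrite mxE.
apply/(Ck_mxP _ _ oDM) => i i'; rewrite ord1.
by apply: (eq_Ck oDM _ (kx (rshift m i'))) => x _; rewrite mxE.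
Qed.

Lemma lsubmx_delta (i : 'I_m) : lsubmx (delta_mx 0 (lshift l i) : 'rV[R]_(m + l)) = delta_mx 0 i.
Proof. by apply/rowP => j; rewrite !mxE eq_lshift. Qed.

Lemma lsubmx_delta0 (i : 'I_l) : lsubmx (delta_mx 0 (rshift m i) : 'rV[R]_(m + l)) = 0.
Proof. by apply/rowP => j; rewrite !mxE eq_lrshift. Qed.

Lemma rsubmx_delta (i : 'I_l) : rsubmx (delta_mx 0 (rshift m i) : 'rV[R]_(m + l)) = delta_mx 0 i.
Proof. by apply/rowP => j; rewrite !mxE eq_rshift. Qed.

Lemma rsubmx_delta0 (i : 'I_m) : rsubmx (delta_mx 0 (lshift l i) : 'rV[R]_(m + l)) = 0.
Proof. by apply/rowP => j; rewrite !mxE eq_rlshift. Qed.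

Lemma induced_metric_product x : DM x -> induced_metric product_immersion x =
  block_mx (induced_metric F (lsubmx x)) 0 0 1%:M.
Proof.
move=> Dx; have dP : differentiable product_immersion x by exact: (smooth_product_immersion [::]).
have dF : differentiable F (lsubmx x) := sF [::] Dx.
apply/matrixP => i j; rewrite induced_metricE //.
have [_ ->] := is_derive_product_immersion (delta_mx 0 i) Dx.
have [_ ->] := is_derive_product_immersion (delta_mx 0 j) Dx.
rewrite dot_row_mx.
case: (fintype.split_ordP i) => a ->; case: (fintype.split_ordP j) => b ->;
  rewrite ?(lsubmx_delta, lsubmx_delta0, rsubmx_delta, rsubmx_delta0) ?derive0
    ?dot0r ?dot0l ?addr0 ?add0r ?(block_mxEul, block_mxEur, block_mxEdl, block_mxEdr).
- by rewrite induced_metricE.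
- by rewrite mxE.
- by rewrite mxE.
by rewrite dot_deltal !mxE eq_sym.
Qed.

(** The product map is affine in the flat coordinates, so those directions get the zero normal
    vector and zero curvature; the other normal vectors are padded with zeros. *)
Lemma principal_product gam kappa gam' kappa' x : DM x ->
  principal_at F gam kappa (lsubmx x) ->
  (forall i, gam' (lshift l i) = gam i) ->
  (forall i j, kappa' (lshift l i) (lshift l j) = kappa i j) ->
  (forall i j, kappa' i (rshift m j) = 0) ->
  (forall i j, kappa' (rshift m i) j = 0) ->
  principal_at product_immersion gam' kappa' x.
Proof.
move=> Dx [nu [Fij nu_n nunu]] gamE kapE kap0 kap0'.
have oDM := open_lsubmx_preimage.
have kF : Ck 1 D F := (smooth_onE _ _).1 sF 1%N.
have DP v y : DM y -> 'D_v product_immersion y = row_mx ('D_(lsubmx v) F (lsubmx y)) (rsubmx v).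
  by move=> Dy; have [_ ->] := is_derive_product_immersion v Dy.
have DDP v w : 'D_w ('D_v product_immersion) x =
    row_mx ('D_(lsubmx w) ('D_(lsubmx v) F) (lsubmx x)) 0.
  have dDF : differentiable ('D_(lsubmx v) F) (lsubmx x) := Ck_differentiable (Ck_derive _ kF) Dx.
  have H := is_derive_row_mx (is_derive_comp (differentiable_lsubmx x) dDF
    (is_derive_lsubmx x w) (derivableP (diff_derivable dDF))) (is_derive_const (rsubmx v) x w).
  have [_ <-] := H; apply: near_eq_derive; apply: (near_open oDM Dx) => y Dy.
  exact: DP.
pose nu' (i : 'I_(m + l)) : 'rV[R]_(N + l) :=
  match fintype.split i with inl a => row_mx (nu a) 0 | inr _ => 0 end.
have nul a : nu' (lshift l a) = row_mx (nu a) 0.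
  by rewrite /nu' (unsplitK (inl a)).
have nur a : nu' (rshift m a) = 0 by rewrite /nu' (unsplitK (inr a)).
exists nu'; split.
- move=> i j; rewrite DDP.
  case: (fintype.split_ordP i) => a ->; case: (fintype.split_ordP j) => b ->;
  rewrite ?(lsubmx_delta, lsubmx_delta0) ?derive0.
  + have [w Fw] := Fij a b; exists (row_mx w 0); rewrite DP // row_mxKl row_mxKr Fw nul eq_lshift.
    by rewrite scale_row_mx add_row_mx scaler0 addr0.
  + exists 0; rewrite eq_lrshift scale0r addr0 derive0.
    have -> : 'D_(delta_mx 0 a) ('D_0 F) (lsubmx x) = 0.
      rewrite (_ : 'D_0 F = cst 0) ?derive_cst //; by apply/funext => y; rewrite derive0.
    by rewrite row_mx0.
  + by exists 0; rewrite eq_rlshift scale0r addr0 derive0 row_mx0.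
  by exists 0; rewrite nur scaler0 addr0 derive0 row_mx0.
- move=> i v; rewrite DP //.
  case: (fintype.split_ordP i) => a ->; rewrite ?nul ?nur ?dot0l //.
  by rewrite dot_row_mx nu_n dot0l addr0.
move=> i j.
case: (fintype.split_ordP i) => a ->; case: (fintype.split_ordP j) => b ->;
  rewrite ?nul ?nur ?dot0l ?dot0r ?kap0 ?kap0' ?mul0r //.
by rewrite eq_lshift => ab; rewrite dot_row_mx dot0l addr0 nunu // kapE !gamE.
Qed.

End ProductEuclidean.

(** * Atlases *)

Section Atlas.
Context {R : realType} {m : nat} (M : riem_atlas R m).
Hypothesis sM : smooth_manifold M.

Let dom_points (a : chart M) x : chart_dom a x -> points M (chart_param a x).
Proof. by move=> ax; have [_ _ <- _] := sM; exists a => //; exists x. Qed.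

Lemma coord_preim_points (a : chart M) : coord_preim a (points M) = chart_dom a.
Proof. by apply/seteqP; split=> [x []//|x ax]; split=> //; exact: dom_points. Qed.

Lemma open_in_points : open_in (points M).
Proof. by split=> // a; rewrite coord_preim_points; have [+ _ _ _] := sM; exact. Qed.

(** Disjoint neighbourhoods in T pull back along the injective f, and continuity in every chart
    makes the preimages open for the topology of the atlas. *)
Lemma hausdorff_atlas (T : topologicalType) (f : carrier M -> T) :
  hausdorff_space T -> {in points M &, injective f} ->
  (forall a : chart M, continuous (f \o chart_param a)) -> hausdorff_manifold M.
Proof.
move=> hT fi fc p q Mp Mq pq; have [op _ _ _] := sM.
have fpq : f p != f q by apply/eqP => fpq; apply: pq; apply: fi; rewrite ?inE.
move: hT; rewrite open_hausdorff => /(_ _ _ fpq)[[A B] /= [Ap Bq] [oA oB /eqP AB]].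
exists (points M `&` f @^-1` A), (points M `&` f @^-1` B); split.
- split=> [x []//|a].
  rewrite (_ : coord_preim _ _ = chart_dom a `&` (f \o chart_param a) @^-1` A).
    by apply: openI => //; apply: open_comp => // x _; exact: fc.
  by apply/seteqP; split=> x; [move=> [? []]|move=> [ax Ax]; split=> //; split=> //; exact: dom_points].
- split=> [x []//|a].
  rewrite (_ : coord_preim _ _ = chart_dom a `&` (f \o chart_param a) @^-1` B).
    by apply: openI => //; apply: open_comp => // x _; exact: fc.
  by apply/seteqP; split=> x; [move=> [? []]|move=> [ax Ax]; split=> //; split=> //; exact: dom_points].
- by split=> //; rewrite inE in Ap.
- by split=> //; rewrite inE in Bq.
apply/seteqP; split=> // x [[_ Ax] [_ Bx]].
by have : (A `&` B) (f x) by []; rewrite AB.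
Qed.

(** Read in another chart, the image of W is the preimage of W under the transition map, which is
    continuous on the open overlap. *)
Lemma open_in_image (a : chart M) (W : set 'rV[R]_m) : open W -> W `<=` chart_dom a ->
  open_in (chart_param a @` W).
Proof.
move=> oW Wa; have [op inj cov trans] := sM.
split=> [_ [x Wx <-]|b]; first by apply: dom_points; exact: Wa.
have [oab [tau stau tauP]] := trans b a.
have ctau x : overlap b a x -> {for x, continuous tau}.
  by move=> bx; apply: differentiable_continuous; exact: (stau [::]).
rewrite (_ : coord_preim _ _ = overlap b a `&` tau @^-1` W).
  rewrite openE => x [abx Wt]; apply: filterI; first exact: open_nbhs_nbhs.
  by apply: (ctau x abx); exact: open_nbhs_nbhs.
apply/seteqP; split=> x.
  move=> [bx [y Wy yx]]; have abx : overlap b a x by split=> //; exists y => //; exact: Wa.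
  split=> //; have [atx tx] := tauP x abx.
  rewrite /preimage /=; suff -> : tau x = y by [].
  by apply: (inj a); rewrite ?inE //; [exact: Wa|rewrite tx yx].
move=> [abx Wt]; have [bx _] := abx; have [_ tx] := tauP x abx.
by split=> //; exists (tau x).
Qed.

(** The basis consists of the chart images of balls with rational centre and radius 1 / (j + 1),
    over the enumerated charts. *)
Lemma second_countable_atlas (e : nat -> chart M) : (forall a, exists i, e i = a) ->
  second_countable_manifold M.
Proof.
move=> eP; have [op inj cov trans] := sM.
pose c (t : 'rV[rat]_m * nat) : set 'rV[R]_m :=
  ball (map_mx ratr t.1 : 'rV[R]_m) (t.2.+1%:R^-1).
have oc t : open (c t) by exact: ball_open.
(* A number that encodes no triple decodes to a default one and merely repeats a basis set. *)
pose dec k : nat * ('rV[rat]_m * nat) := odflt (0%N, (0, 0%N)) (unpickle k).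
exists (fun k => let t := dec k in
  chart_param (e t.1) @` (chart_dom (e t.1) `&` c t.2)); split.
  by move=> k; apply: open_in_image; [exact: openI|exact: subIsetl].
move=> U p [UM oU] Up; have := UM _ Up; rewrite -cov => -[a _ [x ax xp]].
have [i ia] := eP a.
have : nbhs x (coord_preim a U).
  by apply: open_nbhs_nbhs; split; [exact: oU|split=> //; rewrite /preimage /= xp].
move=> /nbhs_ballP[r /= r0 rU].
(* With radius below r / 2 and a rational centre within that radius of x, the ball contains x and
   stays inside the ball of radius r around x. *)
have [j] := @ltr_add_invr R 0 (r / 2) ltac:(by rewrite divr_gt0); rewrite add0r => rj.
have [q qx] : exists q : 'rV[rat]_m, ball x (j.+1%:R^-1) (map_mx ratr q : 'rV[R]_m).
  have j0 : 0 < j.+1%:R^-1 :> R by rewrite invr_gt0.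
  have [q qP] := choice (fun i => rat_in_itvoo (ltr_pwDr j0 (lexx (x 0 i)))).
  exists (\row_i q i); split=> // i' i0; rewrite !mxE ord1.
  have /itvP qi := qP i0.
  rewrite /ball /= distrC ger0_norm ?subr_ge0 ?ltW ?qi //.
  by rewrite ltrBlDl qi.
exists (pickle (i, (q, j))); rewrite /dec pickleK /= ia; split.
  by exists x => //; split=> //; apply: ball_sym.
move=> _ [y [ay cy] <-]; have /rU[//] : ball x r y.
rewrite [r]splitr; apply: ball_triangle.
  by apply: le_ball qx; exact: ltW.
by apply: le_ball cy; exact: ltW.
Qed.
End Atlas.

Lemma smooth_manifold_product (R : realType) m1 m2 (A : riem_atlas R m1) (B : riem_atlas R m2) :
  smooth_manifold A -> smooth_manifold B -> smooth_manifold (riem_product A B).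
Proof.
move=> [opA injA covA trA] [opB injB covB trB]; split.
- move=> [a b] /=; apply: openI.
    by apply: open_comp (opA a) => x _; exact: continuous_lsubmx.
  by apply: open_comp (opB b) => x _; exact: continuous_rsubmx.
- move=> [a b] x y; rewrite !inE /= => -[xa xb] [ya yb] [/injA E1 /injB E2].
  by rewrite -[x]hsubmxK -[y]hsubmxK E1 ?inE // E2 ?inE.
- apply/seteqP; split=> [[p q] [[a b] _ [x [/= xa xb] [<- <-]]]|[p q] /= [Ap Bq]].
    by split=> /=; [rewrite -covA; exists a|rewrite -covB; exists b]=> //; eexists; eauto.
  move: Ap Bq; rewrite -covA -covB => -[a _ [x ax <-]] [b _ [y yb <-]].
  by exists (a, b) => //; exists (row_mx x y); rewrite /= ?row_mxKl ?row_mxKr.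
move=> [a b] [a' b'].
have [oA [tA stA tAP]] := trA a a'; have [oB [tB stB tBP]] := trB b b'.
have ovE : @overlap _ _ (riem_product A B) (a, b) (a', b') =
   [set x | overlap a a' (lsubmx x) /\ overlap b b' (rsubmx x)].
  apply/seteqP; split=> x.
    move=> [[/= xa xb] [y [/= ya yb] [E1 E2]]].
    by split; split=> //; [exists (lsubmx y)|exists (rsubmx y)].
  move=> [[xa [y ya E1]] [xb [z zb E2]]]; split=> //=.
  by exists (row_mx y z); rewrite /= ?row_mxKl ?row_mxKr ?E1 ?E2.
have oov : open [set x : 'rV[R]_(m1 + m2) | overlap a a' (lsubmx x) /\ overlap b b' (rsubmx x)].
  apply: openI.
    by apply: open_comp oA => x _; exact: continuous_lsubmx.
  by apply: open_comp oB => x _; exact: continuous_rsubmx.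
rewrite ovE; split=> //; exists (fun x => row_mx (tA (lsubmx x)) (tB (rsubmx x))).
  apply/smooth_onE => j; set D := (X in Ck j X).
  have kid : Ck j D (@idfun 'rV[R]_(m1 + m2)) by apply: linear_Ck => x.
  have kx i : Ck j D (fun x => x 0 i) by have /(Ck_mxP _ _ oov) := kid; exact.
  apply: Ck_row_mx => //.
    apply: (@Ck_comp R _ m1 1 m1 j D _ lsubmx tA oov oA) => //; first by move=> x [].
      by move: j {kid kx}; apply/smooth_onE.
    apply/(Ck_mxP _ _ oov) => i i'; rewrite ord1.
    by apply: (eq_Ck oov _ (kx (lshift m2 i'))) => x _; rewrite mxE.
  apply: (@Ck_comp R _ m2 1 m2 j D _ rsubmx tB oov oB) => //; first by move=> x [].
    by move: j {kid kx}; apply/smooth_onE.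
  apply/(Ck_mxP _ _ oov) => i i'; rewrite ord1.
  by apply: (eq_Ck oov _ (kx (rshift m1 i'))) => x _; rewrite mxE.
move=> x [/tAP[xa E1] /tBP[xb E2]] /=; rewrite row_mxKl row_mxKr; split=> //.
by rewrite E1 E2.
Qed.

Lemma smooth_manifold_coordinate_domain (R : realType) m (D : set 'rV[R]_m) g :
  open D -> smooth_manifold (coordinate_domain D g).
Proof.
move=> oD; split=> //.
- by move=> a x y _ _ /=.
- by apply/seteqP; split=> [x [[] _ [y Dy <-]]//|x Dx]; exists tt => //; exists x.
move=> [] []; have -> : @overlap _ _ (coordinate_domain D g) tt tt = D.
  by apply/seteqP; split=> x; [move=> []|move=> Dx; split=> //; exists x].
split=> //; exists id => // s x Dx.
by apply: (@linear_Ck R _ _ setT (size s) (@idfun 'rV[R]_m)) => // y.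
Qed.

Section RoundSphere.
Context {R : realType} {d : nat}.
Implicit Types (b : bool) (p : 'rV[R]_(d + 1)).

(** Height towards the projection pole of chart b: on the sphere the pole is the only point of
    height 1 and the only one the chart misses. *)
Let height b p : R := (-1) ^+ b * p 0 (rshift d 0).

Definition stereo b p : 'rV[R]_d := (1 - height b p)^-1 *: lsubmx p.

Let height_inv_stereo b (y : 'rV[R]_d) :
  height b (inv_stereo b y) = 1 - conformal_factor y.
Proof.
by rewrite /height inv_stereoE row_mxEr mxE mulr1n mulrA -expr2 sqrr_sign mul1r.
Qed.

Lemma stereoK b : cancel (@inv_stereo R d b) (stereo b).
Proof.
move=> y; rewrite /stereo height_inv_stereo opprB addrC subrK inv_stereoE row_mxKl.
by rewrite scalerA mulVf ?scale1r // lt0r_neq0 // conformal_factor_gt0.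
Qed.

Let height_neq1 b (y : 'rV[R]_d) : height b (inv_stereo b y) != 1.
Proof.
by rewrite height_inv_stereo -subr_eq0 addrC addKr oppr_eq0 lt0r_neq0 // conformal_factor_gt0.
Qed.

Lemma inv_stereoK b p : dot p p = 1 -> height b p != 1 -> inv_stereo b (stereo b p) = p.
Proof.
move=> p1 hb; rewrite -[p in RHS]hsubmxK inv_stereoE.
have hb0 : 1 - height b p != 0 by rewrite subr_eq0 eq_sym.
have E : dot (lsubmx p) (lsubmx p) = 1 - height b p ^+ 2.
  have H : dot p p = dot (lsubmx p) (lsubmx p) + p 0 (rshift d 0) ^+ 2.
    by rewrite -{1 2}[p]hsubmxK dot_row_mx [X in _ + X]dotE big_ord1 !mxE -expr2.
  by rewrite /height exprMn sqrr_sign mul1r -p1 H addrK.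
have lE : conformal_factor (stereo b p) = 1 - height b p.
  rewrite /conformal_factor /stereo dotZl dotZr E.
  have -> : (1 - height b p)^-1 * ((1 - height b p)^-1 * (1 - height b p ^+ 2)) + 1 =
    2 / (1 - height b p) by field.
  by rewrite invfM invrK mulrA mulfV ?mul1r // pnatr_eq0.
rewrite lE; congr row_mx; first by rewrite /stereo scalerA mulfV ?scale1r.
apply/rowP => i; rewrite !ord1 !mxE mulr1n opprB addrC subrK /height.
by rewrite mulrA -expr2 sqrr_sign mul1r.
Qed.

Lemma smooth_manifold_round_sphere : smooth_manifold (round_sphere R d).
Proof.
have cS b : continuous (@inv_stereo R d b).
  by move=> x; apply: differentiable_continuous; exact: (smooth_inv_stereo b [::]).
split.
- by move=> a; exact: openT.
- by move=> a x y _ _; exact: (can_inj (stereoK a)).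
- apply/seteqP; split=> [_ [b _ [y _ <-]]|p /= p1]; first exact: dot_inv_stereo.
  have [h|h] := eqVneq (height false p) 1.
    have h' : height true p != 1.
      move: h; rewrite /height expr0 expr1 mul1r => ->; rewrite mulr1.
      by rewrite eq_sym -subr_eq0 opprK -(natrD R 1 1) pnatr_eq0.
    by exists true => //; exists (stereo true p) => //; exact: inv_stereoK.
  by exists false => //; exists (stereo false p) => //; exact: inv_stereoK.
move=> a b.
(* The overlap consists of the points of chart a other than the pole of chart b. The same formula
   serves a = b, since a chart never reaches its own pole. *)
pose D := [set y : 'rV[R]_d | height b (inv_stereo a y) != 1].
have smooth_height j : Ck j setT (fun y => height b (@inv_stereo R d a y)).
  apply: CkM; [exact: openT|exact: Ck_cst|].
  have /(Ck_mxP _ _ openT) := (smooth_onE _ _).1 (@smooth_inv_stereo R d a) j.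
  by move=> /(_ 0 (rshift d 0)).
have oD : open D.
  have -> : D = (fun y => height b (inv_stereo a y)) @^-1` [set~ 1].
    by apply/seteqP; split=> y /= => [/eqP|H]; last exact/eqP.
  apply: open_comp; last by rewrite openC; exact: closed_eq.
  move=> y _; apply: differentiable_continuous.
  exact: (Ck_differentiable (@smooth_height 0%N)).
have ovE : @overlap _ _ (round_sphere R d) a b = D.
  apply/seteqP; split=> y.
    by move=> [_ [z _ /= E]]; rewrite /D /= -E; exact: height_neq1.
  move=> Dy; split=> //; exists (stereo b (inv_stereo a y)) => //.
  by apply: inv_stereoK => //; exact: dot_inv_stereo.
rewrite ovE; split=> //; exists (fun y => stereo b (inv_stereo a y)); last first.
  move=> y Dy; split=> //; apply: inv_stereoK => //; exact: dot_inv_stereo.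
apply/smooth_onE => j; have kS := Ck_subset (@subsetT _ D) ((smooth_onE _ _).1 (@smooth_inv_stereo R d a) j).
apply: Ck_scale => //.
  apply: CkV => // [y Dy|]; first by rewrite subr_eq0 eq_sym.
  by apply: CkB => //; [exact: Ck_cst|exact: Ck_subset (@subsetT _ D) (smooth_height j)].
apply/(Ck_mxP _ _ oD) => i i'.
move: kS => /(Ck_mxP _ _ oD)/(_ i (lshift 1 i')); apply: (eq_Ck oD) => y _.
by rewrite [RHS]mxE.
Qed.

End RoundSphere.

Lemma continuous_pair (T U V : topologicalType) (f : T -> U) (g : T -> V) :
  continuous f -> continuous g -> continuous (fun x => (f x, g x)).
Proof. by move=> cf cg x; apply: cvg_pair; [exact: cf|exact: cg]. Qed.

Lemma jacobian_near_comp (R : realType) m n p (f : 'rV[R]_m -> 'rV[R]_n)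
    (g : 'rV[R]_n -> 'rV[R]_p) (h : 'rV[R]_m -> 'rV[R]_p) x :
  differentiable f x -> differentiable g (f x) -> differentiable h x ->
  {near x, h =1 g \o f} -> 'J h x = 'J f x *m 'J g (f x).
Proof.
move=> df dg dh hgf; apply/row_matrixP => i; rewrite !rowE mulmxA.
rewrite -(deriveEjacobian _ df) -(deriveEjacobian _ dg) -(deriveEjacobian _ dh).
by rewrite (near_eq_derive _ hgf) derive_comp.
Qed.

(** All chart metrics are pulled back by one map f on the manifold, so their compatibility under a
    transition map is the chain rule for Jacobians. Positivity is read off from the diagonal
    form. *)
Lemma riemannian_metric_immersion (R : realType) m N (M : riem_atlas R m)
    (f : carrier M -> 'rV[R]_N) (gam : chart M -> 'I_m -> 'rV[R]_m -> R) :
  smooth_manifold M ->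
  (forall a : chart M, smooth_on (chart_dom a) (f \o chart_param a)) ->
  (forall (a : chart M) x, chart_dom a x ->
     induced_metric (f \o chart_param a) x = chart_metric a x) ->
  (forall (a : chart M) x, chart_dom a x ->
     chart_metric a x = diag_mx (\row_i gam a i x)) ->
  (forall (a : chart M) i x, chart_dom a x -> 0 < gam a i x) ->
  riemannian_metric M.
Proof.
move=> [op inj cov trans] sf fg gdiag gam_gt0 a; split.
- apply/smooth_onE => k.
  exact: (@Ck_induced_metric _ _ _ (chart_metric a) (f \o chart_param a) _ (op a) (sf a) (fg a)).
- by move=> x ax; rewrite -fg // /induced_metric trmx_mul trmxK.
- move=> x v ax v0; rewrite gdiag // inner_diag.
  have ge0 i : 0 <= (\row_i gam a i x) 0 i * (v 0 i * v 0 i).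
    rewrite mxE; apply: mulr_ge0; first by rewrite ltW ?gam_gt0.
    by rewrite -expr2 sqr_ge0.
  rewrite lt_def sumr_ge0 // andbT psumr_eq0 //; apply: contra v0 => /allP H.
  apply/eqP/rowP => i; have := H i (mem_index_enum _).
  rewrite /= !mxE mulf_eq0 (gt_eqF (gam_gt0 _ _ _ ax)) /= -expr2 sqrf_eq0.
  by move=> /eqP.
move=> b tau stau tauP x abx.
have [ax _] := abx; have [btx ptx] := tauP x abx; have [oab _] := trans a b.
have dtau : differentiable tau x := stau [::] x abx.
have dfb : differentiable (f \o chart_param b) (tau x) := sf b [::] _ btx.
have E : 'J (f \o chart_param a) x = 'J tau x *m 'J (f \o chart_param b) (tau x).
  apply: (jacobian_near_comp dtau dfb (sf a [::] x ax)).
  by apply: (near_open oab abx) => y /tauP[_ /= ->].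
by rewrite -fg // -fg // /induced_metric E trmx_mul !mulmxA.
Qed.

Lemma eigen_block (R : fieldType) m l (r : R) : r != 0 -> (0 < m)%N -> (0 < l)%N ->
  let P : 'M[R]_(m + l) := block_mx r%:M 0 0 0 in
  [/\ forall mu, eigenvalue P mu <-> mu = 0 \/ mu = r,
      \rank (eigenspace P 0) = l & \rank (eigenspace P r) = m].
Proof.
move=> r0 m0 l0 P.
(* P - mu is block diagonal with scalar blocks r - mu and - mu, each of full rank or zero. *)
have PE mu : \rank (eigenspace P mu) = ((m + l) - ((r != mu) * m + (mu != 0%R) * l))%N.
  rewrite /eigenspace mxrank_ker; congr (_ - _)%N.
  rewrite (scalar_mx_block m l mu) /P opp_block_mx add_block_mx !oppr0 !addr0 add0r.
  rewrite rank_diag_block_mx -raddfB -raddfN /=.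
  congr (_ + _)%N.
    have [->|rm] := eqVneq r mu; first by rewrite subrr raddf0 mxrank0 mul0n.
    by rewrite mxrank_unit ?mul1n // -scalemx1 unitmxZ ?unitmx1 // unitfE subr_eq0.
  have [->|rm] := eqVneq mu 0; first by rewrite oppr0 raddf0 mxrank0 mul0n.
  by rewrite mxrank_unit ?mul1n // -scalemx1 unitmxZ ?unitmx1 // unitfE oppr_eq0.
split.
- move=> mu; rewrite /eigenvalue -mxrank_eq0 PE.
  have [->|m1] := eqVneq mu 0; first by rewrite r0 mul1n mul0n addn0 addKn -lt0n l0; split=> // _; left.
  have [<-|m2] := eqVneq r mu; first by rewrite mul1n mul0n add0n addnK -lt0n m0; split=> // _; right.
  rewrite !mul1n subnn; split=> // -[E|E]; first by rewrite E eqxx in m1.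
  by rewrite E eqxx in m2.
- by rewrite PE r0 eqxx mul1n mul0n addn0 addKn.
by rewrite PE r0 eqxx mul1n mul0n add0n addnK.
Qed.

Lemma sum_class_kappa (R : realType) d l (a b c : R) (q : nat) :
  \sum_(i < 2 + d + l) class_kappa a b c (index_class d i) q =
  class_kappa a b c 0 q + class_kappa a b c 1 q + d%:R * class_kappa a b c 2 q.
Proof.
rewrite !big_split_ord /= [X in _ + X]big1 => [|i _]; last first.
  by rewrite /index_class /= ltnNge leq_addr.
rewrite addr0 big_ord_recl big_ord1 /=; congr (_ + _).
rewrite (eq_bigr (fun=> class_kappa a b c 2 q)) => [|i _]; last first.
  by rewrite /index_class /= ltn_add2l ltn_ord.
by rewrite sumr_const card_ord mulr_natl.
Qed.

(** * The warped product and its product with flat space *)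

Section WarpedConstruction.
Context {R : realType} {d l : nat}.
Variables (k : R) (phi eta : R -> R) (I : set R).
Hypotheses (oI : open I) (k0 : k != 0).
Hypotheses (sphi : smooth_on I phi) (seta : smooth_on I eta).
Local Notation f0 := phi.
Local Notation f1 := (phi^`())%classic.
Local Notation f2 := (f1^`())%classic.
Local Notation f3 := (f2^`())%classic.
Local Notation e1 := (eta^`())%classic.
Hypothesis phi_gt0 : forall t, I t -> 0 < f0 t.
Hypothesis phi1_neq0 : forall t, I t -> f1 t != 0.
Hypothesis unit_speed : forall t, I t ->
  (k * f2 t) ^+ 2 + f1 t ^+ 2 + e1 t ^+ 2 = 1.

(** The whole strip over I, with u unrestricted: the rotation is periodic in u, so the immersion
    wraps around the circle instead of being injective. *)
Definition warped_base : set 'rV[R]_2 := [set p | I (p 0 0)].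

Definition warped_atlas : riem_atlas R (2 + d) :=
  @warped_product R 2 d (coordinate_domain warped_base (base_metric phi))
    (fun p : 'rV[R]_2 => phi (p 0 0)) (round_sphere R d).

Definition warped_atlas_flat : riem_atlas R (2 + d + l) :=
  riem_product warped_atlas (euclidean R l).

Local Notation N := warped_atlas.
Local Notation M := warped_atlas_flat.

(** The rotation written on points of the manifold, independently of charts; in the chart with
    either pole it becomes [rot] by computation. *)
Definition warped_immersion (q : carrier N) : 'rV[R]_(2 + (d + 1) + 1) :=
  row_mx (row_mx ((k * f1 (q.1 0 0)) *: circle (q.1 0 1 / k)) (f0 (q.1 0 0) *: q.2))
    (eta (q.1 0 0))%:M.

Definition flat_immersion (q : carrier M) : 'rV[R]_(2 + (d + 1) + 1 + l) :=
  row_mx (warped_immersion q.1) q.2.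

Let immE (a : chart N) : warped_immersion \o chart_param a = @rot R d a.2 k phi eta.
Proof. by []. Qed.

Let immE' (a : chart M) :
  flat_immersion \o chart_param a = product_immersion (@rot R d a.1.2 k phi eta).
Proof. by []. Qed.

Let DN : set 'rV[R]_(2 + d) := [set x | I ((lsubmx x) 0 0)].

Let domN (a : chart N) : chart_dom a = DN.
Proof. by apply/seteqP; split=> x; [move=> []|move=> Dx; split]. Qed.

Let domM (a : chart M) : chart_dom a = [set x | DN (lsubmx x)].
Proof. by apply/seteqP; split=> x; [move=> [[]]|move=> Dx; split; [split|]]. Qed.

Let gamN (x : 'rV[R]_(2 + d)) (i : nat) : R :=
  class_gam (f1 ((lsubmx x) 0 0) ^+ 2)
    ((f0 ((lsubmx x) 0 0) * conformal_factor (rsubmx x)) ^+ 2) (index_class d i).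

Let kap (t : R) (i j : nat) : R := class_kappa (- f3 t / f1 t) (- f2 t / f0 t)
     ((1 - f1 t ^+ 2) / f0 t ^+ 2) (index_class d i) (index_class d j).

Let gN_diag (a : chart N) x : chart_metric a x = diag_mx (\row_i gamN x i).
Proof.
rewrite /= induced_metric_inv_stereo scale_scalar_mx -exprMn.
apply/matrixP => i j; rewrite [RHS]mxE [in RHS]mxE.
case: (fintype.split_ordP i) => p ->; case: (fintype.split_ordP j) => q ->;
  rewrite ?(block_mxEul, block_mxEur, block_mxEdl, block_mxEdr) ?(eq_lshift, eq_rshift, eq_lrshift, eq_rlshift).
- rewrite /base_metric !mxE /gamN /index_class /= ltn_ord; congr (_ *+ _).
  by case: p => -[|[|p]] hp //=; rewrite mxE.
- by rewrite mxE.
- by rewrite mxE.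
by rewrite mxE /gamN /index_class /= ltn_add2l ltn_ord.
Qed.

Let gM_diag (a : chart M) x : chart_metric a x = diag_mx (\row_i gamN (lsubmx x) i).
Proof.
rewrite -[LHS]/(block_mx (@chart_metric _ _ N a.1 (lsubmx x)) 0 0 1%:M) gN_diag.
apply/matrixP => i j; rewrite [RHS]mxE [in RHS]mxE.
case: (fintype.split_ordP i) => p ->; case: (fintype.split_ordP j) => q ->;
  rewrite ?(block_mxEul, block_mxEur, block_mxEdl, block_mxEdr) ?(eq_lshift, eq_rshift, eq_lrshift, eq_rlshift).
- by rewrite !mxE.
- by rewrite mxE.
- by rewrite mxE.
by rewrite mxE /gamN /index_class /= ltnNge leq_addr.
Qed.

Let oDN : open DN := @open_rot_domain R d I oI.

Let gamN_gt0 x i : DN x -> 0 < gamN x i.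
Proof. exact: (gam_gt0 phi_gt0 phi1_neq0 i). Qed.

Let smooth_imm (a : chart N) : smooth_on (chart_dom a) (warped_immersion \o chart_param a).
Proof. by rewrite immE domN; apply: (smooth_rot a.2 k oI sphi seta oDN). Qed.

Let induced_imm (a : chart N) x : chart_dom a x ->
  induced_metric (warped_immersion \o chart_param a) x = chart_metric a x.
Proof. by rewrite domN immE gN_diag => Dx; exact: (induced_metric_rot a.2 oI k0 sphi seta unit_speed). Qed.

Let smooth_imm' (a : chart M) : smooth_on (chart_dom a) (flat_immersion \o chart_param a).
Proof.
rewrite immE' domM; apply: (smooth_product_immersion oDN).
exact: (smooth_rot _ k oI sphi seta oDN).
Qed.

Let induced_imm' (a : chart M) x : chart_dom a x ->
  induced_metric (flat_immersion \o chart_param a) x = chart_metric a x.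
Proof.
rewrite domM immE' => Dx.
rewrite (induced_metric_product oDN) //; last exact: (smooth_rot _ k oI sphi seta oDN).
rewrite -[RHS]/(block_mx (@chart_metric _ _ N a.1 (lsubmx x)) 0 0 1%:M); congr block_mx.
by rewrite -induced_imm // domN.
Qed.

Let principalN (a : chart N) x : chart_dom a x ->
  principal_at (warped_immersion \o chart_param a) (fun i => gamN x i)
    (fun i j => kap ((lsubmx x) 0 0) i j) x.
Proof.
by rewrite domN immE => Dx; exact: (principal_rot _ oI k0 sphi seta phi_gt0 phi1_neq0 unit_speed oDN).
Qed.

Let kapS (t : R) i j : kap t i j = kap t j i.
Proof. by rewrite /kap; case: (index_class d i) (index_class d j) => [|[|[|p]]] [|[|[|q]]]. Qed.

Let principalM (a : chart M) x : chart_dom a x ->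
  principal_at (flat_immersion \o chart_param a) (fun i => gamN (lsubmx x) i)
    (fun i j => kap ((lsubmx (lsubmx x)) 0 0) i j) x.
Proof.
move=> ax; have Dx : DN (lsubmx x) by move: ax; rewrite domM.
have k0r i j : kap (lsubmx (lsubmx x) 0 0) i (rshift (2 + d) (j : 'I_l)) = 0.
  have c3 : index_class d (rshift (2 + d) j) = 3 by rewrite /index_class /= ltnNge leq_addr.
  by rewrite kapS /kap c3; case: (index_class d i) => [|[|[|]]].
have PN : principal_at (@rot R d a.1.2 k phi eta) (fun i => gamN (lsubmx x) i)
    (fun i j => kap ((lsubmx (lsubmx x)) 0 0) i j) (lsubmx x).
  exact: (principalN (a := a.1) (x := lsubmx x) ax.1).
rewrite immE'.
refine (principal_product oDN (smooth_rot a.1.2 k oI sphi seta oDN _) Dx PN _ _ _ _) => //.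
by move=> i j; rewrite kapS k0r.
Qed.

Lemma diagonal_curvature_warped (a : chart N) x : chart_dom a x ->
  diagonal_curvature (chart_metric a) (gamN x) (kap ((lsubmx x) 0 0)) x.
Proof.
move=> ax; have := ax; rewrite domN => Dx.
have oN : open (chart_dom a) by rewrite domN.
apply: (@principal_diagonal_curvature _ _ _ _ _ (chart_dom a) (fun i y => gamN y i)
  oN (@smooth_imm a) (@induced_imm a) (fun y _ => gN_diag a y) _ x _ ax (principalN ax)).
by move=> i y; rewrite domN; exact: gamN_gt0.
Qed.

Lemma diagonal_curvature_flat (a : chart M) x : chart_dom a x ->
  diagonal_curvature (chart_metric a) (gamN (lsubmx x)) (kap ((lsubmx (lsubmx x)) 0 0)) x.
Proof.
move=> ax; have oM : open (chart_dom a) by rewrite domM; exact: open_lsubmx_preimage.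
apply: (@principal_diagonal_curvature _ _ _ _ _ (chart_dom a) (fun i y => gamN (lsubmx y) i)
  oM (@smooth_imm' a) (@induced_imm' a) (fun y _ => gM_diag a y) _ x _ ax (principalM ax)).
by move=> i y; rewrite domM; exact: gamN_gt0.
Qed.

Lemma open_warped_base : open warped_base.
Proof.
apply: (@open_comp _ R (fun p : 'rV[R]_2 => p 0 0) I) => // p _.
exact: coord_continuous.
Qed.

Lemma smooth_manifold_warped : smooth_manifold N.
Proof.
have := smooth_manifold_product
  (@smooth_manifold_coordinate_domain R 2 warped_base (base_metric phi) open_warped_base)
  (@smooth_manifold_round_sphere R d).
exact.
Qed.

Lemma smooth_manifold_flat : smooth_manifold M.
Proof.
apply: smooth_manifold_product smooth_manifold_warped _.
by apply: smooth_manifold_coordinate_domain; exact: openT.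
Qed.

Let continuous_chart_param (a : chart N) :
  continuous (@chart_param _ _ N a : _ -> ('rV[R]_2 * 'rV[R]_(d + 1))%type).
Proof.
apply: (@continuous_pair _ _ _ lsubmx (fun x : 'rV[R]_(2 + d) => inv_stereo a.2 (rsubmx x))).
  exact: continuous_lsubmx.
move=> x; apply: (@continuous_comp _ _ _ rsubmx (@inv_stereo R d a.2)); first exact: continuous_rsubmx.
by apply: differentiable_continuous; exact: (smooth_inv_stereo a.2 [::]).
Qed.

Lemma riemannian_manifold_warped : riemannian_manifold N.
Proof.
have sN := smooth_manifold_warped; split=> //.
- apply: (@hausdorff_atlas _ _ N sN ('rV[R]_2 * 'rV[R]_(d + 1))%type id).
    exact: (@norm_hausdorff R ('rV[R]_2 * 'rV[R]_(d + 1))%type).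
    by move=> p q _ _.
  exact: continuous_chart_param.
- by apply: (second_countable_atlas sN (e := fun i => (tt, odd i))) => -[[] []]; [exists 1|exists 0].
apply: (@riemannian_metric_immersion _ _ _ N warped_immersion (fun a i x => gamN x i)) => //.
by move=> a i x; rewrite domN; exact: gamN_gt0.
Qed.

Lemma riemannian_manifold_flat : riemannian_manifold M.
Proof.
have sM := smooth_manifold_flat; split=> //.
- apply: (@hausdorff_atlas _ _ M sM ('rV[R]_2 * 'rV[R]_(d + 1) * 'rV[R]_l)%type id).
    exact: (@norm_hausdorff R ('rV[R]_2 * 'rV[R]_(d + 1) * 'rV[R]_l)%type).
    by move=> p q _ _.
  move=> a; apply: (@continuous_pair _ _ _ (fun x : 'rV[R]_(2 + d + l) =>
    (@chart_param _ _ N a.1 (lsubmx x) : ('rV[R]_2 * 'rV[R]_(d + 1))%type)) rsubmx).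
    move=> x; apply: (@continuous_comp _ _ _ lsubmx
      (@chart_param _ _ N a.1 : _ -> ('rV[R]_2 * 'rV[R]_(d + 1))%type)).
      exact: continuous_lsubmx.
    exact: continuous_chart_param.
  exact: continuous_rsubmx.
- by apply: (second_countable_atlas sM (e := fun i => (tt, odd i, tt))) => -[[[] []] []]; [exists 1|exists 0].
apply: (@riemannian_metric_immersion _ _ _ M flat_immersion (fun a i x => gamN (lsubmx x) i)) => //.
by move=> a i x; rewrite domM; exact: gamN_gt0.
Qed.

Lemma flat_immersion_isometric :
  isometric_immersion (points M) flat_immersion.
Proof.
move=> a; rewrite coord_preim_points; last exact: smooth_manifold_flat.
by split; [exact: smooth_imm'|exact: induced_imm'].
Qed.

Lemma flat_immersion_flat_normal_bundle : flat_normal_bundle (points M) flat_immersion.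
Proof.
move=> a; rewrite coord_preim_points; last exact: smooth_manifold_flat.
apply: (@principal_flat_normal _ _ _ _ _ (fun i x => gamN (lsubmx x) i)
  (fun x i j => kap ((lsubmx (lsubmx x)) 0 0) i j)).
- by rewrite domM; exact: open_lsubmx_preimage.
- exact: smooth_imm'.
- by move=> y ay; rewrite induced_imm' // gM_diag.
- by move=> i y; rewrite domM; exact: gamN_gt0.
by move=> x ax; exact: principalM.
Qed.

Local Notation kappa_tu t := (- f3 t / f1 t).
Local Notation kappa_ty t := (- f2 t / f0 t).
Local Notation kappa_yy t := ((1 - f1 t ^+ 2) / f0 t ^+ 2).
Variable rho : R.
(** The Ricci curvatures: this one belongs to the directions t and u, the next one to the sphere
    directions. *)
Hypothesis rho_t : forall t, I t -> kappa_tu t + d%:R * kappa_ty t = rho.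
Hypothesis rho_y : forall t, I t -> 2 * kappa_ty t + (d%:R - 1) * kappa_yy t = rho.

(** Stated for m extra flat coordinates, which contribute zero, so that m = 0 serves N and m = l
    serves M. The sum over classes counts i = j as well, and that term is subtracted. *)
Let sum_kap t (j : nat) (m : nat) : (j < 2 + d)%N -> I t ->
  \sum_(i < 2 + d + m | i != j :> nat) kap t i j = rho.
Proof.
move=> jd It; have jdm : (j < 2 + d + m)%N by rewrite ltn_addr.
have := sum_class_kappa d m (kappa_tu t) (kappa_ty t) (kappa_yy t) (index_class d j).
rewrite (bigD1 (Ordinal jdm)) //= => E.
have {}E : \sum_(i < 2 + d + m | i != j :> nat) kap t i j =
   class_kappa (kappa_tu t) (kappa_ty t) (kappa_yy t) 0 (index_class d j) +
   class_kappa (kappa_tu t) (kappa_ty t) (kappa_yy t) 1 (index_class d j) +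
   d%:R * class_kappa (kappa_tu t) (kappa_ty t) (kappa_yy t) 2 (index_class d j)
   - class_kappa (kappa_tu t) (kappa_ty t) (kappa_yy t) (index_class d j) (index_class d j).
  rewrite -E addrAC subrr add0r; apply: eq_bigl => i.
  by rewrite -val_eqE.
rewrite E {1 2 3 4 5}/index_class jd; case: j jd {jdm E} => [|[|j]] jd /=.
- by rewrite add0r subr0 rho_t.
- by rewrite addr0 subr0 rho_t.
by rewrite -(rho_y It); ring.
Qed.

Lemma einstein_warped : einstein N rho.
Proof.
move=> a x ax; have dc := diagonal_curvature_warped ax.
have It : I ((lsubmx x) 0 0) by move: ax; rewrite domN.
rewrite (ricci_diagonal dc) gN_diag -[RHS]linearZ; congr diag_mx.
apply/rowP => j; rewrite !mxE mulrC; congr (_ * _).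
have := sum_kap 0 (ltn_ord j) It.
rewrite big_mkcond big_split_ord /= big_ord0 addr0 -big_mkcond.
move=> <-; apply: eq_big => [i|i _]; first by rewrite -val_eqE.
by rewrite mxE.
Qed.

Lemma ricci_endo_flat (a : chart M) x : chart_dom a x ->
  ricci_endo (chart_metric a) x = block_mx rho%:M 0 0 0.
Proof.
move=> ax; have dc := diagonal_curvature_flat ax.
have It : I ((lsubmx (lsubmx x)) 0 0) by move: ax; rewrite domM.
rewrite (ricci_endo_diagonal dc).
have -> : (\row_j \sum_(i | i != j) kap (lsubmx (lsubmx x) 0 0) i j) =
  row_mx (const_mx rho) 0 :> 'rV[R]_(2 + d + l).
  apply/rowP => j; rewrite mxE; case: (fintype.split_ordP j) => p ->.
    rewrite row_mxEl [RHS]mxE -(sum_kap l (ltn_ord p) It).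
    by apply: eq_bigl => i; rewrite -val_eqE.
  rewrite row_mxEr [RHS]mxE big1 // => i _; rewrite /kap.
  have -> : index_class d (rshift (2 + d) p) = 3 by rewrite /index_class /= ltnNge leq_addr.
  by case: (index_class d i) => [|[|[|]]].
by rewrite diag_mx_row diag_const_mx raddf0.
Qed.

Hypothesis kappa_tu_le : forall t, I t -> kappa_tu t <= kappa_ty t.
Hypothesis kappa_yy_le : forall t, I t -> kappa_yy t <= kappa_ty t.
Hypothesis kappa_ty_ge0 : forall t, I t -> 0 <= kappa_ty t.

(** At t2 every coordinate plane has curvature at most [kappa_ty t2], including the zero ones of the
    flat factor. The plane of t and one sphere direction, indices 0 and 2, exceeds this bound at t1,
    contrary to [isometry_curvature_le]. *)
Lemma not_curvature_homogeneous_flat t1 t2 : (0 < d)%N -> I t1 -> I t2 ->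
  kappa_ty t2 < kappa_ty t1 -> ~ curvature_homogeneous M.
Proof.
move=> d0 It1 It2 lt12 hom.
pose pt t : 'rV[R]_(2 + d + l) := row_mx (row_mx (const_mx t) 0) 0.
have ptE t : (lsubmx (lsubmx (pt t))) 0 0 = t by rewrite !row_mxKl mxE.
pose a : chart M := (tt, false, tt).
have dom t : I t -> chart_dom a (pt t) by move=> It; rewrite domM /DN /= ptE.
have [J [isoI isoR]] := hom a a (pt t1) (pt t2) (dom _ It1) (dom _ It2).
have dc1 := diagonal_curvature_flat (dom _ It1).
have dc2 := diagonal_curvature_flat (dom _ It2).
rewrite !ptE in dc1 dc2.
have kle i j : i != j -> kap t2 i j <= kappa_ty t2.
  by move=> _; rewrite /kap; case: (index_class d i) (index_class d j) => [|[|[|?]]] [|[|[|?]]] /=; auto.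
have h0 : (0 < 2 + d + l)%N by [].
have h2 : (2 < 2 + d + l)%N by rewrite -addnA -[X in (X < _)%N]addn0 ltn_add2l addn_gt0 d0.
have := @isometry_curvature_le _ _ _ _ _ _ _ _ _ _ _ J dc1 dc2 (fun i j => kapS t2 i j) kle isoI isoR
  (Ordinal h0) (Ordinal h2) isT.
rewrite /kap /index_class /= -[X in (X < _)%N]addn0 ltn_add2l d0 /=.
by rewrite leNgt lt12.
Qed.

Hypothesis kappa_neq : forall t, I t -> kappa_tu t * kappa_yy t != kappa_ty t ^+ 2.

(** The obstruction is applied to the indices 0, 1, 2, 3, that is to t, u and two sphere directions;
    hence the bound 2 <= d. *)
Lemma no_codim_le1_flat n' (U : set (carrier M)) (f : carrier M -> 'rV[R]_n') :
  (2 <= d)%N -> (n' <= (2 + d + l).+1)%N ->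
  open_in U -> U !=set0 -> ~ isometric_immersion U f.
Proof.
move=> d2 n'le [UM oU] [p Up] iso.
have [_ _ cov _] := smooth_manifold_flat.
have := UM p Up; rewrite -cov => -[a _ [x ax xp]].
have Wx : coord_preim a U x.
  by split=> //; rewrite -[_ x]/(U (@chart_param _ _ M a x)) xp.
have [sf fg] := iso a.
have dc := diagonal_curvature_flat ax.
have h (i : nat) : (i < 4)%N -> (i < 2 + d + l)%N.
  by move=> i4; apply: leq_trans i4 _; rewrite -addnA (@leq_add 2 2 2) // (leq_trans d2) // leq_addr.
pose o i (i4 : (i < 4)%N) := Ordinal (h i i4).
have oM : open (chart_dom a) by rewrite domM; exact: open_lsubmx_preimage.
have gU y : coord_preim a U y -> chart_metric a y \in unitmx.
  move=> [ay _]; rewrite gM_diag invmx_diag // => i; rewrite mxE lt0r_neq0 //.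
  by apply: gamN_gt0; move: ay; rewrite domM.
have dch b c e : differentiable (christoffel (chart_metric a) b c e) x.
  apply: Ck_differentiable ax.
  apply: (@Ck_christoffel _ _ _ _ _ _ (fun i y => gamN (lsubmx y) i) oM (@smooth_imm' a)
    (@induced_imm' a) (fun y _ => gM_diag a y) _ 0%N).
  by move=> i y; rewrite domM; exact: gamN_gt0.
have E := diagonal_curvature_codim_le1 dc (oU a) sf Wx fg gU dch n'le
  (i := o 0 isT) (j := o 1 isT) (k := o 2 isT) (l := o 3 isT) isT.
have It : I ((lsubmx (lsubmx x)) 0 0) by move: ax; rewrite domM.
have c2 : index_class d 2 = 2 by rewrite /index_class /= -[X in (X < _)%N]addn0 ltn_add2l (ltnW d2).
have c3 : index_class d 3 = 2 by rewrite /index_class /= -[X in (X < _)%N](addn1 2) ltn_add2l d2.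
move/eqP: (kappa_neq It); apply; move: E; rewrite /kap [index_class d (o 2 _)]c2 [index_class d (o 3 _)]c3 /=.
by rewrite expr2.
Qed.

End WarpedConstruction.

(** * The warping function *)

Section AutonomousODE.
Context {R : realType}.
Implicit Types (a b s t : R) (f g h H G : R -> R).

Lemma open_interval a b : open [set s | a < s < b].
Proof.
have -> : [set s | a < s < b] = `]a, b[%classic by apply/seteqP; split=> s /=; rewrite in_itv.
exact: interval_open.
Qed.

Lemma derive_gt0_lt a b f df : (forall s, a < s < b -> is_derive s (1 : R) f (df s)) ->
  (forall s, a < s < b -> 0 < df s) ->
  forall s t, a < s -> s < t -> t < b -> f s < f t.
Proof.
move=> fd df0 s t as_ st tb.
have inab u : s <= u <= t -> a < u < b.
  by move=> /andP[su ut]; rewrite (lt_le_trans as_ su) (le_lt_trans ut tb).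
have [||u /itvP ust E] := @MVT R f df s t st.
- by move=> u /itvP ust; apply: fd; apply: inab; rewrite !ust.
- apply: derivable_within_continuous => u /itvP ust.
  by have [] := fd u (inab u ltac:(by rewrite !ust)).
rewrite -subr_gt0 E mulr_gt0 ?subr_gt0 // df0 // inab //.
by rewrite !ust.
Qed.

(** Shrinking the interval makes h continuous, hence integrable, on the compact interval from a' to
    b', where the integral from a' is the antiderivative. *)
Lemma antiderivative a b a' b' h : a < a' -> b' < b ->
  (forall s, a < s < b -> {for s, continuous h}) ->
  exists T : R -> R, forall s, a' < s < b' -> is_derive s (1 : R) T (h s).
Proof.
move=> aa' bb' ch; exists (fun x => (\int[lebesgue_measure]_(t in `[a', x]) h t)%R).
move=> s /andP[as_ sb].
have ih : lebesgue_measure.-integrable `[a', b'] (EFin \o h).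
  apply: continuous_compact_integrable; first exact: segment_compact.
  apply: continuous_in_subspaceT => u; rewrite inE /= in_itv /= => /andP[au ub].
  by apply: ch; rewrite (lt_le_trans aa' au) (le_lt_trans ub bb').
have [|dF F's] := continuous_FTC1_closed sb ih as_.
  by apply: ch; rewrite (lt_trans aa' as_) (lt_trans sb bb').
apply: DeriveDef; first exact: dF.
by rewrite -derive1E; exact: F's.
Qed.

(** Separation of variables: an antiderivative T of 1 / H is strictly increasing, and phi is the
    inverse function of T - T s0. *)
Lemma autonomous_ode H a b s0 : a < s0 < b ->
  (forall s, a < s < b -> {for s, continuous H}) -> (forall s, a < s < b -> 0 < H s) ->
  exists r phi, [/\ 0 < r, phi 0 = s0, (forall t, - r < t < r -> a < phi t < b) &
    forall t, - r < t < r -> is_derive t (1 : R) phi (H (phi t))].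
Proof.
move=> /andP[as0 s0b] cH H0.
pose a' := (a + s0) / 2; pose b' := (s0 + b) / 2.
have [aa' a's] : a < a' /\ a' < s0 by rewrite /a'; split; lra.
have [sb' b'b] : s0 < b' /\ b' < b by rewrite /b'; split; lra.
have inab s : a' < s < b' -> a < s < b.
  by move=> /andP[? ?]; rewrite (lt_trans aa') // (lt_trans _ b'b).
have [|T dT] := @antiderivative a b a' b' (fun s => (H s)^-1) aa' b'b.
  by move=> s sab; apply: continuousV; [rewrite lt0r_neq0 // H0|exact: cH].
have Tlt := derive_gt0_lt dT (fun s sab => ltac:(by rewrite invr_gt0; apply: H0; exact: inab)).
have Tinj s t : a' < s < b' -> a' < t < b' -> T s = T t -> s = t.
  move=> /andP[s1 s2] /andP[t1 t2] E; have [lt_st|lt_ts|//] := ltgtP s t.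
    by have := Tlt s t s1 lt_st t2; rewrite E ltxx.
  by have := Tlt t s t1 lt_ts s2; rewrite E ltxx.
pose S s := T s - T s0.
(* The inverse of S chosen pointwise, with the value s0 outside the range of S. *)
pose phi t := xget s0 [set s | a' < s < b' /\ S s = t].
have phiS s : a' < s < b' -> phi (S s) = s.
  move=> sab; rewrite /phi; case: xgetP => [u _ [uab Eu]|/(_ s)[]//].
  by apply: Tinj => //; move: Eu; rewrite /S => /addIr.
(* S is controlled only on the open interval from a' to b'; the intermediate value theorem needs a
   closed one inside it. The bound r below keeps t between the values of S at its ends. *)
pose a'' := (a' + s0) / 2; pose b'' := (s0 + b') / 2.
have [a1 a2] : a' < a'' /\ a'' < s0 by rewrite /a''; split; lra.
have [b1 b2] : s0 < b'' /\ b'' < b' by rewrite /b''; split; lra.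
have S0 : S s0 = 0 by rewrite /S subrr.
have Sa : S a'' < 0 by rewrite -S0 ltrD2r Tlt // (lt_trans sb').
have Sb : 0 < S b'' by rewrite -S0 ltrD2r Tlt.
have dS s : a' < s < b' -> is_derive s (1 : R) S (H s)^-1.
  move=> sab; rewrite -[(H s)^-1]subr0; apply: is_deriveB; exact: dT.
pose r := Num.min (- S a'') (S b'').
have r0 : 0 < r by rewrite lt_min oppr_gt0 Sa.
have surj t : - r < t < r -> exists2 s, a' < s < b' & S s = t.
  move=> /andP[rt tr].
  have h1 : S a'' <= t.
    by apply: ltW; apply: le_lt_trans rt; rewrite lerNr ge_min lexx.
  have h2 : t <= S b'' by apply: ltW; apply: lt_le_trans tr _; rewrite ge_min lexx orbT.
  have [|||s /itvP sab Es] := @IVT R S a'' b'' t.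
  - by apply: ltW; exact: lt_trans a2 b1.
  - apply: derivable_within_continuous => s /itvP sab.
    have [|] // := dS s; rewrite (lt_le_trans a1) ?sab //=.
    by apply: le_lt_trans b2; rewrite sab.
  - by rewrite ge_min h1 /= le_max h2 orbT.
  exists s => //; rewrite (lt_le_trans a1) ?sab //=.
  by apply: le_lt_trans b2; rewrite sab.
exists r, phi; split=> //.
- by rewrite -{1}S0 phiS // a's sb'.
- by move=> t /surj[s sab <-]; rewrite phiS //; exact: inab.
move=> t /surj[s sab <-]; rewrite phiS // -[H s]invrK.
have oab := @open_interval a' b'.
apply: (@is_derive_inverse R S phi) => //.
- by apply: (near_open oab sab) => u; exact: phiS.
- apply: (near_open oab sab) => u uab.
  by apply/differentiable_continuous/derivable1_diffP; have [] := dS u uab.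
- exact: dS.
by rewrite invr_eq0 lt0r_neq0 // H0 // inab.
Qed.

(** Bootstrapping without assuming phi smooth: the derivative of G o phi is (G' H) o phi, again a
    composition with phi, so the induction on k runs over all G at once. The identity for G gives
    smoothness of phi itself. *)
Lemma Ck_ode_comp H a b (I : set R) phi k G : open I ->
  smooth_on [set s | a < s < b] H -> (forall t, I t -> a < phi t < b) ->
  (forall t, I t -> is_derive t (1 : R) phi (H (phi t))) ->
  Ck k [set s | a < s < b] G -> Ck k I (G \o phi).
Proof.
move=> oI sH Iab dphi; have oab := @open_interval a b.
have diffphi t : I t -> differentiable phi t.
  by move=> It; apply/derivable1_diffP; have [] := dphi t It.
elim: k G => [|k IH] G kG.
  apply/CkP; split=> // t It; apply: differentiable_comp; first exact: diffphi.
  exact/(Ck_differentiable kG)/Iab.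
have dG t : I t -> differentiable G (phi t) by move/Iab/(Ck_differentiable kG).
apply/CkP; split=> [t It|v]; first by apply: differentiable_comp; auto.
have kGH : Ck k [set s | a < s < b] (fun s => 'D_(1 : R) G s * H s).
  by apply: CkM => //; [exact: Ck_derive|exact: ((smooth_onE _ _).1 sH k)].
apply: (eq_Ck oI _ (CkM oI (Ck_cst v) (IH _ kGH))) => t It.
rewrite [RHS](derive_comp _ (diffphi t It) (dG t It)).
have dphiv : 'D_v phi t = v * H (phi t).
  have [_ <-] := dphi t It.
  by rewrite !(deriveE _ (diffphi t It)) -[in LHS](mulr1 v) [LHS]linearZ.
rewrite dphiv !(deriveE _ (dG t It)) /= (deriveE _ (dG t It)).
rewrite -[in RHS](mulr1 (v * _)) [RHS]linearZ /GRing.scale /=.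
by rewrite -[RHS]/(v * H (phi t) * 'd G (phi t) 1) -mulrA; congr (_ * _); rewrite mulrC.
Qed.

End AutonomousODE.

Section SmoothTools.
Context {R : realType}.

Lemma derive_scalar (f : R -> R) (t v df : R) : is_derive t (1 : R) f df -> 'D_v f t = v * df.
Proof.
move=> [dF <-]; have /derivable1_diffP df' := dF.
by rewrite !(deriveE _ df') -[in LHS](mulr1 v) [LHS]linearZ.
Qed.

Lemma Ck_of_derive (U : set R) (f df : R -> R) k : open U ->
  (forall t, U t -> is_derive t (1 : R) f (df t)) -> Ck k U df -> Ck k.+1 U f.
Proof.
move=> oU fd kdf; apply/CkP; split=> [t Ut|v].
  by apply/derivable1_diffP; have [] := fd t Ut.
apply: (eq_Ck oU _ (CkM oU (Ck_cst v) kdf)) => t Ut.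
by rewrite (derive_scalar v (fd t Ut)).
Qed.

Lemma open_gt0 : open [set x : R | 0 < x].
Proof. exact: open_gt. Qed.

Lemma Ck_sqrt k : Ck k [set x : R | 0 < x] (@Num.sqrt R).
Proof.
elim: k => [|k IH].
  apply/CkP; split=> // x x0; apply/derivable1_diffP.
  by have [] := is_derive1_sqrt x0.
apply: (Ck_of_derive open_gt0 (fun x x0 => is_derive1_sqrt x0)).
apply: CkV; [exact: open_gt0|by move=> x x0; rewrite mulf_neq0 // lt0r_neq0 // sqrtr_gt0|].
by apply: CkM => //; exact: Ck_cst.
Qed.

End SmoothTools.

Section Profile.
Context {R : realType} (p : nat).
Hypothesis p_gt0 : (0 < p)%N.

(* The right-hand side of the equation for phi'^2 with p = n - 3,
   rho / (n - 1) = 1/2 and c = 1/4; then phi'' = [profile1] phi and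
   phi''' = [profile2] phi * phi'. *)
Definition profile (s : R) : R := 1 - s ^+ 2 / 2 + 4^-1 / s ^+ p.
Definition profile1 (s : R) : R := - s / 2 - p%:R / 8 / s ^+ p.+1.
Definition profile2 (s : R) : R := - 2^-1 + p%:R * p.+1%:R / 8 / s ^+ p.+2.
(* Small enough for eta'^2 = [gap] phi to be positive near phi = 1. *)
Definition aperture : R := p.+1%:R^-1.
Let gap (s : R) : R := 1 - profile s - (aperture * profile1 s) ^+ 2.

Let is_derive_invX n (s : R) : 0 < s ->
  is_derive s (1 : R) (fun s => (s ^+ n.+1)^-1) (- n.+1%:R / s ^+ n.+2).
Proof.
move=> s0; have Hid : is_derive s (1 : R) (@id R) 1 by exact: is_derive_id.
have HX : is_derive s (1 : R) (fun s : R => s ^+ n.+1) (n.+1%:R * s ^+ n).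
  split; first exact: exprn_derivable.
  by rewrite exp_derive /GRing.scale /= mulr1.
have sn0 m : s ^+ m != 0 by rewrite expf_neq0 // lt0r_neq0.
apply: (is_derive_eq (is_derive_inv HX (sn0 _))).
by rewrite !exprS; field; rewrite ?sn0 lt0r_neq0.
Qed.

Lemma is_derive_profile (s : R) : 0 < s -> is_derive s (1 : R) profile (2 * profile1 s).
Proof.
move=> s0.
have Hid : is_derive s (1 : R) (@id R) 1 by exact: is_derive_id.
have HV := @is_derive_invX p.-1 s s0; rewrite !(prednK p_gt0) in HV.
have HS := is_derive_mulr (is_derive_mulr Hid Hid) (is_derive_const (2^-1 : R) s (1 : R)).
have H := is_derive_addr (is_derive_subr (is_derive_const (1 : R) s (1 : R)) HS)
  (is_derive_mulr (is_derive_const (4^-1 : R) s (1 : R)) HV).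
rewrite /profile1.
apply: (is_derive_eq H); rewrite mul0r; move: (s ^- p.+1) => u; rewrite /=.
by field.
Qed.

Lemma is_derive_profile1 (s : R) : 0 < s -> is_derive s (1 : R) profile1 (profile2 s).
Proof.
move=> s0.
have Hid : is_derive s (1 : R) (@id R) 1 by exact: is_derive_id.
have HV := @is_derive_invX p s s0.
have HN := is_derive_subr (is_derive_const (0 : R) s (1 : R)) Hid.
have H := is_derive_subr
  (is_derive_mulr HN (is_derive_const (2^-1 : R) s (1 : R)))
  (is_derive_mulr (is_derive_const (p%:R / 8 : R) s (1 : R)) HV).
rewrite /profile2.
have -> : profile1 = fun s => (0 - s) * 2^-1 - (p%:R / 8) * (s ^+ p.+1)^-1.
  by apply/funext => t; rewrite sub0r.
apply: (is_derive_eq H); rewrite mul0r; move: (s ^- p.+2) => u; rewrite /=.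
by field.
Qed.

Let gt0_open := @open_gt0 R.

Lemma smooth_profile k : Ck k [set s : R | 0 < s] profile.
Proof.
have kid : Ck k [set s : R | 0 < s] (@idfun R) by apply: linear_Ck => x.
apply: CkD => //; last first.
  apply: CkM => //; first exact: Ck_cst.
  apply: CkV => // [s s0|]; first by rewrite expf_neq0 // lt0r_neq0.
  exact: (CkX p gt0_open kid).
apply: CkB => //; first exact: Ck_cst.
by apply: CkM => //; [exact: (CkX 2 gt0_open kid)|exact: Ck_cst].
Qed.

Lemma smooth_profile1 k : Ck k [set s : R | 0 < s] profile1.
Proof.
have kid : Ck k [set s : R | 0 < s] (@idfun R) by apply: linear_Ck => x.
apply: CkB => //.
  by apply: CkM => //; [exact: CkN|exact: Ck_cst].
apply: CkM => //; first exact: Ck_cst.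
apply: CkV => // [s s0|]; first by rewrite expf_neq0 // lt0r_neq0.
exact: (CkX p.+1 gt0_open kid).
Qed.

Let smooth_gap k : Ck k [set s : R | 0 < s] gap.
Proof.
apply: CkB => //; last by apply: CkX => //; apply: CkM => //; [exact: Ck_cst|exact: smooth_profile1].
by apply: CkB => //; [exact: Ck_cst|exact: smooth_profile].
Qed.

(** All conditions are open and hold at s = 1, where the profile is 3/4. *)
Let profile_near1 : exists2 e : R, 0 < e < 1 & forall s, 1 - e < s < 1 + e ->
  [/\ 0 < s, 0 < profile s, profile s < 1 & 0 < gap s].
Proof.
have c1 (f : R -> R) : (forall k, Ck k [set s : R | 0 < s] f) -> {for (1 : R), continuous f}.
  by move=> kf; apply: differentiable_continuous; exact: Ck_differentiable (kf 0%N) ltr01.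
have P1 : profile 1 = 3 / 4 by rewrite /profile !expr1n; field.
have G1 : 0 < gap 1.
  rewrite /gap P1 /aperture /profile1 !expr1n.
  have p1 : 1 <= p%:R :> R by rewrite ler1n.
  rewrite -[p.+1%:R]natr1; move: (p%:R : R) p1 => x x1.
  have x10 : x + 1 != 0 by rewrite lt0r_neq0 //; lra.
  (* With x = p, the value at 1 is 1/4 - ((x + 4) / (8 (x + 1)))^2. It is positive because 4 (x + 1)
     > x + 4, and this is where the size of [aperture] enters. *)
  rewrite [X in 0 < X](_ : _ =
     (16 * (x + 1) ^+ 2 - (x + 4) ^+ 2) / (64 * (x + 1) ^+ 2)); last by field.
  rewrite divr_gt0 //; first by nra.
  by rewrite mulr_gt0 // exprn_gt0 //; lra.
have n1 : \forall s \near (1 : R), 0 < profile s.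
  by apply: (c1 _ smooth_profile [set y | 0 < y]); apply: open_nbhs_nbhs; split; [exact: open_gt|rewrite /= P1; lra].
have n2 : \forall s \near (1 : R), profile s < 1.
  by apply: (c1 _ smooth_profile [set y | y < 1]); apply: open_nbhs_nbhs; split; [exact: open_lt|rewrite /= P1; lra].
have n3 : \forall s \near (1 : R), 0 < gap s.
  by apply: (c1 _ smooth_gap [set y | 0 < y]); apply: open_nbhs_nbhs; split; [exact: open_gt|].
have [e /= e0 eP] := (nbhs_ballP (1 : R) _).1 (filterI (filterI n1 n2) n3).
exists (Num.min e 2^-1).
  by rewrite lt_min e0 gt_min invf_lt1 ?ltr1n // invr_gt0 ltr0n orbT.
move=> s /andP[s1 s2].
have le1 : Num.min e 2^-1 <= e by rewrite ge_min lexx.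
have le2 : Num.min e 2^-1 <= 2^-1 by rewrite ge_min lexx orbT.
have [] : ((fun s => 0 < profile s) `&` (fun s => profile s < 1) `&` (fun s => 0 < gap s)) s.
  apply: eP; rewrite /ball /= ltr_norml; apply/andP; split; lra.
by move=> [h1 h2] h3; split=> //; lra.
Qed.

(** Taking eta = Q o phi with Q' = sqrt gap / H and phi' = H phi makes eta' = sqrt (gap phi), as
    unit speed demands, and [Ck_ode_comp] then gives smoothness of eta as well as of phi. *)
Lemma warping_exists : exists (r : R) (phi eta : R -> R), let I := [set t : R | - r < t < r] in
  [/\ 0 < r, smooth_on I phi, smooth_on I eta,
   forall t, I t -> 0 < phi t /\ 0 < (phi^`())%classic t &
   forall t, I t -> [/\ (phi^`())%classic t ^+ 2 = profile (phi t),
     profile (phi t) < 1,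
     (phi^`()^`())%classic t = profile1 (phi t),
     (phi^`()^`()^`())%classic t = profile2 (phi t) * (phi^`())%classic t &
     (aperture * (phi^`()^`())%classic t) ^+ 2 + (phi^`())%classic t ^+ 2
       + (eta^`())%classic t ^+ 2 = 1]].
Proof.
have [e /andP[e0 e1] eP] := profile_near1.
pose H (s : R) := Num.sqrt (profile s).
pose h (s : R) := Num.sqrt (gap s) / H s.
(* Two nested intervals around 1: [antiderivative] yields Q only on the smaller one, so phi is
   confined to it. *)
pose a0 : R := 1 - e; pose b0 : R := 1 + e; pose a : R := 1 - e / 2; pose b : R := 1 + e / 2.
have [aa bb] : a0 < a /\ b < b0 by rewrite /a0 /a /b /b0; split; lra.
have ab1 : a < 1 < b by rewrite /a /b; apply/andP; split; lra.
have sub s : a < s < b -> a0 < s < b0.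
  by move=> /andP[? ?]; rewrite (lt_trans aa) // (lt_trans _ bb).
pose J0 : set R := [set s | a0 < s < b0]; have oJ0 : open J0 := @open_interval R a0 b0.
pose J : set R := [set s | a < s < b]; have oJ : open J := @open_interval R a b.
have J0gt0 s : J0 s -> 0 < s by move=> /eP[].
have sH k : Ck k J0 H.
  have P0 s : J0 s -> [set x | 0 < x] (profile s) by move=> /eP[].
  exact: (Ck_comp1 oJ0 P0 (@Ck_sqrt R k) (Ck_subset J0gt0 (@smooth_profile k))).
have H0 s : J0 s -> 0 < H s by move=> /eP[_ ? _ _]; rewrite sqrtr_gt0.
have sh k : Ck k J0 h.
  apply: CkM => //.
    have P0 s : J0 s -> [set x | 0 < x] (gap s) by move=> /eP[].
    exact: (Ck_comp1 oJ0 P0 (@Ck_sqrt R k) (Ck_subset J0gt0 (@smooth_gap k))).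
  by apply: CkV => // s /H0/lt0r_neq0.
have cont (f : R -> R) : (forall k, Ck k J0 f) -> forall s, a0 < s < b0 -> {for s, continuous f}.
  by move=> kf s Js; apply: differentiable_continuous; exact: Ck_differentiable (kf 0%N) Js.
have [r [phi [r0 phi0 phiJ dphi]]] := autonomous_ode ab1
  (fun s sab => cont _ sH s (sub s sab)) (fun s sab => H0 s (sub s sab)).
have [Q dQ] := antiderivative aa bb (cont _ sh).
pose I := [set t : R | - r < t < r]; have oI : open I := @open_interval R (- r) r.
have sJH : smooth_on J H.
  by apply/smooth_onE => k; apply: Ck_subset (@sH k) => s; exact: sub.
have kQ k : Ck k J Q.
  by apply: CkW; apply: (Ck_of_derive oJ dQ); apply: Ck_subset (@sh k) => s; exact: sub.
have kid k : Ck k J (@idfun R) by apply: linear_Ck => x.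
exists r, phi, (Q \o phi) => /=; rewrite -/I.
have d1 t : I t -> (phi^`())%classic t = H (phi t).
  by move=> It; rewrite derive1E; have [_ ->] := dphi t It.
have Jphi t : I t -> J0 (phi t) by move=> It; exact: sub (phiJ t It).
have dcomp (f : R -> R) (t df : R) : I t -> is_derive (phi t) (1 : R) f df ->
    is_derive t (1 : R) (f \o phi) (df * H (phi t)).
  by move=> It Hf; exact: is_derive1_comp (dphi t It).
have nearE (f g : R -> R) (t : R) : I t -> (forall u, I u -> f u = g u) ->
    (f^`())%classic t = (g^`())%classic t.
  by move=> It fg; rewrite !derive1E; apply: near_eq_derive; exact: (near_open oI It).
have d2 t : I t -> (phi^`()^`())%classic t = profile1 (phi t).
  move=> It; rewrite (nearE _ _ _ It d1) derive1E.
  have [s0 P0 _ _] := eP _ (Jphi t It).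
  have HP := is_derive1_comp (is_derive1_sqrt P0) (is_derive_profile s0).
  have [_ ->] := dcomp _ _ _ It HP.
  have H0' : H (phi t) != 0 by rewrite lt0r_neq0 // H0 //; exact: Jphi.
  by rewrite -/(H (phi t)); field.
split=> //.
- by apply/smooth_onE => k; exact: (Ck_ode_comp oI sJH phiJ dphi (@kid k)).
- by apply/smooth_onE => k; exact: (Ck_ode_comp oI sJH phiJ dphi (@kQ k)).
- move=> t It; rewrite d1 //; split; last exact/H0/Jphi.
  by have [] := eP _ (Jphi t It).
move=> t It; have [s0 P0 Plt G0] := eP _ (Jphi t It).
have H2 : H (phi t) ^+ 2 = profile (phi t) by rewrite sqr_sqrtr // ltW.
split=> //.
- by rewrite d1.
- exact: d2.
- rewrite (nearE _ _ _ It d2) derive1E d1 //.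
  by have [_ ->] := dcomp _ _ _ It (is_derive_profile1 s0).
rewrite d2 // d1 // H2.
have -> : ((Q \o phi)^`())%classic t = h (phi t) * H (phi t).
  by rewrite derive1E; have [_ ->] := dcomp _ _ _ It (dQ _ (phiJ t It)).
have -> : h (phi t) * H (phi t) = Num.sqrt (gap (phi t)).
  by rewrite /h divfK // lt0r_neq0 // H0 //; exact: Jphi.
by rewrite sqr_sqrtr ?ltW // /gap; ring.
Qed.

End Profile.

(** L is the union of the segments from the origin to its points, all of which share the origin. *)
Lemma star_connected (R : realType) (V : normedModType R) (L : set V) :
  (forall p s, L p -> 0 <= s <= 1 -> L (s *: p)) -> connected L.
Proof.
move=> star.
have -> : L = \bigcup_(p in L) ((fun s : R => s *: p) @` `[0, 1]).
  apply/seteqP; split=> [p Lp|p [q Lq] [s]].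
    exists p => //; exists 1; last by rewrite scale1r.
    by rewrite /= in_itv /= ler01 lexx.
  by rewrite /= in_itv /= => s01 <-; exact: star.
apply: bigcup_connected.
  by exists 0 => p _; exists 0; [rewrite /= in_itv /= lexx ler01|rewrite scale0r].
move=> p _; apply: connected_continuous_connected; first exact: segment_connected.
apply: continuous_subspaceT => s.
by apply: continuousZl; exact: cvg_id.
Qed.

(** * Curvatures along the chosen profile *)

Section ProfileCurvature.
Context {R : realType} (p : nat).
Hypothesis p_gt0 : (0 < p)%N.
Variables (s v : R).
Hypotheses (s_gt0 : 0 < s) (v_neq0 : v != 0) (P_lt1 : profile p s < 1).
(** Here [s] stands for phi t and [v] for phi' t. *)
Let X : R := 4^-1 / s ^+ p.+2.
Let kappa_tu : R := - (profile2 p s * v) / v.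
Let kappa_ty : R := - profile1 p s / s.
Let kappa_yy : R := (1 - profile p s) / s ^+ 2.

Let X_gt0 : 0 < X. Proof. by rewrite divr_gt0 ?invr_gt0 ?exprn_gt0. Qed.

Let kappa_tuE : kappa_tu = 2^-1 - p%:R * p.+1%:R / 2 * X.
Proof.
have sp : s ^+ p.+2 != 0 by rewrite expf_neq0 // lt0r_neq0.
by rewrite /kappa_tu /profile2 /X mulNr mulfK //; field.
Qed.

Let kappa_tyE : kappa_ty = 2^-1 + p%:R / 2 * X.
Proof.
have sp : s ^+ p != 0 by rewrite expf_neq0 // lt0r_neq0.
have s0 : s != 0 by rewrite lt0r_neq0.
by rewrite /kappa_ty /profile1 /X !exprS; field; rewrite sp s0.
Qed.

Let kappa_yyE : kappa_yy = 2^-1 - X.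
Proof.
have sp : s ^+ p != 0 by rewrite expf_neq0 // lt0r_neq0.
have s0 : s != 0 by rewrite lt0r_neq0.
by rewrite /kappa_yy /profile /X !exprS expr0; field; rewrite sp s0.
Qed.

(** The condition phi'^2 < 1 is the positivity of K(y, y') = 1/2 - X. *)
Let X_lt : X < 2^-1.
Proof.
have : 0 < kappa_yy by rewrite divr_gt0 ?subr_gt0 ?exprn_gt0.
by rewrite kappa_yyE subr_gt0.
Qed.

Let p_ge1 : 1 <= p%:R :> R. Proof. by rewrite ler1n. Qed.

Lemma profile_ricci_t : kappa_tu + p.+1%:R * kappa_ty = p.+2%:R / 2.
Proof. by rewrite kappa_tuE kappa_tyE -!natr1; field. Qed.

Lemma profile_ricci_y : 2 * kappa_ty + (p.+1%:R - 1) * kappa_yy = p.+2%:R / 2.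
Proof. by rewrite kappa_yyE kappa_tyE -!natr1; field. Qed.

Lemma profile_kappa_tu_le : kappa_tu <= kappa_ty.
Proof.
rewrite kappa_tuE kappa_tyE lerD2l -mulNr ler_pM2r // -[p.+1%:R]natr1.
by move: (p%:R : R) p_ge1 => x x1; nra.
Qed.

Lemma profile_kappa_yy_le : kappa_yy <= kappa_ty.
Proof.
rewrite kappa_yyE kappa_tyE lerD2l -mulN1r ler_pM2r //.
by move: (p%:R : R) p_ge1 => x x1; lra.
Qed.

Lemma profile_kappa_ty_ge0 : 0 <= kappa_ty.
Proof. by rewrite kappa_tyE addr_ge0 ?invr_ge0 ?mulr_ge0 ?ler0n ?invr_ge0 ?exprn_ge0 ?ler0n // ltW. Qed.

Lemma profile_kappa_neq : kappa_tu * kappa_yy != kappa_ty ^+ 2.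
Proof.
rewrite -subr_eq0 lt_eqF // kappa_tuE kappa_yyE kappa_tyE -[p.+1%:R]natr1.
move: (p%:R : R) p_ge1 => x x1.
(* The constant terms cancel and X (x + 2) factors out; the remaining factor is positive because X <
   1. *)
have -> : (2^-1 - x * (x + 1) / 2 * X) * (2^-1 - X) - (2^-1 + x / 2 * X) ^+ 2 =
  - (X * (x + 2) / 4 * (x * (1 - X) + 1)) by field.
rewrite oppr_lt0 mulr_gt0 //; first by rewrite divr_gt0 // mulr_gt0 //; lra.
by rewrite addr_gt0 // mulr_gt0 //; [lra|move: X_lt; lra].
Qed.

End ProfileCurvature.

(** The quotient is 1/2 + p / (8 s^(p + 2)): K(t, y) decreases strictly as phi grows. *)
Lemma profile1_div_lt (R : realType) p (s s' : R) : (0 < p)%N -> 0 < s -> s < s' ->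
  - profile1 p s' / s' < - profile1 p s / s.
Proof.
move=> p0 s0 ss'; have s'0 := lt_trans s0 ss'.
have E (u : R) : 0 < u -> - profile1 p u / u = 2^-1 + p%:R / 8 / u ^+ p.+2.
  move=> u0; have up : u ^+ p != 0 by rewrite expf_neq0 // lt0r_neq0.
  by rewrite /profile1 !exprS; field; rewrite up lt0r_neq0.
rewrite !E // ltrD2l ltr_pM2l ?divr_gt0 ?ltr0n //.
by rewrite ltf_pV2 ?posrE ?exprn_gt0 // ltrXn2r // ltW.
Qed.

Theorem theorem1p2 (R : realType) (n l : nat) (hn : (4 <= n)%N)
    (hl : (1 <= l)%N) :
  exists (rho c : R) (I : set R) (phi : R -> R) (L : set 'rV[R]_2),
    let N := einstein_warped_product n phi L in
    let M := riem_product N (euclidean R l) in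
    (rho != 0 /\ c != 0) /\
    [/\ open I, is_interval I & I 0] /\
    warping_function n rho c I phi /\
    [/\ open L, connected L, L !=set0 & forall p, L p -> I (p 0 0)] /\
    (riemannian_manifold N /\ riemannian_manifold M) /\
    einstein N rho /\
    (forall (a : chart M) x, chart_dom a x ->
       let P := ricci_endo (chart_metric a) x in
       [/\ forall mu, eigenvalue P mu <-> mu = 0 \/ mu = rho,
           \rank (eigenspace P 0) = l &
           \rank (eigenspace P rho) = n]) /\
    ~ curvature_homogeneous M /\
    (exists (U : set (carrier M)) (f : carrier M -> 'rV[R]_(n + l + 2)),
       [/\ open_in U, U !=set0, isometric_immersion U f
         & flat_normal_bundle U f]) /\
    (forall q, (q <= 1)%N ->
       forall (U : set (carrier M)) (f : carrier M -> 'rV[R]_(n + l + q)),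
         open_in U -> U !=set0 -> ~ isometric_immersion U f).
Proof.
pose p := (n - 3)%N; have p0 : (0 < p)%N by rewrite subn_gt0.
have nE : n = p.+3 by rewrite /p; lia.
have dE : (n - 2)%N = p.+1 by rewrite nE subSS subSS subn0.
have [r [phi [eta [r0 sphi seta pos prof]]]] := @warping_exists R p p0.
set I := [set t | - r < t < r] in sphi seta pos prof.
have oI : open I := @open_interval R (- r) r.
pose k := @aperture R p; have k0 : k != 0 by rewrite invr_eq0 pnatr_eq0.
have phi_gt0 t : I t -> 0 < phi t by move=> /pos[].
have phi1_neq0 t : I t -> (phi^`())%classic t != 0 by move=> /pos[_ /lt0r_neq0].
have speed t : I t -> (k * (phi^`()^`())%classic t) ^+ 2 + (phi^`())%classic t ^+ 2
    + (eta^`())%classic t ^+ 2 = 1 by move=> /prof[].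
pose rho : R := p.+2%:R / 2.
have rho0 : rho != 0 by rewrite mulf_neq0 ?invr_eq0 ?pnatr_eq0.
have d1 : (n - 2)%:R = p.+1%:R :> R by rewrite dE.
pose ktu t := - (phi^`()^`()^`())%classic t / (phi^`())%classic t.
pose kty t := - (phi^`()^`())%classic t / phi t.
pose kyy t := (1 - (phi^`())%classic t ^+ 2) / phi t ^+ 2.
have ktuE t : I t -> ktu t = - (profile2 p (phi t) * (phi^`())%classic t) / (phi^`())%classic t.
  by move=> /prof[_ _ _ E _]; rewrite /ktu E.
have ktyE t : I t -> kty t = - profile1 p (phi t) / phi t.
  by move=> /prof[_ _ E _ _]; rewrite /kty E.
have kyyE t : I t -> kyy t = (1 - profile p (phi t)) / phi t ^+ 2.
  by move=> /prof[E _ _ _ _]; rewrite /kyy E.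
have lt1 t : I t -> profile p (phi t) < 1 by move=> /prof[].
have rho_t t : I t -> ktu t + (n - 2)%:R * kty t = rho.
  by move=> It; rewrite ktuE // ktyE // d1 profile_ricci_t //; auto.
have rho_y t : I t -> 2 * kty t + ((n - 2)%:R - 1) * kyy t = rho.
  by move=> It; rewrite kyyE // ktyE // d1 profile_ricci_y //; auto.
have tu_le t : I t -> ktu t <= kty t.
  by move=> It; rewrite ktuE // ktyE // profile_kappa_tu_le //; auto.
have yy_le t : I t -> kyy t <= kty t.
  by move=> It; rewrite kyyE // ktyE // profile_kappa_yy_le //; auto.
have ty_ge0 t : I t -> 0 <= kty t.
  by move=> It; rewrite ktyE // profile_kappa_ty_ge0 //; auto.
have k_neq t : I t -> ktu t * kyy t != kty t ^+ 2.
  by move=> It; rewrite ktuE // kyyE // ktyE // profile_kappa_neq //; auto.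
have I0 : I 0 by rewrite /I /= r0 oppr_lt0 r0.
have I1 : I (r / 2) by rewrite /I /=; lra.
(* These two parameters show that phi is not constant and provide the points with different K(t,
   y). *)
have phi01 : phi 0 < phi (r / 2).
  apply: (@derive_gt0_lt R (- r) r phi (phi^`())%classic); last 3 first.
  - lra.
  - lra.
  - lra.
  - move=> t It; rewrite derive1E; apply: derivableP.
    exact: smooth_derivable sphi It.
  by move=> t /pos[].
pose N := einstein_warped_product n phi (warped_base I).
pose M := riem_product N (euclidean R l).
exists rho, 4^-1, I, phi, (warped_base I) => /=; rewrite -/N -/M.
split; first by split=> //; rewrite invr_eq0 pnatr_eq0.
split.
  split=> // s t /andP[s1 s2] /andP[t1 t2] u /andP[su ut]; rewrite /I /=.
  by rewrite (lt_le_trans s1 su) (le_lt_trans ut t2).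
split.
  split=> //.
  - by move=> [c E]; move: phi01; rewrite !E // ltxx.
  - move=> t It; have [-> _ _ _ _] := prof t It; rewrite /profile -/p.
    have -> : rho / (n - 1)%:R = 2^-1.
      by rewrite /rho nE subSS subn0 mulrAC divff ?mul1r ?pnatr_eq0.
    by rewrite mulrC.
  move=> t It; have [-> -> _ _ _] := prof t It; rewrite andbT.
  by have [E _ _ _ _] := prof t It; rewrite -E exprn_even_gt0 //= phi1_neq0.
split.
  split=> //.
  - exact: open_warped_base.
  (* The strip is star-shaped about the origin because I is an interval containing 0. *)
  - apply: star_connected => x s Lx /andP[s0 s1]; move: Lx; rewrite /warped_base /I /= mxE.
    by move: (x 0 0) => t /andP[t1 t2]; apply/andP; split; nra.
  by exists 0; rewrite /warped_base /= mxE.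
split.
  split.
    exact: (@riemannian_manifold_warped R (n - 2) k phi eta I oI k0 sphi seta phi_gt0 phi1_neq0 speed).
  exact: (@riemannian_manifold_flat R (n - 2) l k phi eta I oI k0 sphi seta phi_gt0 phi1_neq0 speed).
split.
  exact: (@einstein_warped R (n - 2) k phi eta I oI k0 sphi seta phi_gt0 phi1_neq0 speed rho rho_t rho_y).
split.
  move=> a x ax.
  have := @ricci_endo_flat R (n - 2) l k phi eta I oI k0 sphi seta phi_gt0 phi1_neq0 speed rho rho_t rho_y a x ax.
  move=> ->.
  have [E1 E2 E3] := eigen_block (m := 2 + (n - 2)) rho0 isT hl.
  split=> //; rewrite E3 nE; lia.
split.
  apply: (@not_curvature_homogeneous_flat R (n - 2) l k phi eta I oI k0 sphi seta phi_gt0 phi1_neq0 speed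
    tu_le yy_le ty_ge0 0 (r / 2)) => //; first by rewrite dE.
  rewrite -[X in X < _]/(kty (r / 2)) -[X in _ < X]/(kty 0) !ktyE //.
  by apply: profile1_div_lt => //; auto.
split.
  (* The ambient dimension is rewritten before the witness is given, since it occurs in the type of
     the immersion: plane of the circle, space of the sphere, axis, flat factor. *)
  have -> : (n + l + 2 = 2 + ((n - 2) + 1) + 1 + l)%N by rewrite dE nE; lia.
  exists (points M), (@flat_immersion R (n - 2) l k phi eta I); split.
  - apply: open_in_points; exact: (@smooth_manifold_flat R (n - 2) l phi I oI).
  - have [_ _ <- _] := @smooth_manifold_flat R (n - 2) l phi I oI.
    exists (@chart_param _ _ M (tt, false, tt) 0), (tt, false, tt) => //.
    by exists 0 => //=; rewrite /warped_base /= !mxE.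
  - exact: (@flat_immersion_isometric R (n - 2) l k phi eta I oI k0 sphi seta speed).
  exact: (@flat_immersion_flat_normal_bundle R (n - 2) l k phi eta I oI k0 sphi seta phi_gt0 phi1_neq0 speed).
move=> q q1 U f; apply: (@no_codim_le1_flat R (n - 2) l k phi eta I oI k0 sphi seta phi_gt0 phi1_neq0 speed k_neq).
  by rewrite dE.
by rewrite dE nE; lia.
Qed.
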